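(* There exists a Carnot group $G$ with Hausdorff dimension $6$ so that for every $p_1 < 4$ and $p_2 > 2$ there are compact curves $E_1, E_2 \subset G$ such that $E_1$ is rectifiable and $E_2$ is not, but $$\int_G \int_0^\infty \beta_{E_1}(x,r)^{p_1} \,\frac{dr}{r^6} \,dx = \infty, \qquad \int_G \int_0^\infty \beta_{E_2}(x,r)^{p_2} \,\frac{dr}{r^6} \,dx < \infty.$$
   Context: A Carnot group of step $s$ is a simply connected Lie group $G$ whose Lie algebra has a stratification $\mathfrak g = V_1\oplus\cdots\oplus V_s$ with $[V_1,V_j]=V_{j+1}$ for $j\ge 1$ (with $V_k=0$ for $k>s$ and $V_s\ne 0$). Via $\exp$ and a choice of bases of the $V_i$, $G$ is identified with $\mathbb R^n=\mathbb R^{n_1+\cdots+n_s}$, $n_i=\dim V_i$ (exponential coordinates $g=(g_1,\dots,g_s)$, identity $0$). The dilations $\delta_\lambda(g_1,\dots,g_s)=(\lambda g_1,\lambda^2 g_2,\dots,\lambda^s g_s)$, $\lambda>0$, are automorphisms. A homogeneous norm is a function $N:G\to[0,\infty)$ with $N(g^{-1})=N(g)$, $N(\delta_\lambda(g))=\lambda N(g)$, $N(g)=0\Leftrightarrow g=0$, and $N(gh)\le N(g)+N(h)$. It induces the left-invariant homogeneous metric $d(g,h)=N(g^{-1}h)$. Here $d$ is a homogeneous metric on $G$, $B(x,r)$ is the $d$-ball, Hausdorff dimension is with respect to $d$, and $dx$ is Lebesgue measure on $\mathbb R^n$ (a Haar measure of $G$). A horizontal line is a set $\{g\exp(tv): t\in\mathbb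 R\}$ with $g\in G$, $v\in V_1\setminus\{0\}$. For $E\subset G$, $$\beta_E(x,r)=\inf_L\ \sup_{z\in E\cap B(x,r)}\frac{d(z,L)}{r},$$ the infimum being over horizontal lines $L$, $d(z,L)=\inf_{y\in L}d(z,y)$, and a supremum over the empty set being $0$. A curve is rectifiable if it has finite length with respect to $d$. *)

(* Defs.v *)
From HB Require Import structures.
From mathcomp Require Import all_boot all_order all_algebra.
From mathcomp Require Import all_classical all_reals all_analysis.

Set Implicit Arguments.
Unset Strict Implicit.
Unset Printing Implicit Defensive.

Import Order.TTheory GRing.Theory Num.Theory.
Import numFieldNormedType.Exports.

Local Open Scope classical_set_scope.
Local Open Scope ring_scope.

(* A Carnot group is presented in exponential coordinates: the Lie algebra g
   is R^n, the chosen basis of g is the standard one and is adapted to the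
   stratification, and the group is g itself with the Baker-Campbell-Hausdorff
   product, which is a finite sum because g is nilpotent.  Every simply
   connected nilpotent Lie group is of this form, with exp the identity map,
   neutral element 0 and inverse -x. *)

Section Brackets.
Context {R : realType} {n : nat}.
Variable br : 'rV[R]_n -> 'rV[R]_n -> 'rV[R]_n.

(* The layer V_j when the i-th basis vector has weight w i. *)
Definition layer (w : 'I_n -> nat) (j : nat) : {vspace 'rV[R]_n} :=
  <<[seq delta_mx 0%R i | i <- enum 'I_n & w i == j]>>%VS.

(* [U, W]; br being bilinear, the span of all brackets [u, v] with u in U and
   v in W is the span of the brackets of basis vectors. *)
Definition bracket_space (U W : {vspace 'rV[R]_n}) : {vspace 'rV[R]_n} :=
  <<[seq br u v | u <- vbasis U, v <- vbasis W]>>%VS.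

(* [a_1, [a_2, ... [a_(m-1), a_m]]] *)
Fixpoint iter_bracket (l : seq 'rV[R]_n) : 'rV[R]_n :=
  if l is a :: l' then
    if l' is [::] then a else br a (iter_bracket l')
  else 0.

(* Dynkin's form of the Baker-Campbell-Hausdorff series:
     sum_(m >= 1) (-1)^(m-1) / m  sum_(r_i + s_i > 0)
       [x^(r_1) y^(s_1) ... x^(r_m) y^(s_m)]
         / ((sum_i (r_i + s_i)) prod_i r_i! s_i!),
   restricted to m, r_i, s_i <= s.  In a Lie algebra of step s, all the
   terms left out are iterated brackets of more than s elements, hence 0. *)
Definition bch (s : nat) (x y : 'rV[R]_n) : 'rV[R]_n :=
  \sum_(m < s) ((-1) ^+ m / m.+1%:R) *:
    \sum_(k : m.+1.-tuple ('I_s.+1 * 'I_s.+1) |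
            all (fun p : 'I_s.+1 * 'I_s.+1 => 0 < p.1 + p.2)%N k)
      ((\sum_(p <- k) (p.1 + p.2)) * \prod_(p <- k) (p.1`! * p.2`!))%N%:R^-1 *:
        iter_bracket (flatten
          [seq nseq p.1 x ++ nseq p.2 y | p : 'I_s.+1 * 'I_s.+1 <- k]).

End Brackets.

Record carnotGroup (R : realType) := CarnotGroup {
  cg_dim : nat;
  cg_step : nat;
  cg_weight : 'I_cg_dim -> nat;
  cg_bracket : 'rV[R]_cg_dim -> 'rV[R]_cg_dim -> 'rV[R]_cg_dim;
  cg_bracket_linearl : forall y, linear (cg_bracket^~ y);
  cg_bracket_linearr : forall x, linear (cg_bracket x);
  cg_bracketxx : forall x, cg_bracket x x = 0;
  cg_jacobi : forall x y z,
    cg_bracket x (cg_bracket y z) + cg_bracket y (cg_bracket z x)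
      + cg_bracket z (cg_bracket x y) = 0;
  (* coordinates are ordered as (g_1, ..., g_s) *)
  cg_weight_homo : forall i j : 'I_cg_dim,
    (i <= j)%N -> (cg_weight i <= cg_weight j)%N;
  (* with the next field, g = V_1 (+) ... (+) V_s with V_s <> 0 *)
  cg_weight_bounds : forall i, (0 < cg_weight i <= cg_step)%N;
  cg_top_layer : layer (R := R) cg_weight cg_step != 0%VS;
  (* this includes [V_1, V_s] = V_(s+1) = 0 *)
  cg_stratified : forall j, (0 < j)%N ->
    bracket_space cg_bracket (layer cg_weight 1) (layer cg_weight j)
      = layer cg_weight j.+1
}.

Section CarnotGroup.
Context {R : realType} (G : carnotGroup R).
Local Notation pt := 'rV[R]_(cg_dim G).
Implicit Types (x y g v : pt) (N : pt -> R).

Definition cg_mul x y : pt := bch (@cg_bracket R G) (cg_step G) x y.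

Definition cg_inv x : pt := - x.

Definition dilation (lambda : R) x : pt :=
  \row_i (lambda ^+ cg_weight i * x 0 i).

Definition homogeneous_norm N : Prop :=
  [/\ forall x, 0 <= N x,
      forall x, N (cg_inv x) = N x,
      forall (lambda : R) x, 0 < lambda -> N (dilation lambda x) = lambda * N x,
      forall x, N x = 0 <-> x = 0
    & forall x y, N (cg_mul x y) <= N x + N y].

Definition homogeneous_dist N x y : R := N (cg_mul (cg_inv x) y).

Definition horizontal_line (L : set (pt)) : Prop :=
  exists g v, [/\ v \in layer (@cg_weight R G) 1, v != 0 &
    L = [set cg_mul g (t *: v) | t in [set: R]]].

End CarnotGroup.

Section MetricNotions.
Context {R : realType} {T : Type}.
Variable d : T -> T -> R.
Implicit Types (A : set T) (gamma : R -> T).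

Definition dball (x : T) (r : R) : set T := [set y | d x y < r].

Definition dist_set (z : T) A : R := inf [set d z y | y in A].

Definition ediam A : \bar R :=
  Order.max 0%E (ereal_sup [set (d p.1 p.2)%:E | p in A `*` A]).

Definition hausdorff_premeasure (s delta : R) A : \bar R :=
  ereal_inf [set (\sum_(0 <= k <oo) poweR (ediam (F k)) s)%E | F in
    [set F : nat -> set T |
      A `<=` \bigcup_k F k /\ forall k, (ediam (F k) <= delta%:E)%E]].

Definition hausdorff_measure (s : R) A : \bar R :=
  ereal_sup [set hausdorff_premeasure s delta A | delta in [set e | 0 < e]].

(* Only s > 0 is used, so that poweR 0 s = 0; this does not change the
   infimum. *)
Definition hausdorff_dim A : \bar R :=
  ereal_inf [set s%:E | s in [set s | 0 < s /\ hausdorff_measure s A = 0%E]].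

(* The metric analogue of total_variation. *)
Definition curve_length (a b : R) gamma : \bar R :=
  ereal_sup [set (\sum_(0 <= k < size l)
      d (gamma (nth b (a :: l) k)) (gamma (nth b (a :: l) k.+1)))%:E
    | l in itv_partition a b].

End MetricNotions.

Section Curves.
Context {R : realType} {n : nat}.
Local Notation T := 'rV[R]_n.
Implicit Types (E : set T) (gamma : R -> T).

Definition curve_param E gamma : Prop :=
  {within `[0, 1], continuous gamma} /\ E = gamma @` `[0, 1].

Definition compact_curve E : Prop := exists gamma, curve_param E gamma.

(* Curves are sets: E is rectifiable when some parametrization of E has finite
   length, so a curve that is not rectifiable has no such parametrization. *)
Definition rectifiable (d : T -> T -> R) E : Prop :=
  exists2 gamma, curve_param E gamma & (curve_length d 0 1 gamma < +oo)%E.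

End Curves.

(* Lebesgue measure on R^n, as the n-fold product of lebesgue_measure, on the
   product sigma-algebra of n.-tuple (measurableTypeR R). *)
Fixpoint lebesgue_tuple (R : realType) (n : nat) :
    set (n.-tuple (measurableTypeR R)) -> \bar R :=
  if n is m.+1 then
    pushforward (lebesgue_measure \x lebesgue_tuple (R := R) (n := m))%E
      (fun p : measurableTypeR R * m.-tuple (measurableTypeR R) =>
         [tuple of p.1 :: p.2])
  else \d_[tuple].

Definition row_of_tuple (R : realType) (n : nat)
    (t : n.-tuple (measurableTypeR R)) : 'rV[R]_n :=
  \row_i tnth t i.

Section Beta.
Context {R : realType} (G : carnotGroup R).
Local Notation pt := 'rV[R]_(cg_dim G).
Variable d : pt -> pt -> R.
Implicit Types (E : set (pt)) (x : pt).

(* As the real numbers d(z, L) / r are bounded for z in a ball, sup is the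
   supremum, and sup set0 = 0. *)
Definition beta E x (r : R) : R :=
  inf [set sup [set dist_set d z L / r | z in E `&` dball d x r] |
    L in @horizontal_line R G].

Definition beta_integral E (p : R) : \bar R :=
  (\int[@lebesgue_tuple R (cg_dim G)]_t
     \int[lebesgue_measure]_(r in `]0%R, +oo[)
       (beta E (row_of_tuple t) r `^ p / r ^+ 6)%:E)%E.

End Beta.

(* Main.v *)
(* In the product of the first Heisenberg group H and the plane, of homogeneous
   dimension 6, consider f(t) = sum_j eta_j 64^-j sin(64^j t) on [0, 2 pi].  E1
   is the horizontal lift to H of the graph of f, and E2 is the graph of f in
   the plane.

   At a point of either curve and at scale 64^-k, the graph of f deviates from
   a line by about eta_k 64^-k.  In the plane this gives beta ~ eta_k.  In H the
   deviation enters the vertical coordinate of the lift as an area of order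
   eta_k 64^-2k, which the homogeneous distance measures by its square root,
   whence beta ~ eta_k^(1/2).  The balls of radius 64^-k that meet the curve
   have total volume about 64^-5k, up to a factor 1 + sum_(j < k) eta_j^2, so
   the integral of beta^p compares to sum_k eta_k^(p/2) for E1 and to
   sum_k eta_k^p for E2.  On the other hand sum_j eta_j^2 decides about the
   length: the increments of f are dominated by those of the antiderivative of
   (1 + f'^2) / 2, and they are bounded below by pairing them with a Riesz
   product.  The choices
   eta_j = (j+1)^(-2 / max(p1, 2)) and eta_j = (j+1)^(-1/2) work.

   Any two homogeneous norms on the group are comparable, so all estimates
   reduce to the norm max(|x_0|, |x_1|, |x_2|, |x_3|, |x_4|^(1/2)), whose balls
   of radius rho have volume 32 rho^6. *)
Require Import Defs.
From HB Require Import structures.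
From mathcomp Require Import all_boot all_order all_algebra.
From mathcomp Require Import ring lra zify.
From mathcomp Require Import all_classical all_reals all_analysis measurable_realfun.
Set Implicit Arguments.
Unset Strict Implicit.
Unset Printing Implicit Defensive.
Import Order.TTheory GRing.Theory Num.Theory.
Import numFieldNormedType.Exports.
Local Open Scope classical_set_scope.
Local Open Scope ring_scope.

(** * The group *)

(** The obstacle for [E1] is that the derivatives of the partial sums of f are unbounded: only the
    squares of the eta_j are summable. A lower bound for beta is therefore not claimed at every
    point of the curve. It is proved on windows of three steps of the grid pi / 64^k over which the
    majorant grows by at most a fixed multiple of the step. The total growth of the majorant is
    bounded, so these windows fill a fixed share of the curve at every scale. On such a window,
    third differences isolate the scale. In suitable coordinates a horizontal line is a quadratic,
    which they annihilate. On the grid the frequencies above 64^k drop out of the antiderivative of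
    f, cos (64^k t) has third difference 8 in absolute value, and the ratio 64 together with eta_j
    <= 2 eta_(j+1) keeps the lower frequencies to half of the resulting term. The obstacle for [E2]
    is that every parametrization has to be excluded, also one that runs back and forth. The curve
    being a graph, times can be selected at which the abscissa visits a grid in order. *)

Definition c0 : 'I_5 := Ordinal (isT : (0 < 5)%N).
Definition c1 : 'I_5 := Ordinal (isT : (1 < 5)%N).
Definition c2 : 'I_5 := Ordinal (isT : (2 < 5)%N).
Definition c3 : 'I_5 := Ordinal (isT : (3 < 5)%N).
Definition c4 : 'I_5 := Ordinal (isT : (4 < 5)%N).

Lemma forall_I5 (P : 'I_5 -> Prop) :
  P c0 -> P c1 -> P c2 -> P c3 -> P c4 -> forall i, P i.
Proof.
move=> h0 h1 h2 h3 h4 [[|[|[|[|[|m]]]]] Hm] //.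
- by rewrite (_ : Ordinal Hm = c0) //; exact: val_inj.
- by rewrite (_ : Ordinal Hm = c1) //; exact: val_inj.
- by rewrite (_ : Ordinal Hm = c2) //; exact: val_inj.
- by rewrite (_ : Ordinal Hm = c3) //; exact: val_inj.
- by rewrite (_ : Ordinal Hm = c4) //; exact: val_inj.
Qed.

Section Point.
Context {R : realType}.

Definition pt5 (a b c d z : R) : 'rV[R]_5 := \row_i [:: a; b; c; d; z]`_i.

Lemma pt5E a b c d z : (pt5 a b c d z 0 c0 = a) * (pt5 a b c d z 0 c1 = b) *
  (pt5 a b c d z 0 c2 = c) * (pt5 a b c d z 0 c3 = d) * (pt5 a b c d z 0 c4 = z).
Proof. by rewrite !mxE. Qed.

Lemma row5P (x y : 'rV[R]_5) :
  x 0 c0 = y 0 c0 -> x 0 c1 = y 0 c1 -> x 0 c2 = y 0 c2 -> x 0 c3 = y 0 c3 ->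
  x 0 c4 = y 0 c4 -> x = y.
Proof. by move=> *; apply/rowP; exact: forall_I5. Qed.

Definition om (x y : 'rV[R]_5) : R := x 0 c0 * y 0 c1 - x 0 c1 * y 0 c0.

Definition hbr (x y : 'rV[R]_5) : 'rV[R]_5 := om x y *: delta_mx 0 c4.

Definition hweight (i : 'I_5) : nat := if (i < 4)%N then 1 else 2.

Lemma hbrE x y : hbr x y = pt5 0 0 0 0 (om x y).
Proof. by apply: row5P; rewrite !mxE /= ?mulr1 ?mulr0. Qed.

Lemma hbr_linearl y : linear (hbr^~ y).
Proof.
by move=> a u v; rewrite /hbr scalerA -scalerDl /om !mxE; congr (_ *: _); ring.
Qed.

Lemma hbr_linearr x : linear (hbr x).
Proof.
by move=> a u v; rewrite /hbr scalerA -scalerDl /om !mxE; congr (_ *: _); ring.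
Qed.

Lemma hbrxx x : hbr x x = 0.
Proof. by rewrite /hbr /om mulrC subrr scale0r. Qed.

Lemma hbr_nilp x y z : hbr x (hbr y z) = 0.
Proof. by rewrite hbrE [hbr y z]hbrE /om !pt5E; apply: row5P; rewrite !pt5E !mxE; ring. Qed.

Lemma hbr_jacobi x y z :
  hbr x (hbr y z) + hbr y (hbr z x) + hbr z (hbr x y) = 0.
Proof. by rewrite !hbr_nilp !addr0. Qed.

Lemma hweight_homo (i j : 'I_5) : (i <= j)%N -> (hweight i <= hweight j)%N.
Proof. by rewrite /hweight; case: ifP; case: ifP => //; lia. Qed.

Lemma hweight_bounds i : (0 < hweight i <= 2)%N.
Proof. by rewrite /hweight; case: ifP. Qed.

Lemma mem_layer (n : nat) (w : 'I_n -> nat) j (x : 'rV[R]_n) :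
  reflect (forall i, w i != j -> x 0 i = 0) (x \in layer w j).
Proof.
apply: (iffP idP) => [|H].
  rewrite /layer; set X := map _ _ => /(@coord_span _ _ _ (in_tuple X)) -> i wi.
  rewrite summxE big1 // => k _; rewrite mxE.
  have /mapP[l] : X`_k \in X by exact: mem_nth.
  rewrite mem_filter => /andP[wl _] ->; rewrite mxE eqxx /= [i == l]negbTE ?mulr0 //.
  by apply: contraNneq wi => ->.
have -> : x = \sum_i x 0 i *: delta_mx 0 i.
  exact: row_sum_delta.
apply: memv_suml => i _; have [wi|wi] := eqVneq (w i) j; last first.
  by rewrite H // scale0r mem0v.
apply: memvZ; apply: memv_span; apply/mapP; exists i => //.
by rewrite mem_filter wi eqxx mem_enum.
Qed.

Lemma bracket_in (n : nat) (br : 'rV[R]_n -> 'rV[R]_n -> 'rV[R]_n)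
    (U W : {vspace 'rV[R]_n}) u v :
  (forall y, linear (br^~ y)) -> (forall x, linear (br x)) ->
  u \in U -> v \in W -> br u v \in bracket_space br U W.
Proof.
move=> ll lr uU vW.
(* Both partial maps are packed as linear functions, so that sums and scalars can be pulled out of
   either argument. *)
pose fl y := GRing.isLinear.Build _ _ _ _ (br^~ y) (ll y).
pose Fl y : {linear 'rV[R]_n -> 'rV[R]_n} := HB.pack (br^~ y) (fl y).
pose fr x := GRing.isLinear.Build _ _ _ _ (br x) (lr x).
pose Fr x : {linear 'rV[R]_n -> 'rV[R]_n} := HB.pack (br x) (fr x).
have -> : br u v = Fl v u by [].
rewrite (coord_vbasis uU) linear_sum /=; apply: memv_suml => i _.
have -> : br (coord (vbasis U) i u *: (vbasis U)`_i) v =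
   Fl v (coord (vbasis U) i u *: (vbasis U)`_i) by [].
rewrite linearZ; apply: memvZ.
have -> : Fl v (vbasis U)`_i = Fr (vbasis U)`_i v by [].
rewrite (coord_vbasis vW) linear_sum /=; apply: memv_suml => k _.
have -> : br (vbasis U)`_i (coord (vbasis W) k v *: (vbasis W)`_k) =
   Fr (vbasis U)`_i (coord (vbasis W) k v *: (vbasis W)`_k) by [].
rewrite linearZ; apply: memvZ; apply: memv_span; apply/allpairsP.
by exists ((vbasis U)`_i, (vbasis W)`_k); split => //=; apply: mem_nth; rewrite size_tuple.
Qed.

Lemma bracket_sub (n : nat) (br : 'rV[R]_n -> 'rV[R]_n -> 'rV[R]_n)
    (U W Z : {vspace 'rV[R]_n}) :
  (forall u v, u \in U -> v \in W -> br u v \in Z) ->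
  (bracket_space br U W <= Z)%VS.
Proof.
move=> H; apply/span_subvP => x /allpairsP[[u v] /= [uU vW ->]].
by apply: H; apply: vbasis_mem.
Qed.

Lemma htop_layer : layer (R := R) hweight 2 != 0%VS.
Proof.
apply/eqP => H; have : delta_mx 0 c4 \in layer (R := R) hweight 2.
  by apply/mem_layer; apply: forall_I5 => //= _; rewrite mxE.
rewrite H memv0 => /eqP /rowP /(_ c4) /eqP.
by rewrite !mxE /= oner_eq0.
Qed.

Lemma hstratified j : (0 < j)%N ->
  bracket_space hbr (layer hweight 1) (layer hweight j) = layer hweight j.+1.
Proof.
move=> j0; apply/eqP; rewrite eqEsubv; apply/andP; split.
  apply: bracket_sub => u v uU vW; apply/mem_layer => i wi.
  rewrite /hbr mxE; have [i4|i4] := eqVneq i c4; last by rewrite mxE [i == _]negbTE // andbF mulr0.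
  move: wi; rewrite i4 /hweight /= => wi; rewrite /om.
  have j1 : (1 != j)%N by apply: contraNneq wi => <-.
  have v0 i' : hweight i' = 1%N -> v 0 i' = 0.
    by move=> wi'; move/mem_layer : vW; apply; rewrite wi'.
  by rewrite !v0 // !mulr0 subrr mul0r.
apply/subvP => x /mem_layer xl.
have [->|j1] := eqVneq x 0; first exact: mem0v.
(* Layers beyond the second are zero, so a nonzero x forces j = 1. *)
have jE : j = 1%N.
  apply/eqP; apply: contraNT j1 => j1; apply/eqP/rowP => i; rewrite mxE xl //.
  by rewrite /hweight; case: ifP => _; apply/eqP; lia.
have -> : x = hbr (x 0 c4 *: delta_mx 0 c0) (delta_mx 0 c1).
  rewrite hbrE /om !mxE /= !(mulr0,mulr1,subr0).
  apply: row5P; rewrite !mxE //= ?xl // jE //.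
apply: bracket_in; [exact: hbr_linearl|exact: hbr_linearr|..].
  by apply: memvZ; apply/mem_layer; apply: forall_I5 => //= _; rewrite mxE.
by rewrite jE; apply/mem_layer; apply: forall_I5 => //= _; rewrite mxE.
Qed.

(* The center is spanned by the bracket of the first two basis vectors; the
   next two basis vectors span the factor R^2. *)
Definition heisR2 : carnotGroup R :=
  CarnotGroup hbr_linearl hbr_linearr hbrxx hbr_jacobi hweight_homo
    hweight_bounds htop_layer hstratified.

Lemma big_tuple1 (V : nmodType) (T : finType) (P : pred (1.-tuple T)) (F : 1.-tuple T -> V) :
  \sum_(k : 1.-tuple T | P k) F k = \sum_(p : T | P [tuple p]) F [tuple p].
Proof.
rewrite (reindex (fun p : T => [tuple p])) //.
exists (fun k : 1.-tuple T => tnth k ord0) => [p _|k _] //.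
by apply: eq_from_tnth => i; rewrite [i]ord1.
Qed.

Lemma big_tuple2 (V : nmodType) (T : finType) (P : pred (2.-tuple T)) (F : 2.-tuple T -> V) :
  \sum_(k : 2.-tuple T | P k) F k =
  \sum_(p : T * T | P [tuple p.1; p.2]) F [tuple p.1; p.2].
Proof.
rewrite (reindex (fun p : T * T => [tuple p.1; p.2])) //=.
exists (fun k : 2.-tuple T => (tnth k ord0, tnth k ord_max)) => [[p q] _|k _] //.
apply: eq_from_tnth => i; rewrite !(tnth_nth (thead k)) /=.
by case: i => [[|[|]]].
Qed.

Lemma big_pair (V : nmodType) (S T : finType) (P : pred (S * T)) (F : S * T -> V) :
  \sum_(p | P p) F p = \sum_i \sum_j if P (i, j) then F (i, j) else 0.
Proof. by rewrite big_mkcond pair_bigA; apply: eq_bigr => -[]. Qed.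

Lemma hbrC x y : hbr y x = - hbr x y.
Proof. by rewrite /hbr -scaleNr /om; congr (_ *: _); ring. Qed.

Lemma hbr0 x : hbr x 0 = 0.
Proof. by rewrite /hbr /om !mxE !mulr0 subrr scale0r. Qed.

(** Brackets of three or more entries vanish, and two single entries give [a, b] + [b, a] = 0. This
    pairs off the terms with m = 1 of the Dynkin series. *)
Lemma iter_hbr_swap u v : (0 < size u)%N -> (0 < size v)%N ->
  iter_bracket hbr (u ++ v) + iter_bracket hbr (v ++ u) = 0 :> 'rV[R]_5.
Proof.
have long (l : seq 'rV[R]_5) : (2 < size l)%N -> iter_bracket hbr l = 0.
  by case: l => [|a [|b [|c l]]] //= _; case: l => [|d l]; rewrite hbr_nilp.
move=> u0 v0; have [uv|uv] := boolP (2 < size (u ++ v))%N.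
  by rewrite !long ?addr0 // !size_cat addnC -size_cat.
move: uv; rewrite size_cat; case: u u0 => [|a [|a' u]] //; case: v v0 => [|b [|b' v]] //=.
  by move=> _ _; rewrite [hbr b a]hbrC subrr.
all: by move=> _ _; lia.
Qed.

(** In step 2 only m = 0 and m = 1 occur. The terms with m = 0 already give the whole product, and
    those with m = 1 cancel. *)
Lemma bch_hbr (x y : 'rV[R]_5) : bch hbr 2 x y = x + y + 2^-1 *: hbr x y.
Proof.
rewrite /bch big_ord_recr big_ord1 /= big_tuple1 big_tuple2 expr0 expr1.
set S2 := (X in _ + _ *: X).
have -> : S2 = 0.
  (* Exchanging the two exponent pairs keeps the coefficient and changes the sign of the bracket. *)
  have S2E : S2 = - S2.
    have sw : cancel (fun p : ('I_3 * 'I_3) * ('I_3 * 'I_3) => (p.2, p.1)) (fun p => (p.2, p.1)).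
      by case.
    rewrite {1}/S2 (reindex_inj (can_inj sw)) /= -sumrN.
    apply: eq_big => [[p q]|[p q]] /=; first by rewrite !andbT andbC.
    rewrite !andbT => /andP[q0 p0]; rewrite !cats0 -scalerN.
    rewrite !big_cons !big_nil !addn0 !muln1 [(q.1 + q.2 + _)%N]addnC.
    rewrite [(q.1`! * q.2`! * _)%N]mulnC; congr (_ *: _); apply/eqP; rewrite -subr_eq0 opprK; apply/eqP.
    by apply: iter_hbr_swap; rewrite size_cat !size_nseq.
  have : 2 *: S2 = 0 by rewrite scaler_nat mulr2n {1}S2E addNr.
  by move/eqP; rewrite scaler_eq0 pnatr_eq0 => /eqP.
rewrite scaler0 addr0 big_pair !big_ord_recl !big_ord0 /=.
rewrite !(hbr_nilp, hbrxx, hbr0, scaler0, addr0, add0r, big_cons, big_nil) /=.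
rewrite !factS !fact0.
by rewrite /bump /= !addn0 !add0n !muln1 !divr1 !invr1 !scale1r addrCA addrA.
Qed.

(** * Homogeneous norms *)

Notation cgm := (@cg_mul R heisR2).
Notation cgi := (@cg_inv R heisR2).

Lemma cgmE (x y : 'rV[R]_5) : cgm x y = x + y + 2^-1 *: hbr x y.
Proof. exact: bch_hbr. Qed.

Lemma cgm_coord x y : (cgm x y 0 c0 = x 0 c0 + y 0 c0) * (cgm x y 0 c1 = x 0 c1 + y 0 c1) *
  (cgm x y 0 c2 = x 0 c2 + y 0 c2) * (cgm x y 0 c3 = x 0 c3 + y 0 c3) *
  (cgm x y 0 c4 = x 0 c4 + y 0 c4 + 2^-1 * om x y).
Proof. by rewrite cgmE hbrE !mxE /= !mulr0 !addr0. Qed.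

Lemma cgi_coord x i : cgi x 0 i = - x 0 i.
Proof. by rewrite mxE. Qed.

Lemma om_cgi x y : om (cgi x) y = - om x y.
Proof. by rewrite /om !cgi_coord; ring. Qed.

Lemma cgmA x y z : cgm x (cgm y z) = cgm (cgm x y) z.
Proof. by apply: row5P; rewrite !cgm_coord /om ?cgm_coord; ring. Qed.

Lemma cgmV x : cgm x (cgi x) = 0.
Proof. by apply: row5P; rewrite !cgm_coord /om !mxE; ring. Qed.

Lemma cg0m x : cgm 0 x = x.
Proof. by apply: row5P; rewrite !cgm_coord /om !mxE; ring. Qed.

Lemma cgm0 x : cgm x 0 = x.
Proof. by apply: row5P; rewrite !cgm_coord /om !mxE; ring. Qed.

Lemma cgVmK x y : cgm x (cgm (cgi x) y) = y.
Proof. by rewrite cgmA cgmV cg0m. Qed.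

Lemma cgiM x y : cgi (cgm x y) = cgm (cgi y) (cgi x).
Proof. by apply: row5P; rewrite cgi_coord !cgm_coord /om !mxE; ring. Qed.

Lemma cgiK x : cgi (cgi x) = x.
Proof. by rewrite /cg_inv opprK. Qed.

Definition cgsub x y := cgm (cgi x) y.

Lemma cgsub_coord x y : (cgsub x y 0 c0 = y 0 c0 - x 0 c0) *
  (cgsub x y 0 c1 = y 0 c1 - x 0 c1) * (cgsub x y 0 c2 = y 0 c2 - x 0 c2) *
  (cgsub x y 0 c3 = y 0 c3 - x 0 c3) *
  (cgsub x y 0 c4 = y 0 c4 - x 0 c4 - 2^-1 * om x y).
Proof. by rewrite /cgsub !cgm_coord om_cgi !cgi_coord mulrN; do !split; ring. Qed.

Definition maxnorm (x : 'rV[R]_5) : R :=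
  Num.max `|x 0 c0| (Num.max `|x 0 c1| (Num.max `|x 0 c2| (Num.max `|x 0 c3|
    (Num.sqrt `|x 0 c4|)))).

Lemma maxnorm_le x r : maxnorm x <= r <->
  [/\ `|x 0 c0| <= r, `|x 0 c1| <= r, `|x 0 c2| <= r, `|x 0 c3| <= r &
      Num.sqrt `|x 0 c4| <= r].
Proof.
rewrite /maxnorm !ge_max; split; first by move=> /and5P[].
by case=> -> -> -> ->.
Qed.

Lemma maxnorm_ge0 x : 0 <= maxnorm x.
Proof. by rewrite /maxnorm le_max normr_ge0. Qed.

Lemma sqrt_le_sqr (a r : R) : 0 <= r -> (Num.sqrt `|a| <= r) = (`|a| <= r ^+ 2).
Proof.
by move=> r0; rewrite -[in LHS](ger0_norm r0) -(sqrtr_sqr r) ler_sqrt // exprn_ge0.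
Qed.

Lemma maxnorm_leP x r : 0 <= r -> maxnorm x <= r <->
  [/\ `|x 0 c0| <= r, `|x 0 c1| <= r, `|x 0 c2| <= r, `|x 0 c3| <= r &
      `|x 0 c4| <= r ^+ 2].
Proof. by move=> r0; rewrite maxnorm_le sqrt_le_sqr. Qed.

Lemma maxnorm_bound (x : 'rV[R]_5) : [/\ `|x 0 c0| <= maxnorm x, `|x 0 c1| <= maxnorm x,
  `|x 0 c2| <= maxnorm x, `|x 0 c3| <= maxnorm x & `|x 0 c4| <= maxnorm x ^+ 2].
Proof. by apply/maxnorm_leP => //; exact: maxnorm_ge0. Qed.

Lemma maxnorm_eq0 x : maxnorm x = 0 <-> x = 0.
Proof.
split=> [x0|->].
  have := maxnorm_bound x; rewrite x0 expr0n /= !normr_le0.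
  by case=> /eqP ? /eqP ? /eqP ? /eqP ? /eqP ?; apply: row5P; rewrite mxE.
by rewrite /maxnorm !mxE normr0 sqrtr0 !maxxx.
Qed.

Lemma maxnorm_homogeneous : homogeneous_norm (G := heisR2) maxnorm.
Proof.
split.
- exact: maxnorm_ge0.
- by move=> x; rewrite /maxnorm !cgi_coord !normrN.
- move=> l x l0.
  (* One inequality suffices: applied to the inverse factor, it yields the other. *)
  have le1 (m : R) (y : 'rV[R]_5) : 0 < m -> maxnorm (dilation (G := heisR2) m y) <= m * maxnorm y.
    move=> m0; have m0' := ltW m0.
    have [h0 h1 h2 h3 h4] := maxnorm_bound y.
    apply/maxnorm_leP; first by rewrite mulr_ge0 // maxnorm_ge0.
    rewrite !mxE /= /hweight /= !expr1 !normrM !(ger0_norm m0').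
    by rewrite -expr2 exprMn; split; rewrite ler_pM2l // exprn_gt0.
  apply/eqP; rewrite eq_le le1 //=.
  have := le1 l^-1 (dilation (G := heisR2) l x); rewrite invr_gt0 => /(_ l0).
  rewrite (_ : dilation _ (dilation _ x) = x); last first.
    apply/rowP => i; rewrite !mxE mulrA -exprMn mulVf ?expr1n ?mul1r //.
    by rewrite gt_eqF.
  by rewrite -(ler_pM2l l0) mulrA divff ?mul1r // gt_eqF.
- exact: maxnorm_eq0.
- move=> x y; have [h0 h1 h2 h3 h4] := maxnorm_bound x.
  have [k0 k1 k2 k3 k4] := maxnorm_bound y.
  have x0 := maxnorm_ge0 x; have y0 := maxnorm_ge0 y.
  apply/maxnorm_leP; first exact: addr_ge0.
  rewrite !cgm_coord; split; try by apply: le_trans (ler_normD _ _) _; exact: lerD.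
  apply: le_trans (ler_normD _ _) _.
  (* Half of the area form is at most the product of the two norms, and the cross term of the square
     is twice that product. *)
  rewrite sqrrD -addrA [_ *+ 2 + _]addrC addrA lerD //.
    by apply: le_trans (ler_normD _ _) _; exact: lerD.
  rewrite /om normrM ger0_norm ?invr_ge0 //.
  have b : `|x 0 c0 * y 0 c1 - x 0 c1 * y 0 c0| <= 2 * (maxnorm x * maxnorm y).
    apply: le_trans (ler_normB _ _) _; rewrite !normrM mulrDl mul1r.
    by apply: lerD; apply: ler_pM.
  by have p0 := mulr_ge0 x0 y0; rewrite mulr2n; lra.
Qed.

Section HomNorm.
Variable N : 'rV[R]_5 -> R.
Hypothesis hN : homogeneous_norm (G := heisR2) N.

Lemma hn_ge0 x : 0 <= N x. Proof. by case: hN. Qed.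

Lemma hn_inv x : N (cgi x) = N x. Proof. by case: hN => _ ->. Qed.

Lemma hn_dil l x : 0 < l -> N (dilation (G := heisR2) l x) = l * N x.
Proof. by case: hN => _ _ H _ _; exact: H. Qed.

Lemma hn_mul x y : N (cgm x y) <= N x + N y. Proof. by case: hN. Qed.

Lemma hn0 : N 0 = 0. Proof. by case: hN => _ _ _ H _; apply/H. Qed.

Lemma hn_eq0 x : N x = 0 -> x = 0. Proof. by case: hN => _ _ _ H _ /H. Qed.

Lemma hn_axis (i : 'I_5) (a : R) :
  N (a *: delta_mx 0 i) = (if hweight i == 1%N then `|a| else Num.sqrt `|a|) * N (delta_mx 0 i).
Proof.
have pos (b : R) : 0 < b -> N (b *: delta_mx 0 i) =
    (if hweight i == 1%N then b else Num.sqrt b) * N (delta_mx 0 i).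
  move=> b0.
  rewrite -hn_dil; last by case: ifP => // _; rewrite sqrtr_gt0.
  congr N; apply/rowP => j; rewrite !mxE eqxx /=.
  have [->|ji] := eqVneq j i; last by rewrite !mulr0.
  change (cg_weight (c := heisR2)) with hweight.
  have [->|->] : hweight i = 1%N \/ hweight i = 2%N.
    by rewrite /hweight; case: ifP; [left|right].
    by rewrite eqxx expr1.
  by rewrite /= sqr_sqrtr // ltW.
have [a0|a0|->] := ltgtP a 0.
- rewrite -hn_inv /cg_inv -scaleNr pos ?oppr_gt0 //.
  by rewrite ltr0_norm.
- by rewrite pos // gtr0_norm.
- by rewrite scale0r hn0 normr0 sqrtr0 if_same mul0r.
Qed.

(** The triangle inequality is applied to a factorization of x along the five axes. *)
Lemma hn_upper : exists2 C, 0 < C & forall x, N x <= C * maxnorm x.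
Proof.
exists (N (delta_mx 0 c0) + N (delta_mx 0 c1) + N (delta_mx 0 c2) + N (delta_mx 0 c3)
  + 2 * N (delta_mx 0 c4) + 1).
  by rewrite ltr_wpDl // !addr_ge0 ?mulr_ge0 ?hn_ge0.
move=> x; have [h0 h1 h2 h3 h4] := maxnorm_bound x.
have m0 := maxnorm_ge0 x.
(* The product of the first two axis factors already puts half of x_0 x_1 into the last
   coordinate. *)
set w := x 0 c4 - 2^-1 * (x 0 c0 * x 0 c1).
have xE : x = cgm (x 0 c0 *: delta_mx 0 c0) (cgm (x 0 c1 *: delta_mx 0 c1)
   (cgm (x 0 c2 *: delta_mx 0 c2) (cgm (x 0 c3 *: delta_mx 0 c3) (w *: delta_mx 0 c4)))).
  by apply: row5P; rewrite !cgm_coord /om ?cgm_coord !mxE /= ?mulr0 ?mulr1 /om ?mxE /= /w; ring.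
have t a b s : N b <= s -> N (cgm a b) <= N a + s.
  by move=> bs; apply: le_trans (hn_mul _ _) _; rewrite lerD2l.
rewrite [in N x]xE; apply: le_trans (t _ _ _ (t _ _ _ (t _ _ _ (t _ _ _ (lexx _))))) _.
rewrite !hn_axis /=.
have w2 : Num.sqrt `|w| <= 2 * maxnorm x.
  rewrite sqrt_le_sqr ?mulr_ge0 // /w.
  apply: le_trans (ler_normB _ _) _.
  rewrite !normrM ger0_norm ?invr_ge0 //.
  have := ler_pM (normr_ge0 _) (normr_ge0 _) h0 h1.
  by rewrite exprMn expr2 in h4 *; nra.
have e0 := ler_wpM2r (hn_ge0 (delta_mx 0 c0)) h0.
have e1 := ler_wpM2r (hn_ge0 (delta_mx 0 c1)) h1.
have e2 := ler_wpM2r (hn_ge0 (delta_mx 0 c2)) h2.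
have e3 := ler_wpM2r (hn_ge0 (delta_mx 0 c3)) h3.
have e4 := ler_wpM2r (hn_ge0 (delta_mx 0 c4)) w2.
lra.
Qed.

Lemma hn_sub x y : `|N y - N x| <= N (cgsub x y).
Proof.
have H a b : N b - N a <= N (cgsub a b).
  by rewrite lerBlDl -{1}(cgVmK a b); exact: hn_mul.
rewrite ler_norml H andbT lerNl opprB; apply: le_trans (H _ _) _.
by rewrite -hn_inv /cgsub cgiM cgiK.
Qed.

Lemma hn_continuous : continuous N.
Proof.
have [C C0 NC] := hn_upper.
move=> x; apply/(@cvgrPdist_lt _ _ _ (nbhs x) _) => e e0.
(* K dominates the coefficients with which the differences y_i - x_i enter the last coordinate of
   x^-1 y; that coordinate has to be at most eps^2. *)
set K := 1 + `|x 0 c0| + `|x 0 c1|.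
have K1 : 1 <= K by rewrite /K -addrA lerDl addr_ge0.
set eps := e / (2 * C).
have eps0 : 0 < eps by rewrite divr_gt0 ?mulr_gt0.
set del := Num.min eps (eps ^+ 2 / K).
have del0 : 0 < del by rewrite lt_min eps0 divr_gt0 ?exprn_gt0 // (lt_le_trans ltr01).
exists (fun i j => ball (x i j) del); first by move=> i j; exact: nbhsx_ballx.
move=> y /= xy.
rewrite distrC; apply: le_lt_trans (hn_sub _ _) _; apply: le_lt_trans (NC _) _.
have dC i : `|y 0 i - x 0 i| <= del by rewrite distrC; apply: ltW; exact: xy.
have M : maxnorm (cgsub x y) <= eps.
  apply/maxnorm_leP; first exact: ltW.
  have de : del <= eps by rewrite ge_min lexx.
  have dK : del * K <= eps ^+ 2 by rewrite -ler_pdivlMr ?ge_min ?lexx ?orbT // (lt_le_trans ltr01).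
  rewrite !cgsub_coord; split; try exact: le_trans (dC _) de.
  have -> : y 0 c4 - x 0 c4 - 2^-1 * om x y = (y 0 c4 - x 0 c4) -
     2^-1 * (x 0 c0 * (y 0 c1 - x 0 c1)) + 2^-1 * (x 0 c1 * (y 0 c0 - x 0 c0)).
    by rewrite /om; ring.
  apply: le_trans _ dK; rewrite /K [del * _]mulrDr [del * (1 + _)]mulrDr mulr1.
  apply: le_trans (ler_normD _ _) (lerD (le_trans (ler_normB _ _) (lerD (dC _) _)) _).
    rewrite !normrM ger0_norm ?invr_ge0 //.
    have := ler_wpM2l (normr_ge0 (x 0 c0)) (dC c1).
    by have := mulr_ge0 (normr_ge0 (x 0 c0)) (ltW del0); lra.
  rewrite !normrM ger0_norm ?invr_ge0 //.
  have := ler_wpM2l (normr_ge0 (x 0 c1)) (dC c0).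
  by have := mulr_ge0 (normr_ge0 (x 0 c1)) (ltW del0); lra.
apply: le_lt_trans (ler_wpM2l (ltW C0) M) _.
have -> : C * eps = e / 2 by rewrite /eps; field; rewrite gt_eqF.
by rewrite ltr_pdivrMr // ltr_pMr // ltr1n.
Qed.
End HomNorm.

Lemma maxnorm_dil l (x : 'rV[R]_5) : 0 < l -> maxnorm (dilation (G := heisR2) l x) = l * maxnorm x.
Proof. exact: (hn_dil maxnorm_homogeneous). Qed.

(** N has a positive minimum on the unit sphere of [maxnorm], which is compact, and dilations carry
    the bound to all other points. *)
Lemma hn_lower (N : 'rV[R]_5 -> R) : homogeneous_norm (G := heisR2) N ->
  exists2 c, 0 < c & forall x, c * maxnorm x <= N x.
Proof.
move=> hN; set K := [set x : 'rV[R]_5 | maxnorm x = 1].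
have clK : closed K.
  have /continuous_closedP := hn_continuous maxnorm_homogeneous.
  by move=> /(_ [set x | x = 1]); apply; exact: closed_eq.
have bK : bounded_set K.
  exists 1; split => // r r1 x /= xK; apply: le_trans (ltW r1).
  rewrite [leLHS]/Num.Def.normr /= mx_normrE; apply: bigmax_le => // -[i j] _ /=.
  have [h0 h1 h2 h3 h4] := maxnorm_bound x; rewrite xK expr1n in h0 h1 h2 h3 h4.
  by rewrite [i]ord1; move: j; apply: forall_I5.
have K0 : K !=set0.
  exists (delta_mx 0 c0); rewrite /K /= /maxnorm !mxE /= normr1 normr0 sqrtr0.
  by rewrite !maxxx max_l.
have [k] := EVT_min_rV K0 (bounded_closed_compact bK clK)
  (continuous_subspaceT (hn_continuous hN)).
rewrite inE => kK kmin.
have k0 : 0 < N k.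
  rewrite lt_neqAle hn_ge0 // andbT eq_sym; apply/eqP => /(hn_eq0 hN) k0.
  by move: kK; rewrite k0 /K /= (proj2 (maxnorm_eq0 0)) // => /esym/eqP; rewrite oner_eq0.
exists (N k) => // x.
have [x0|x0] := eqVneq (maxnorm x) 0.
  by rewrite x0 mulr0 hn_ge0.
have x0' : 0 < maxnorm x by rewrite lt_neqAle eq_sym x0 maxnorm_ge0.
have := kmin (dilation (G := heisR2) (maxnorm x)^-1 x).
rewrite (hn_dil hN) ?invr_gt0 // inE /K /= maxnorm_dil ?invr_gt0 // mulVf // => /(_ erefl).
by rewrite ler_pdivlMl // mulrC.
Qed.

End Point.

(** * Measure and integration *)

Section TupleMeasure.
Context {R : realType}.

Lemma lebesgue_tuple_cons n (A : set (n.+1.-tuple (measurableTypeR R))) :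
  lebesgue_tuple A = (\int[lebesgue_measure]_(x in [set: measurableTypeR R])
     lebesgue_tuple [set t : n.-tuple (measurableTypeR R) | A [tuple of x :: t]])%E.
Proof.
rewrite /= /pushforward /product_measure1; apply: eq_integral => x _ /=.
congr (lebesgue_tuple _); apply/seteqP; split => t /=; by rewrite /xsection /= in_setE.
Qed.

Section SigmaFiniteCopy.
Context d (T : measurableType d) (mu : {measure set T -> \bar R}).

(** A fresh name for [mu] that carries the proof of sigma-finiteness, so that the corresponding
    structure can be attached to it. *)
Definition sigma_finite_copy (_ : sigma_finite setT mu) : set T -> \bar R := mu.

Variable sf : sigma_finite setT mu.

HB.instance Definition _ := isMeasure.Build _ _ _ (sigma_finite_copy sf)
  (measure0 mu) (measure_ge0 mu) (@measure_semi_sigma_additive _ _ _ mu).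

HB.instance Definition _ := Measure_isSigmaFinite.Build _ _ _ (sigma_finite_copy sf) sf.

Lemma sigma_finite_pack :
  exists m : {sigma_finite_measure set T -> \bar R}, (m : set _ -> \bar R) = mu.
Proof. by exists (sigma_finite_copy sf). Qed.
End SigmaFiniteCopy.

Lemma product_sigma_finite d1 d2 (T1 : measurableType d1) (T2 : measurableType d2)
    (m1 : {sigma_finite_measure set T1 -> \bar R}) (m2 : {sigma_finite_measure set T2 -> \bar R}) :
  exists P : {sigma_finite_measure set (T1 * T2)%type -> \bar R}, (P : set _ -> \bar R) = (m1 \x m2)%E.
Proof.
have [F FT Fm] := sigma_finiteT m1; have [G GT Gm] := sigma_finiteT m2.
pose mp := [the {measure set (T1 * T2)%type -> \bar R} of (m1 \x m2)%E].
have sf : sigma_finite setT mp.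
  exists (fun k => if unpickle k is Some (i, j) then F i `*` G j else set0).
    apply/seteqP; split => // -[x y] _.
    have [i _ Fx] : (\bigcup_i F i) x by rewrite -FT.
    have [j _ Gy] : (\bigcup_i G i) y by rewrite -GT.
    by exists (pickle (i, j)) => //; rewrite pickleK.
  move=> k; case: unpickle => [[i j]|]; last by rewrite measure0; split.
  have [? ?] := Fm i; have [? ?] := Gm j; split; first exact: measurableX.
  by rewrite /mp /= product_measure1E // lte_mul_pinfty // ge0_fin_numE.
by have [m mE] := sigma_finite_pack sf; exists m.
Qed.

Lemma pushforward_iso_sigma_finite d1 d2 (T1 : measurableType d1) (T2 : measurableType d2)
    (P : {sigma_finite_measure set T1 -> \bar R}) (g : T1 -> T2) (un : T2 -> T1) :
  measurable_fun setT g -> measurable_fun setT un -> cancel g un ->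
  exists m : {sigma_finite_measure set T2 -> \bar R}, (m : set _ -> \bar R) = pushforward P g.
Proof.
move=> mg mun unK.
have [F FT Fm] := sigma_finiteT P.
have sf : sigma_finite setT (pushforward P g).
  exists (fun k => un @^-1` F k).
    by rewrite -preimage_bigcup -FT.
  move=> k; have [mFk Fk] := Fm k; split.
    by rewrite -[X in measurable X]setTI; exact: mun.
  by rewrite /pushforward -comp_preimage (_ : un \o g = id) //; apply/funext => p; exact: unK.
have [m mE] := @sigma_finite_pack _ _ (measure_function_pushforward__canonical__measure_function_Measure P mg) sf.
by exists m.
Qed.

(** [lebesgue_tuple] is a bare set function; this gives access to subadditivity, additivity and
    Tonelli for it. *)
Lemma lebesgue_tuple_sigma_finite_measure n :
  exists m : {sigma_finite_measure set (n.-tuple (measurableTypeR R)) -> \bar R},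
    (m : set _ -> \bar R) = @lebesgue_tuple R n.
Proof.
elim: n => [|n [m mE]].
  by exists (dirac [tuple]).
have [P PE] := product_sigma_finite (lebesgue_measure : {sigma_finite_measure set (measurableTypeR R) -> \bar R}) m.
have [||p|m' m'E] := @pushforward_iso_sigma_finite _ _ _ _ P
    (fun p => [tuple of p.1 :: p.2] : n.+1.-tuple (measurableTypeR R))
    (fun t => (thead t, [tuple of behead t])).
- by apply: measurable_cons; [exact: measurable_fst|exact: measurable_snd].
- apply/measurable_fun_pairP; split; first exact: measurable_tnth.
  exact: measurable_behead.
- by case: p => x t; rewrite /= theadE; congr pair; apply: val_inj.
- by exists m'; rewrite m'E PE mE.
Qed.

(* Homogeneous balls are sheared boxes: the interval in each coordinate is
   centered at a function [c] of the preceding coordinates, gathered in [p]. *)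
Fixpoint inbox (c : seq R -> R) (w : nat -> R) (p l : seq R) : Prop :=
  if l is x :: l' then `|x - c p| <= w (size p) /\ inbox c w (rcons p x) l' else True.

Lemma lebesgue_interval (c w K : R) : 0 <= w -> 0 <= K ->
  (\int[lebesgue_measure]_(x in [set: measurableTypeR R])
     (if `|x - c| <= w then K%:E else 0%E)%R)%E = (2 * w * K)%:E.
Proof.
move=> w0 K0.
have -> : (fun x : measurableTypeR R => if `|x - c| <= w then K%:E else 0%E) =
    (fun=> K%:E) \_ (`[c - w, c + w]%classic : set (measurableTypeR R)).
  by apply/funext => x; rewrite patchE mem_setE in_itv /= ler_distl.
have mI : measurable (`[c - w, c + w]%classic : set (measurableTypeR R)) by exact: measurable_itv.
have /= E := @integral_cst _ _ _ (@lebesgue_measure R) _ mI K%:E.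
rewrite -integral_mkcond E lebesgue_measure_itv /= lte_fin {E mI}.
case: ltP => [h|h].
  by rewrite -EFinD -EFinM; congr (_%:E); ring.
have -> : w = 0 by lra.
by rewrite mule0 mulr0 mul0r.
Qed.

(** The set is sliced along the first coordinate. The measure of a slice does not depend on the
    centers, so a shear leaves the volume unchanged. *)
Lemma lebesgue_tuple_inbox n c w p : (forall i, 0 <= w i) ->
  lebesgue_tuple [set t : n.-tuple (measurableTypeR R) | inbox c w p t] =
  (\prod_(i < n) (2 * w (size p + i)%N))%:E.
Proof.
move=> w0; elim: n p => [|n IH] p.
  by rewrite /= diracE big_ord0 mem_set.
rewrite lebesgue_tuple_cons.
pose K := \prod_(i < n) (2 * w (size p + i.+1)%N).
have K0 : 0 <= K by apply: prodr_ge0 => i _; rewrite mulr_ge0.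
rewrite (_ : \prod_(i < n.+1) _ = 2 * w (size p) * K); last first.
  by rewrite big_ord_recl /= addn0.
rewrite -(lebesgue_interval (c p) (w0 _) K0); apply: eq_integral => x _ /=.
case: ifP => h.
  rewrite (_ : [set t : n.-tuple _ | _] = [set t : n.-tuple (measurableTypeR R) | inbox c w (rcons p x) t]).
    rewrite IH; congr (_%:E); apply: eq_bigr => i _.
    by rewrite size_rcons addSnnS.
  by apply/seteqP; split => t /= => [[]|].
have [m mE] := lebesgue_tuple_sigma_finite_measure n.
by rewrite (_ : [set t : n.-tuple _ | _] = set0) -?mE ?measure0 //; apply/seteqP; split => t //= [].
Qed.

Lemma row_of_tupleE (t : 5.-tuple (measurableTypeR R)) i : @row_of_tuple R 5 t 0 i = tnth t i.
Proof. by rewrite mxE. Qed.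

Definition tball (p : 'rV[R]_5) (rho : R) : set (5.-tuple (measurableTypeR R)) :=
  [set t | maxnorm (cgsub p (row_of_tuple t)) <= rho].

Lemma maxnorm_cgsub_leP (x y : 'rV[R]_5) rho : 0 <= rho ->
  maxnorm (cgsub x y) <= rho <->
  [/\ `|y 0 c0 - x 0 c0| <= rho, `|y 0 c1 - x 0 c1| <= rho, `|y 0 c2 - x 0 c2| <= rho,
      `|y 0 c3 - x 0 c3| <= rho
    & `|y 0 c4 - x 0 c4 - 2^-1 * (x 0 c0 * y 0 c1 - x 0 c1 * y 0 c0)| <= rho ^+ 2].
Proof.
move=> r0; have [[[[E0 E1] E2] E3] E4] := cgsub_coord x y.
by rewrite maxnorm_leP // E0 E1 E2 E3 E4 /om.
Qed.

Lemma lebesgue_tball p rho : 0 <= rho -> lebesgue_tuple (tball p rho) = (32 * rho ^+ 6)%:E.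
Proof.
move=> r0.
(* Left translation by p is a shear: only the center in the last coordinate depends on the other
   coordinates. *)
pose c (l : seq R) := if size l == 4%N then p 0 c4 + 2^-1 * (p 0 c0 * l`_1 - p 0 c1 * l`_0)
  else nth 0 [:: p 0 c0; p 0 c1; p 0 c2; p 0 c3] (size l).
pose w (i : nat) := if i == 4%N then rho ^+ 2 else rho.
have w0 i : 0 <= w i by rewrite /w; case: ifP => // _; rewrite exprn_ge0.
have -> : tball p rho = [set t | inbox c w [::] t].
  apply/seteqP; split => t; case/tupleP: t => a t; case/tupleP: t => b t; case/tupleP: t => e t;
    case/tupleP: t => f t; case/tupleP: t => z t; rewrite (tuple0 t) /tball /=;
    rewrite maxnorm_cgsub_leP // !row_of_tupleE /= !(tnth_nth 0) /= /c /w /=.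
    move=> [h0 h1 h2 h3 h4]; do 4!split => //; split => //.
    by apply: le_trans h4; rewrite le_eqVlt; apply/orP; left; apply/eqP; congr (`|_|); ring.
  move=> [h0 [h1 [h2 [h3 [h4 _]]]]]; split => //.
  by apply: le_trans h4; rewrite le_eqVlt; apply/orP; left; apply/eqP; congr (`|_|); ring.
rewrite lebesgue_tuple_inbox //; congr (_%:E).
by rewrite !big_ord_recr big_ord0 /= /w /=; ring.
Qed.

Lemma measurable_tball p rho : 0 <= rho -> measurable (tball p rho).
Proof.
move=> r0.
have mt (i : 'I_5) : measurable_fun [set: 5.-tuple (measurableTypeR R)] (fun t => tnth t i : R).
  exact: measurable_tnth.
have mle (g : 5.-tuple (measurableTypeR R) -> R) (b : R) : measurable_fun setT g -> measurable [set t | `|g t| <= b].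
  move=> mg; rewrite -[X in measurable X]setTI; apply: measurable_fun_le => //.
  by apply: measurableT_comp.
rewrite (_ : tball p rho = [set t | `|tnth t c0 - p 0 c0| <= rho] `&` [set t | `|tnth t c1 - p 0 c1| <= rho] `&`
   [set t | `|tnth t c2 - p 0 c2| <= rho] `&` [set t | `|tnth t c3 - p 0 c3| <= rho] `&`
   [set t | `|tnth t c4 - p 0 c4 - 2^-1 * (p 0 c0 * tnth t c1 - p 0 c1 * tnth t c0)| <= rho ^+ 2]); last first.
  apply/seteqP; split => t; rewrite /tball /= maxnorm_cgsub_leP // !row_of_tupleE.
    by move=> [].
  by move=> [[[[]]]].
repeat apply: measurableI; apply: mle.
all: repeat first [exact: mt | exact: measurable_cst | apply: measurable_funB | apply: measurable_funM].
Qed.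

(* No measurability is needed because the integral is a supremum over the
   simple functions below the integrand; this matters as beta is not shown to
   be measurable. *)
Lemma le_integral_ge0 d (T : measurableType d) (mu : {measure set T -> \bar R}) (D : set T)
    (f g : T -> \bar R) :
  (forall x, D x -> (0 <= f x)%E) -> (forall x, D x -> (f x <= g x)%E) ->
  (\int[mu]_(x in D) f x <= \int[mu]_(x in D) g x)%E.
Proof.
move=> f0 fg; have g0 x : D x -> (0 <= g x)%E by move=> Dx; apply: le_trans (f0 x Dx) (fg x Dx).
rewrite !ge0_integralE //; apply: ereal_sup_le => _ [h hf <-].
exists h => // x; apply: le_trans (hf x) _.
by rewrite !patchE; case: ifPn => // /set_mem; exact: fg.
Qed.

(** * Double integrals compared with sums over rectangles *)

Section Rectangles.
Context d (T : measurableType d) (mu : {sigma_finite_measure set T -> \bar R}).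
Variables (c a b : nat -> R) (N : nat -> set T).
Hypothesis c0 : forall k, 0 <= c k.
Hypothesis a0 : forall k, 0 < a k.
Hypothesis ab : forall k, a k <= b k.
Hypothesis mN : forall k, measurable (N k).

Definition rect_term k (t : T) (r : R) : R := c k * \1_(N k) t * \1_(`[a k, b k]%classic) r.

Lemma rect_term_ge0 k t r : 0 <= rect_term k t r.
Proof. by rewrite /rect_term !mulr_ge0 // indicE ler0n. Qed.

Lemma rect_termE k t r : N k t -> a k <= r <= b k -> rect_term k t r = c k.
Proof.
by move=> Nt ar; rewrite /rect_term !indicE mem_set // mem_set ?in_itv //= !mulr1.
Qed.

Lemma rect_term0 k t r : ~ (N k t /\ a k <= r <= b k) -> rect_term k t r = 0.
Proof.
move=> h; rewrite /rect_term !indicE; have [/set_mem Nt|_] := boolP (t \in N k); last by rewrite mulr0 mul0r.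
have [/set_mem /=|_] := boolP (r \in `[a k, b k]%classic); last by rewrite mulr0.
by rewrite in_itv /= => ar; case: h.
Qed.

Lemma integral_indic_scale d' (S : measurableType d') (m : {measure set S -> \bar R})
    (D A : set S) (C : R) : measurable D -> measurable A -> 0 <= C ->
  (\int[m]_(x in D) (C * \1_A x)%:E = C%:E * m (A `&` D))%E.
Proof.
move=> mD mA C0; under eq_integral do rewrite EFinM.
rewrite ge0_integralZl_EFin //; first by rewrite integral_indic.
by apply/measurable_EFinP; exact: measurable_indic.
Qed.

Lemma rect_integral :
  (\int[mu]_t \int[lebesgue_measure]_(r in `]0%R, +oo[)
     \sum_(k <oo) (rect_term k t r)%:E = \sum_(k <oo) (c k * (b k - a k))%:E * mu (N k))%E.
Proof.
have inner t k : (\int[lebesgue_measure]_(r in `]0%R, +oo[) (rect_term k t r)%:E =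
    (c k * (b k - a k) * \1_(N k) t)%:E)%E.
  rewrite integral_indic_scale //; last by rewrite mulr_ge0 // indicE ler0n.
  rewrite setIidl; last first.
    move=> r /=; rewrite !in_itv /= andbT => /andP[h _]; exact: lt_le_trans h.
  have lE : lebesgue_measure (`[a k, b k]%classic : set R) = (b k - a k)%:E.
    rewrite lebesgue_measure_itv /= lte_fin; have := ab k.
    by rewrite le_eqVlt => /orP[/eqP <-|->] //; rewrite ltxx subrr.
  transitivity ((c k * \1_(N k) t)%:E * (b k - a k)%:E)%E; first by congr (_ * _)%E; exact: lE.
  by rewrite -EFinM mulrAC.
under eq_integral => t _.
  rewrite integral_nneseries //; first last.
  - by move=> k r _; rewrite lee_fin rect_term_ge0.
  - move=> k; apply/measurable_EFinP; apply: measurable_funM; first exact: measurable_cst.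
    by apply: measurable_indic; exact: measurable_itv.
  under eq_eseriesr do rewrite inner.
  over.
have cb k : 0 <= c k * (b k - a k) by rewrite mulr_ge0 // subr_ge0.
rewrite integral_nneseries //; first last.
- by move=> k t _; rewrite lee_fin mulr_ge0 // indicE ler0n.
- move=> k; apply/measurable_EFinP; apply: measurable_funM; first exact: measurable_cst.
  exact: measurable_indic.
by apply: eq_eseriesr => k _; rewrite integral_indic_scale // setIT.
Qed.

(** Wherever f is nonzero, one term of the sum over the rectangles dominates it. Tonelli is applied
    to that sum only, never to f. *)
Lemma double_integral_le (f : T -> R -> R) (v : nat -> R) (B : R) :
  (forall t r, 0 < r -> 0 <= f t r) ->
  (forall t r, 0 < r -> f t r = 0 \/ exists k, [/\ N k t, a k <= r <= b k & f t r <= c k]) ->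
  (forall k, (mu (N k) <= (v k)%:E)%E) ->
  (forall n, \sum_(k < n) c k * (b k - a k) * v k <= B) ->
  (\int[mu]_t \int[lebesgue_measure]_(r in `]0%R, +oo[) (f t r)%:E <= B%:E)%E.
Proof.
move=> f0 fc Nv vB; apply: (@le_trans _ _ (\sum_(k <oo) (c k * (b k - a k))%:E * mu (N k))%E).
  rewrite -rect_integral; apply: le_integral_ge0 => [t _|t _].
    by apply: integral_ge0 => r /=; rewrite in_itv /= andbT => r0; rewrite lee_fin f0.
  apply: le_integral_ge0 => r /=; rewrite in_itv /= andbT => r0; first by rewrite lee_fin f0.
  have s0 : (0 <= \sum_(k <oo) (rect_term k t r)%:E)%E.
    by apply: nneseries_ge0 => k _ _; rewrite lee_fin rect_term_ge0.
  have [->//|[k [Nt ar fk]]] := fc t r r0.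
  apply: (@le_trans _ _ (\sum_(0 <= i < k.+1) (rect_term i t r)%:E)%E); last first.
    by apply: nneseries_lim_ge => i _ _; rewrite lee_fin rect_term_ge0.
  rewrite big_nat_recr //= (rect_termE Nt ar) -[leLHS]add0e leeD ?lee_fin //.
  by apply: sume_ge0 => i _; rewrite lee_fin rect_term_ge0.
have cb k : 0 <= c k * (b k - a k) by rewrite mulr_ge0 // subr_ge0.
apply: lime_le; first by apply: is_cvg_nneseries => k _ _; rewrite mule_ge0 ?lee_fin.
apply: nearW => n; apply: le_trans (_ : (\sum_(0 <= k < n) (c k * (b k - a k) * v k)%:E <= _)%E).
  by apply: lee_sum => k _; rewrite (EFinM (c k * (b k - a k)) (v k)); apply: lee_pmul; rewrite ?lee_fin.
by rewrite sumEFin lee_fin big_mkord.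
Qed.

(** As b (k+1) < a k, the intervals of the rectangles are disjoint. At most one term is nonzero at a
    given point, so the sum stays below f. *)
Lemma double_integral_ge (f : T -> R -> R) (v : nat -> R) (n : nat) :
  (forall t r, 0 < r -> 0 <= f t r) ->
  (forall k t r, N k t -> a k <= r <= b k -> c k <= f t r) ->
  (forall k, b k.+1 < a k) ->
  (forall k, 0 <= v k) -> (forall k, ((v k)%:E <= mu (N k))%E) ->
  ((\sum_(k < n) c k * (b k - a k) * v k)%:E <=
   \int[mu]_t \int[lebesgue_measure]_(r in `]0%R, +oo[) (f t r)%:E)%E.
Proof.
move=> f0 fc ba v0 Nv; apply: (@le_trans _ _ (\sum_(k <oo) (c k * (b k - a k))%:E * mu (N k))%E).
  have cb k : 0 <= c k * (b k - a k) by rewrite mulr_ge0 // subr_ge0.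
  apply: (@le_trans _ _ (\sum_(0 <= k < n) (c k * (b k - a k))%:E * mu (N k))%E).
    rewrite -(big_mkord xpredT (fun k => c k * (b k - a k) * v k)) -sumEFin.
    by apply: lee_sum => k _; rewrite (EFinM (c k * (b k - a k)) (v k)); apply: lee_pmul; rewrite ?lee_fin.
  by apply: nneseries_lim_ge => k _ _; rewrite mule_ge0 ?lee_fin.
have lt_ba j k : (j < k)%N -> b k < a j.
  elim: k => // k IH; rewrite ltnS leq_eqVlt => /orP[/eqP <- //|/IH h].
  by apply: lt_trans (ba _) _; apply: le_lt_trans (ab k) h.
rewrite -rect_integral; apply: le_integral_ge0 => [t _|t _].
  apply: integral_ge0 => r _; apply: nneseries_ge0 => k _ _; by rewrite lee_fin rect_term_ge0.
apply: le_integral_ge0 => r /=; rewrite in_itv /= andbT => r0.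
  by apply: nneseries_ge0 => k _ _; rewrite lee_fin rect_term_ge0.
apply: lime_le; first by apply: is_cvg_nneseries => k _ _; rewrite lee_fin rect_term_ge0.
apply: nearW => m; rewrite sumEFin lee_fin.
elim: m => [|m IH]; first by rewrite big_geq // f0.
rewrite big_nat_recr //=; have [[Nt ar]|h] := pselect (N m t /\ a m <= r <= b m); last first.
  by rewrite (rect_term0 h) addr0.
rewrite (rect_termE Nt ar) big1_seq ?add0r ?fc // => i /andP[_].
rewrite mem_index_iota => /andP[_ im]; apply: rect_term0 => -[_ /andP[ai _]].
by have := lt_ba _ _ im; move/andP: ar => [_ rb]; rewrite ltNge (le_trans ai rb).
Qed.
End Rectangles.

End TupleMeasure.

(** * Beta numbers *)

Section BetaGeneral.
Context {R : realType}.
Local Notation cgm := (@cg_mul R heisR2).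
Variable N : 'rV[R]_5 -> R.
Hypothesis hN : homogeneous_norm (G := heisR2) N.
Local Notation d := (homogeneous_dist (G := heisR2) N).
Local Notation line := (@horizontal_line R heisR2).
Local Notation betaE := (@beta R heisR2 d).

Lemma hd_ge0 x y : 0 <= d x y. Proof. exact: (hn_ge0 hN). Qed.

Lemma hd_sym x y : d x y = d y x.
Proof. by rewrite /homogeneous_dist -(hn_inv hN) cgiM cgiK. Qed.

Lemma hd_tri y x z : d x z <= d x y + d y z.
Proof.
rewrite /homogeneous_dist -{1}(cgVmK y z) cgmA; exact: (hn_mul hN).
Qed.

Lemma line_neq0 L : line L -> L !=set0.
Proof. by move=> [g [v [_ _ ->]]]; exists (cgm g (0 *: v)), 0. Qed.

Lemma line_exists (g v : 'rV[R]_5) : v 0 c4 = 0 -> v != 0 ->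
  exists2 L, line L & forall t, L (cgm g (t *: v)).
Proof.
move=> v4 v0; exists [set cgm g (t *: v) | t in [set: R]]; last by move=> t; exists t.
exists g, v; split=> //; apply/mem_layer; apply: forall_I5 => //=.
Qed.

Lemma line_through (g : 'rV[R]_5) : exists2 L, line L & L g.
Proof.
have [||L lL Lg] := @line_exists g (delta_mx 0 c0).
- by rewrite mxE.
- by apply/eqP => /rowP /(_ c0); rewrite !mxE /= => /eqP; rewrite oner_eq0.
- by exists L => //; have := Lg 0; rewrite scale0r cgm0.
Qed.

Lemma dist_set_ge0 z L : 0 <= dist_set d z L.
Proof.
rewrite /dist_set; have [->|/set0P L0] := eqVneq L set0; first by rewrite image_set0 inf0.
apply: lb_le_inf; first exact: image_nonempty.
by move=> _ [y _ <-]; exact: hd_ge0.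
Qed.

Lemma dist_set_le z L y : L y -> dist_set d z L <= d z y.
Proof.
move=> Ly; apply: ge_inf; last by exists y.
by exists 0 => _ [y' _ <-]; exact: hd_ge0.
Qed.

Lemma sup_nneg (S : set R) : (forall x, S x -> 0 <= x) -> 0 <= sup S.
Proof.
move=> S0; have [hS|hS] := pselect (has_sup S); last by rewrite sup_out.
have [x Sx] := hS.1; apply: le_trans (S0 _ Sx) _.
exact: sup_upper_bound.
Qed.

Lemma beta_members_ge0 E x r (S : R) : 0 < r ->
  [set sup [set dist_set d z L / r | z in E `&` dball d x r] | L in line] S -> 0 <= S.
Proof.
move=> r0 [L _ <-]; apply: sup_nneg => _ [z _ <-].
by rewrite divr_ge0 ?dist_set_ge0 // ltW.
Qed.

Lemma beta_ge0 E x r : 0 < r -> 0 <= betaE E x r.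
Proof.
move=> r0; apply: lb_le_inf.
  by have [L lL _] := line_through 0; eexists; exists L.
by move=> S; exact: beta_members_ge0.
Qed.

Lemma beta_le E x r b L : 0 < r -> 0 <= b -> line L ->
  (forall z, E z -> d x z < r -> dist_set d z L <= b) -> betaE E x r <= b / r.
Proof.
move=> r0 b0 lL H; apply: (@le_trans _ _ (sup [set dist_set d z L / r | z in E `&` dball d x r])).
  apply: ge_inf; last by exists L.
  by exists 0 => S; exact: beta_members_ge0.
set S := (X in sup X); have [->|/set0P S0] := eqVneq S set0.
  by rewrite sup0 divr_ge0 // ltW.
apply: ge_sup => // _ [z [Ez Bz] <-]; rewrite ler_pM2r ?invr_gt0 //.
exact: H.
Qed.

Lemma beta_le1 E x r : 0 < r -> betaE E x r <= 1.
Proof.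
move=> r0; have [L lL Lx] := line_through x.
rewrite -(@divff _ r) ?gt_eqF //; apply: (beta_le r0 (ltW r0) lL) => z _ zr.
by apply: le_trans (dist_set_le z Lx) _; rewrite hd_sym ltW.
Qed.

Lemma beta_eq0 E x r : 0 < r -> (forall z, E z -> ~ d x z < r) -> betaE E x r = 0.
Proof.
move=> r0 H; apply/eqP; rewrite eq_le beta_ge0 // andbT.
have [L lL _] := line_through x; rewrite -(mul0r r^-1).
by apply: (beta_le r0 (lexx _) lL) => z Ez /(H z Ez).
Qed.

Lemma beta_ge E x r b : 0 < r ->
  (forall L, line L -> exists z, [/\ E z, d x z < r & b <= dist_set d z L]) ->
  b / r <= betaE E x r.
Proof.
move=> r0 H; apply: lb_le_inf.
  by have [L lL _] := line_through 0; eexists; exists L.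
move=> _ [L lL <-]; have [z [Ez zr bz]] := H L lL.
apply: (@le_trans _ _ (dist_set d z L / r)); first by rewrite ler_pM2r ?invr_gt0.
apply: ub_le_sup; last by exists z.
have [y Ly] := line_neq0 lL.
(* [sup] is an upper bound only for a bounded set; any y in L bounds the distances by r + d x y. *)
exists ((r + d x y) / r) => _ [z' [_ z'r] <-]; rewrite ler_pM2r ?invr_gt0 //.
apply: le_trans (dist_set_le z' Ly) _; apply: le_trans (hd_tri x _ _) _.
by rewrite lerD2r hd_sym ltW.
Qed.
End BetaGeneral.

(** * Hausdorff dimension *)

Section HausdorffNull.
Context {R : realType} {T : Type} (d : T -> T -> R).

Lemma ediam_ge0 A : (0 <= ediam d A)%E. Proof. by rewrite le_max lexx. Qed.

Lemma ediam_le A b : 0 <= b -> (forall x y, A x -> A y -> d x y <= b) -> (ediam d A <= b%:E)%E.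
Proof.
move=> b0 h; rewrite ge_max lee_fin b0 /=; apply: ge_ereal_sup => _ [[x y] [Ax Ay] <-].
by rewrite lee_fin h.
Qed.

Lemma le_ediam (A : set T) x y : A x -> A y -> ((d x y)%:E <= ediam d A)%E.
Proof.
by move=> Ax Ay; rewrite le_max; apply/orP; right; apply: ereal_sup_ubound; exists (x, y).
Qed.

(** Coverings of the A k at cost e / 2^(k+1) are merged into one sequence through a bijection
    between nat and nat * nat. *)
Lemma hausdorff_measure_bigcup_eq0 s (A : nat -> set T) : 0 < s ->
  (forall k delta e, 0 < delta -> 0 < e -> exists n (F : nat -> set T) b,
     [/\ A k `<=` \bigcup_(i in `I_n) F i, forall i, (ediam d (F i) <= b%:E)%E,
         0 <= b <= delta & n%:R * b `^ s <= e]) ->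
  hausdorff_measure d s (\bigcup_k A k) = 0%E.
Proof.
move=> s0 cov; have sn0 : s != 0 by rewrite gt_eqF.
have sum0 (F : nat -> set T) : (0 <= \sum_(0 <= k <oo) poweR (ediam d (F k)) s)%E.
  by apply: nneseries_ge0 => k _ _; exact: poweR_ge0.
have pre0 delta : 0 < delta -> hausdorff_premeasure d s delta (\bigcup_k A k) = 0%E.
  move=> delta0; apply/eqP; rewrite eq_le; apply/andP; split; last first.
    by apply: le_ereal_inf_tmp => _ [F _ <-].
  apply/lee_addgt0Pr => e e0; rewrite add0e.
  have ek0 k : 0 < e / (2 ^ k.+1)%:R :> R by rewrite divr_gt0 // ltr0n expn_gt0.
  have := fun k => cov k delta _ delta0 (ek0 k).
  move=> /choice[n /choice[F /choice[b hF]]].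
  have /pcard_eqP/unsquash g : ([set: nat] #= [set: nat * nat])%card.
    by apply: card_esym; exact: card_nat2.
  (* The finite families are padded with the empty set, whose term is 0 because s > 0. *)
  pose G p := if (p.2 < n p.1)%N then F p.1 p.2 else set0.
  have dG p : (ediam d (G p) <= (b p.1)%:E)%E.
    have [_ h /andP[b0 _] _] := hF p.1; rewrite /G; case: ifP => _; first exact: h.
    by apply: ediam_le.
  apply: (@le_trans _ _ (\sum_(0 <= k <oo) poweR (ediam d (G (g k))) s)%E).
    apply: ereal_inf_lbound; exists (G \o g) => //; split.
      move=> x [k _ Ax]; have [sub _ _ _] := hF k; have [i /= ik Fx] := sub _ Ax.
      have [j _ gj] := @surj _ _ _ _ g (k, i) I.
      by exists j => //=; rewrite gj /G /= ik.
    move=> k; have [_ _ /andP[_ bd] _] := hF (g k).1.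
    by apply: le_trans (dG _) _; rewrite lee_fin.
  rewrite nneseries_esum; last by move=> k _; exact: poweR_ge0.
  rewrite (_ : [set x : nat | true] = setT); last by apply/seteqP; split.
  have gb : set_bij [set: nat] [set: nat * nat] g by exact: bij.
  rewrite -(reindex_esum _ _ _ (fun p => poweR (ediam d (G p)) s) gb).
  rewrite (_ : [set: nat * nat] = setT `*`` (fun=> setT)); last by apply/seteqP; split.
  rewrite -(@esum_esum _ _ _ _ _ (fun k i => poweR (ediam d (G (k, i))) s)); last first.
    by move=> *; exact: poweR_ge0.
  apply: le_trans (epsilon_trick0 xpredT (ltW e0)).
  rewrite nneseries_esum; last by move=> k _; rewrite lee_fin ltW.
  rewrite (_ : [set x : nat | true] = setT); last by apply/seteqP; split.
  apply: le_esum => k _; have [_ _ /andP[b0 _] nb] := hF k.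
  apply: (@le_trans _ _ ((n k)%:R * b k `^ s)%:E); last by rewrite lee_fin.
  have part m : \sum_(0 <= i < m) (if (i < n k)%N then b k `^ s else 0) = (minn m (n k))%:R * b k `^ s.
    elim: m => [|m IH]; first by rewrite big_geq // min0n mul0r.
    rewrite big_nat_recr //= IH; case: ltnP => mn.
      by rewrite !(minn_idPl _) // ?(ltnW mn) // -natr1 mulrDl mul1r.
    by rewrite !(minn_idPr _) ?addr0 // (leq_trans mn).
  rewrite -[X in \esum_(_ in X) _](_ : [set x : nat | true] = setT); last by apply/seteqP; split.
  rewrite -nneseries_esum; last by move=> i _; exact: poweR_ge0.
  apply: lime_le; first by apply: is_cvg_nneseries => i _ _; exact: poweR_ge0.
  apply: nearW => m; apply: (@le_trans _ _ (\sum_(0 <= i < m) (if (i < n k)%N then b k `^ s else 0)%:E)%E).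
    apply: lee_sum => i _; rewrite /G /=; case: ifP => _.
      rewrite -poweR_EFin; apply: gt0_ler_poweR; rewrite ?in_itv /= ?andbT ?leey ?ediam_ge0 ?lee_fin ?b0 ?(ltW s0) //.
      by have [_ h _ _] := hF k.
    suff -> : ediam d set0 = 0%E by rewrite poweR0r.
    by apply/eqP; rewrite eq_le ediam_ge0 andbT; apply: ediam_le.
  by rewrite sumEFin part lee_fin ler_wpM2r ?powR_ge0 // ler_nat geq_minr.
apply/eqP; rewrite eq_le; apply/andP; split.
  by apply: ge_ereal_sup => _ [delta delta0 <-]; rewrite pre0.
by apply: ereal_sup_ubound; exists 1; [exact: ltr01|exact: pre0].
Qed.
End HausdorffNull.

Section GridCover.
Context {R : realType}.

Lemma ord_near (y : R) (M : nat) : 0 <= y <= M%:R -> exists i : 'I_M.+1, `|y - i%:R| <= 1.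
Proof.
move=> /andP[y0 yM]; have /andP[t1 t2] := truncn_itv y0.
have tM : (Num.truncn y < M.+1)%N by rewrite ltnS -(ler_nat R); exact: le_trans yM.
exists (Ordinal tM) => /=; rewrite ger0_norm ?subr_ge0 //.
by rewrite lerBlDl natr1 ltW.
Qed.

Lemma ord_grid (y K : R) (n M : nat) : 0 < n%:R :> R -> `|y| <= K -> 2 * K * n%:R = M%:R ->
  exists i : 'I_M.+1, `|y - (i%:R / n%:R - K)| <= n%:R^-1.
Proof.
move=> n0; rewrite ler_norml => /andP[y1 y2] E.
have [|i hi] := @ord_near ((y + K) * n%:R) M.
  apply/andP; split; first by rewrite mulr_ge0 ?(ltW n0) //; lra.
  by rewrite -E ler_pM2r //; lra.
exists i; have -> : y - (i%:R / n%:R - K) = ((y + K) * n%:R - i%:R) / n%:R.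
  by field; rewrite gt_eqF.
by rewrite normrM [X in _ * X]ger0_norm ?invr_ge0 ?(ltW n0) // ler_piMl // invr_ge0 ltW.
Qed.

Lemma grid_card_le (x : nat) : (0 < x)%N ->
  ((2 * x).+1 ^ 4 * (4 * x ^ 2).+1 <= 405 * x ^ 6)%N.
Proof.
move=> x0; have -> : (405 * x ^ 6 = (3 * x) ^ 4 * (5 * x ^ 2))%N.
  by rewrite expnMn mulnACA -expnD.
apply: leq_mul; first by rewrite leq_exp2r //; lia.
by have : (0 < x ^ 2)%N; [rewrite expn_gt0 x0|lia].
Qed.

(** The mesh is 1 / n in the first four coordinates and 1 / n^2 in the last, following the weights,
    whence a number of points of order n^6. *)
Lemma grid_cover (L n : nat) : (0 < L)%N -> (0 < n)%N -> exists P : nat -> 'rV[R]_5,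
  forall x, maxnorm x <= L%:R -> exists2 i,
    (i < (2 * L * n).+1 ^ 4 * (4 * L ^ 2 * n ^ 2).+1)%N & maxnorm (cgsub (P i) x) <= n%:R^-1.
Proof.
move=> L0 n0; set a := (2 * L * n).+1; set b := (4 * L ^ 2 * n ^ 2).+1.
pose I := ('I_a * 'I_a * 'I_a * 'I_a * 'I_b)%type.
have nR : 0 < n%:R :> R by rewrite ltr0n.
pose g (i : 'I_a) : R := i%:R / n%:R - L%:R.
pose Q (q : I) : 'rV[R]_5 :=
  pt5 (g q.1.1.1.1) (g q.1.1.1.2) (g q.1.1.2) (g q.1.2) (q.2%:R / (n ^ 2)%:R - 2 * L%:R ^+ 2).
pose dflt : I := (ord0, ord0, ord0, ord0, ord0).
exists (fun i => Q (nth dflt (enum {: I}) i)) => x xL.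
have [x0 x1 x2 x3 x4] := maxnorm_bound x.
have gE : 2 * L%:R * n%:R = (2 * L * n)%N%:R :> R by rewrite !natrM.
have [i0 h0] := ord_grid nR (le_trans x0 xL) gE.
have [i1 h1] := ord_grid nR (le_trans x1 xL) gE.
have [i2 h2] := ord_grid nR (le_trans x2 xL) gE.
have [i3 h3] := ord_grid nR (le_trans x3 xL) gE.
have gb (i : 'I_a) : `|g i| <= L%:R.
  rewrite ler_norml /g; have : (i%:R : R) / n%:R <= 2 * L%:R.
    by rewrite ler_pdivrMr // gE ler_nat -ltnS.
  have : 0 <= (i%:R : R) / n%:R by rewrite mulr_ge0 // invr_ge0 ltW.
  by move=> ? ?; apply/andP; split; lra.
have n2 : 0 < (n ^ 2)%N%:R :> R by rewrite ltr0n expn_gt0 n0.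
have gE2 : 2 * (2 * L%:R ^+ 2) * (n ^ 2)%N%:R = (4 * L ^ 2 * n ^ 2)%N%:R :> R.
  by rewrite (natrM R (4 * L ^ 2)) natrM [(L ^ 2)%:R]natrX mulrA; congr (_ * _); ring.
(* The last coordinate of the grid point has to approximate that of x corrected by half the area
   form. The correction is at most L^2, hence the range 2 L^2 in [Q]. *)
have y4 : `|x 0 c4 - 2^-1 * (g i0 * x 0 c1 - g i1 * x 0 c0)| <= 2 * L%:R ^+ 2.
  have Lx4 : `|x 0 c4| <= L%:R ^+ 2 by apply: le_trans x4 _; apply: lerXn2r; rewrite ?nnegrE ?maxnorm_ge0.
  have m1 : `|g i0 * x 0 c1| <= L%:R ^+ 2.
    by rewrite normrM expr2; apply: ler_pM => //; exact: le_trans x1 xL.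
  have m2 : `|g i1 * x 0 c0| <= L%:R ^+ 2.
    by rewrite normrM expr2; apply: ler_pM => //; exact: le_trans x0 xL.
  move: Lx4 m1 m2; rewrite !ler_norml => /andP[? ?] /andP[? ?] /andP[? ?].
  by apply/andP; split; lra.
have [i4 h4] := ord_grid n2 y4 gE2.
pose q : I := (i0, i1, i2, i3, i4).
exists (index q (enum {: I})).
  have -> : (a ^ 4 * b = size (enum {: I}))%N.
    by rewrite -cardE !card_prod !card_ord !expnS expn0 muln1 !mulnA.
  by rewrite index_mem mem_enum.
rewrite nth_index ?mem_enum //; apply/maxnorm_cgsub_leP; first by rewrite invr_ge0 ltW.
rewrite /Q !pt5E /=; split => //.
by rewrite exprVn -(natrX _ n 2) [X in `|X|]addrAC.
Qed.
End GridCover.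

Section HausdorffDim.
Context {R : realType}.
Variable N : 'rV[R]_5 -> R.
Hypothesis hN : homogeneous_norm (G := heisR2) N.
Local Notation d := (homogeneous_dist (G := heisR2) N).

Lemma powR_nat_small (a e : R) : 0 < a -> 0 < e ->
  exists M : nat, forall n, (M <= n)%N -> (0 < n)%N -> (n%:R : R) `^ (- a) <= e.
Proof.
move=> a0 e0; exists (Num.truncn (e `^ (- a^-1))).+1 => n Mn n0.
have nR : 0 < n%:R :> R by rewrite ltr0n.
have h : e `^ (- a^-1) <= n%:R.
  have /andP[_ /ltW h] := truncn_itv (powR_ge0 e (- a^-1)).
  by apply: le_trans h _; rewrite ler_nat.
rewrite powRN -[e]invrK lef_pV2 ?posrE ?invr_gt0 ?powR_gt0 //.
have -> : e^-1 = (e `^ (- a^-1)) `^ a.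
  by rewrite -powRrM mulNr mulVf ?gt_eqF // powR_inv1 ?ltW.
by apply: ge0_ler_powR => //; rewrite ?nnegrE ?powR_ge0 //; exact: ltW.
Qed.

(** A ball of radius L is covered by at most 405 (L n)^6 sets of diameter at most 2 C / n, at a
    total cost of order n^(6-s). *)
Lemma hausdorff_measure_eq0_gt6 s : 6 < s -> hausdorff_measure d s setT = 0%E.
Proof.
move=> s6; have s0 : 0 < s by lra.
have [C C0 NC] := hn_upper hN.
rewrite (_ : setT = \bigcup_k [set x : 'rV[R]_5 | maxnorm x <= k.+1%:R]); last first.
  apply/seteqP; split => // x _; have m0 := maxnorm_ge0 x.
  by exists (Num.truncn (maxnorm x)) => //=; have /andP[_ /ltW] := truncn_itv m0.
apply: hausdorff_measure_bigcup_eq0 => // k delta e delta0 e0.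
pose L := k.+1.
pose A := 405 * L%:R ^+ 6 * (2 * C) `^ s.
have A0 : 0 < A.
  apply: mulr_gt0; last by apply: powR_gt0; exact: mulr_gt0.
  by apply: mulr_gt0; [rewrite ltr0n|apply: exprn_gt0; rewrite ltr0n].
have [M hM] : exists M : nat, forall n, (M <= n)%N -> (0 < n)%N -> (n%:R : R) `^ (- (s - 6)) <= e / A.
  by apply: powR_nat_small; [lra|rewrite divr_gt0].
pose n := (maxn M (Num.truncn (2 * C / delta))).+1.
have n0 : (0 < n)%N by [].
have nR : 0 < n%:R :> R by rewrite ltr0n.
have Cd : 2 * C / n%:R <= delta.
  rewrite ler_pdivrMr // [leRHS]mulrC -ler_pdivrMr //.
  have /andP[_ /ltW h] := truncn_itv (ltW (divr_gt0 (mulr_gt0 (ltr0n R 2) C0) delta0) : 0 <= 2 * C / delta).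
  by apply: le_trans h _; rewrite ler_nat /n ltnS leq_maxr.
have [P hP] := @grid_cover R L n isT n0.
exists ((2 * L * n).+1 ^ 4 * (4 * L ^ 2 * n ^ 2).+1)%N.
exists (fun i => [set x | maxnorm (cgsub (P i) x) <= n%:R^-1]), (2 * C / n%:R).
have b0 : 0 <= 2 * C / n%:R by rewrite divr_ge0 ?(ltW nR) // mulr_ge0 // ltW.
split.
- by move=> x /= /hP[i iM Px]; exists i.
- move=> i; apply: ediam_le => // x y /= Px Py.
  apply: le_trans (hd_tri hN (P i) _ _) _; rewrite (hd_sym hN x).
  have h z : maxnorm (cgsub (P i) z) <= n%:R^-1 -> d (P i) z <= C / n%:R.
    by move=> Pz; apply: le_trans (NC _) _; rewrite ler_pM2l.
  have := h _ Px; have := h _ Py; rewrite -mulrA; lra.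
- by rewrite b0 Cd.
have En : (2 * C / n%:R) `^ s = (2 * C) `^ s * (n%:R `^ (- (s - 6)) / n%:R ^+ 6).
  rewrite powRM ?invr_ge0 ?(ltW nR) ?mulr_ge0 ?(ltW C0) //; congr (_ * _).
  rewrite -(powR_inv1 (ltW nR)) -powRrM -(powR_mulrn 6 (ltW nR)) -powRN -powRD.
    by congr (_ `^ _); ring.
  by rewrite pnatr_eq0 implybT.
rewrite En; apply: (@le_trans _ _ (405 * L%:R ^+ 6 * n%:R ^+ 6 * ((2 * C) `^ s * (n%:R `^ (- (s - 6)) / n%:R ^+ 6)))).
  apply: ler_wpM2r; first by rewrite !mulr_ge0 ?powR_ge0 // invr_ge0 exprn_ge0 // ltW.
  rewrite -!natrX -!natrM ler_nat.
  have Ln : (0 < L * n)%N by rewrite muln_gt0.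
  by have := grid_card_le Ln; rewrite !expnMn !mulnA.
have h := hM n (leq_trans (leq_maxl _ _) (leqnSn _)) n0.
rewrite ler_pdivlMr // mulrC in h; apply: le_trans h.
rewrite le_eqVlt; apply/orP; left; apply/eqP; rewrite /A; field; exact: lt0r_neq0.
Qed.

(** A set of diameter D <= 1 lies in a ball of volume 32 (D / c)^6 <= 32 / c^6 * D^s. The unit ball
    has volume 32, so no covering by such sets costs less than c^6; the bound c^6 / 2 is
    contradictory. *)
Lemma hausdorff_measure_neq0_lt6 s : 0 < s -> s < 6 -> hausdorff_measure d s setT <> 0%E.
Proof.
move=> s0 s6 H0; have [c c_0 Nc] := hn_lower hN.
have [m mE] := @lebesgue_tuple_sigma_finite_measure R 5.
have mb p rho : 0 <= rho -> m (tball p rho) = (32 * rho ^+ 6)%:E.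
  by move=> r0; exact: etrans (congr1 (@^~ (tball p rho)) mE) (lebesgue_tball _ r0).
have pre : (hausdorff_premeasure d s 1 setT < (c ^+ 6 / 2)%:E)%E.
  apply: le_lt_trans (_ : 0%E < _)%E; last by rewrite lte_fin divr_gt0 // exprn_gt0.
  by rewrite -H0; apply: ereal_sup_ubound; exists 1; first exact: ltr01.
have [_ [F [cov F1] <-] Fs] := ereal_inf_lt pre.
have dfin k : ediam d (F k) = (fine (ediam d (F k)))%:E.
  by rewrite fineK // ge0_fin_numE ?ediam_ge0 //; apply: le_lt_trans (F1 k) (ltry _).
pose D k := fine (ediam d (F k)).
have D0 k : 0 <= D k by rewrite fine_ge0 ?ediam_ge0.
have D1 k : D k <= 1 by rewrite -lee_fin -dfin.
have [P hP] : exists P : nat -> 'rV[R]_5, forall k x, F k x -> maxnorm (cgsub (P k) x) <= D k / c.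
  have ex k : exists p, forall x, F k x -> maxnorm (cgsub p x) <= D k / c.
    have [->|/set0P[p Fp]] := eqVneq (F k) set0; first by exists 0.
    exists p => x Fx; rewrite ler_pdivlMr // mulrC; apply: le_trans (Nc _) _.
    by rewrite -lee_fin -dfin; exact: le_ediam.
  by have [P hP] := choice ex; exists P.
have Dc k : 0 <= D k / c by rewrite divr_ge0 // ltW.
have mt k : measurable (tball (P k) (D k / c)) by exact: measurable_tball.
have sub : tball 0 1 `<=` \bigcup_k tball (P k) (D k / c).
  move=> t _; have [k _ Ft] := cov (row_of_tuple t) I; exists k => //; exact: hP.
have h := @measure_sigma_subadditive _ R _ m _ _ mt (measurable_tball 0 ler01) sub.
have E0 : 32%:E = m (tball 0 1) by rewrite mb // expr1n mulr1.
have : (32%:E <= \sum_(0 <= k <oo) (32 * (D k / c) ^+ 6)%:E)%E.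
  rewrite E0; apply: le_trans h _; apply: lee_nneseries => [k _ _|k _]; first exact: measure_ge0.
  by rewrite le_eqVlt; apply/orP; left; apply/eqP; exact: mb.
apply/negP; rewrite -ltNge.
apply: le_lt_trans (_ : ((32 / c ^+ 6)%:E * (c ^+ 6 / 2)%:E < 32%:E)%E); last first.
  rewrite -EFinM lte_fin (_ : _ * _ = 16); first by rewrite ltr_nat.
  by field; rewrite gt_eqF.
apply: le_trans (_ : ((32 / c ^+ 6)%:E * \sum_(0 <= k <oo) poweR (ediam d (F k)) s <= _)%E); last first.
  by apply: lee_wpmul2l; [rewrite lee_fin divr_ge0 // exprn_ge0 // ltW|exact: ltW].
have k0 : 0 <= 32 / c ^+ 6 by rewrite divr_ge0 // exprn_ge0 // ltW.
rewrite -nneseriesZl //; last by move=> k _; exact: poweR_ge0.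
apply: lee_nneseries => [k _ _|k _].
  by rewrite lee_fin mulr_ge0 // exprn_ge0.
rewrite dfin poweR_EFin -EFinM lee_fin -/(D k).
have D6 : D k ^+ 6 <= D k `^ s.
  have [->|Dn] := eqVneq (D k) 0; first by rewrite powR0 ?gt_eqF // expr0n.
  rewrite -powR_mulrn //; apply: ger_powR; last exact: ltW.
  by rewrite lt_def Dn D0 D1.
have -> : 32 * (D k / c) ^+ 6 = 32 / c ^+ 6 * D k ^+ 6 by field; rewrite gt_eqF.
exact: ler_wpM2l.
Qed.

Lemma hausdorff_dim_heisR2 : hausdorff_dim d setT = 6%:E.
Proof.
apply/eqP; rewrite eq_le; apply/andP; split.
  apply/lee_addgt0Pr => e e0; rewrite -EFinD; apply: ereal_inf_lbound.
  exists (6 + e) => //; split; first by lra.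
  by apply: hausdorff_measure_eq0_gt6; lra.
apply: le_ereal_inf_tmp => _ [s [s0 Hs] <-]; rewrite lee_fin leNgt; apply/negP => s6.
exact: hausdorff_measure_neq0_lt6 s0 s6 Hs.
Qed.
End HausdorffDim.

(** * Lacunary series *)

Section Calculus.
Context {R : realType}.
Implicit Types (g dg : R -> R).

Lemma MVT_total g dg (a b : R) : (forall x : R, is_derive x 1 g (dg x)) -> a <= b ->
  exists2 c, a <= c <= b & g b - g a = dg c * (b - a).
Proof.
move=> gdg ab; have [x xab|c cab E] := MVT_segment ab (fun x _ => gdg x) _.
  apply: continuous_subspaceT => y; apply: differentiable_continuous.
  by apply/derivable1_diffP; exact: (@ex_derive _ _ _ _ _ _ _ (gdg y)).
by exists c => //; rewrite in_itv in cab.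
Qed.

Lemma le_of_derive g dg (a b : R) : (forall x : R, is_derive x 1 g (dg x)) ->
  (forall x, 0 <= dg x) -> a <= b -> g a <= g b.
Proof.
move=> gdg dg0 ab; have [c _ E] := MVT_total gdg ab.
by rewrite -subr_ge0 E mulr_ge0 ?subr_ge0.
Qed.

Lemma is_derive_scale (k : R) g (x d : R) : is_derive x 1 g d -> is_derive x 1 (fun t => k * g t) (k * d).
Proof. exact: is_deriveZ. Qed.

Lemma is_derive_scaled_sin (w x : R) :
  is_derive x 1 (fun t => sin (w * t)) (w * cos (w * x)).
Proof.
have dw : is_derive x 1 (fun t : R => w * t) (w * 1).
  by apply: is_derive_scale; exact: is_derive_id.
have := @is_derive1_comp R sin _ x _ _ (is_derive_sin _) dw.
by rewrite mulr1 mulrC.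
Qed.

Lemma is_derive_scaled_cos (w x : R) :
  is_derive x 1 (fun t => cos (w * t)) (- w * sin (w * x)).
Proof.
have dw : is_derive x 1 (fun t : R => w * t) (w * 1).
  by apply: is_derive_scale; exact: is_derive_id.
have := @is_derive1_comp R cos _ x _ _ (is_derive_cos _) dw.
by rewrite mulr1 mulrC mulrN mulNr.
Qed.

Lemma is_derive_bigsum n (h dh : nat -> R -> R) (x : R) :
  (forall j, is_derive x 1 (h j) (dh j x)) ->
  is_derive x 1 (fun t => \sum_(j < n) h j t) (\sum_(j < n) dh j x).
Proof.
move=> H; have := @is_derive_sum R R R n (fun j : 'I_n => h j) x 1 (fun j => dh j x) (fun j => H j).
by rewrite (_ : \sum_(i < n) _ = fun t => \sum_(j < n) h j t) //; apply/funext => t; rewrite fct_sumE.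
Qed.

Lemma sin_lip (a b : R) : `|sin a - sin b| <= `|a - b|.
Proof.
wlog ba : a b / b <= a.
  by move=> H; have [|/ltW] := leP b a; [exact: H|rewrite distrC [`|a - b|]distrC; exact: H].
have [c _ ->] := MVT_total (@is_derive_sin R) ba.
by rewrite normrM ler_piMl // cos_max.
Qed.

Lemma cos_lip (a b : R) : `|cos a - cos b| <= `|a - b|.
Proof.
wlog ba : a b / b <= a.
  by move=> H; have [|/ltW] := leP b a; [exact: H|rewrite distrC [`|a - b|]distrC; exact: H].
have [c _ ->] := MVT_total (@is_derive_cos R) ba.
by rewrite normrM normrN ler_piMl // sin_max.
Qed.

Lemma norm_sin_le (a : R) : `|sin a| <= `|a|.
Proof. by have := sin_lip a 0; rewrite sin0 !subr0. Qed.

Lemma sin_npi (n : nat) : sin (n%:R * pi) = 0 :> R.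
Proof.
elim: n => [|n IH]; first by rewrite mul0r sin0.
by rewrite -addn1 natrD mulrDl mul1r sinDpi IH oppr0.
Qed.

Lemma cos_npi (n : nat) : cos (n%:R * pi) = (-1) ^+ n :> R.
Proof.
elim: n => [|n IH]; first by rewrite mul0r cos0 expr0.
by rewrite -addn1 natrD mulrDl mul1r cosDpi IH exprD expr1 mulrN1.
Qed.

Lemma pi_lt4 : pi < 4 :> R.
Proof. by have /andP[_] := @pihalf_02 R; rewrite ltr_pdivrMr // => /lt_le_trans; apply; rewrite -natrM. Qed.

End Calculus.

Section Tail.
Context {R : realType}.

Definition lam (j : nat) : R := 64 ^+ j.

Lemma lam_gt0 j : 0 < lam j. Proof. by rewrite exprn_gt0. Qed.
Lemma lamS j : lam j.+1 = 64 * lam j. Proof. by rewrite /lam exprS. Qed.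
Lemma lamD i j : lam (i + j) = lam i * lam j. Proof. by rewrite /lam exprD. Qed.
Lemma lam_nat j : lam j = (64 ^ j)%:R. Proof. by rewrite natrX. Qed.
Lemma lam_neq0 j : lam j != 0. Proof. by rewrite gt_eqF // lam_gt0. Qed.
Lemma lam_ge1 j : 1 <= lam j. Proof. by rewrite exprn_ege1 // ler1n. Qed.

Lemma sum_tail_le (A : R) n k : 0 <= A ->
  \sum_(j < k) A / lam (n + j) <= 2 * A / lam n.
Proof.
move=> A0.
suff : \sum_(j < k) A / lam (n + j) <= 2 * A / lam n - 2 * A / lam (n + k).
  by move/le_trans; apply; rewrite gerBl divr_ge0 ?mulr_ge0 // ltW // lam_gt0.
elim: k => [|k IH]; first by rewrite big_ord0 addn0 subrr.
rewrite big_ord_recr /=; apply: le_trans (lerD IH (lexx _)) _.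
rewrite addnS lamS invfM.
have : 0 <= A / lam (n + k) by rewrite divr_ge0 // ltW // lam_gt0.
by rewrite -!mulrA [A * (64^-1 * _)]mulrCA; lra.
Qed.

Lemma lim_norm_le (x : nat -> R) (l a B : R) n : x @ \oo --> l ->
  (forall k, (n <= k)%N -> `|x k - a| <= B) -> `|l - a| <= B.
Proof.
move=> xl H; apply/ler_addgt0Pr => e e0.
have /cvgrPdist_lt /(_ _ e0) [m _ Hm] := xl.
have := Hm (maxn n m) (leq_maxr _ _) => /= h1.
have h2 := H _ (leq_maxl n m).
rewrite -(subrKA (x (maxn n m))); apply: le_trans (ler_normD _ _) _.
by rewrite addrC lerD // ltW.
Qed.

Lemma lac_tail (u : nat -> R) n (A : R) : 0 <= A ->
  (forall j, (n <= j)%N -> `|u j| <= A / lam j) ->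
  cvgn (fun k => \sum_(j < k) u j) /\
  `|limn (fun k => \sum_(j < k) u j) - \sum_(j < n) u j| <= 2 * A / lam n.
Proof.
move=> A0 uA.
have cu : cvgn (fun k => \sum_(j < k) u j).
  have -> : (fun k => \sum_(j < k) u j) = series u.
    by apply/funext => k; rewrite /series /= big_mkord.
  pose u' j := if (j < n)%N then 0 else u j.
  rewrite -(is_cvg_series_restrict n).
  rewrite (_ : [sequence _]_n = [sequence \sum_(n <= k < m) u' k]_m); last first.
    apply/funext => m /=; apply: eq_big_nat => j /andP[nj _].
    by rewrite /u' ltnNge nj.
  rewrite is_cvg_series_restrict; apply: normed_cvg.
  apply: (@series_le_cvg _ _ (geometric A (64^-1))) => [j|j|j|] //=.
  - by rewrite mulr_ge0 // exprn_ge0 // invr_ge0.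
  - rewrite /u'; case: ltnP => nj; first by rewrite normr0 mulr_ge0 // exprn_ge0 // invr_ge0.
    by rewrite exprVn; exact: uA.
  - by apply: is_cvg_geometric_series; rewrite ger0_norm ?invr_ge0 // invf_lt1 // ltr1n.
split=> //; apply: (lim_norm_le (n := n) cu) => k nk.
rewrite -(subnKC nk) big_split_ord /= [X in X - _]addrC addrK.
apply: le_trans (ler_norm_sum _ _ _) _.
apply: le_trans (sum_tail_le n (k - n) A0); apply: ler_sum => j _.
by apply: uA; rewrite leq_addr.
Qed.
End Tail.

Section Lacunary.
Context {R : realType}.
Local Notation lam := (@lam R).
Variable eta : nat -> R.
Hypothesis eta_gt0 : forall j, 0 < eta j.
Hypothesis eta_le1 : forall j, eta j <= 1.
Hypothesis eta_dec : forall j, eta j.+1 <= eta j.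
Hypothesis eta_slow : forall j, eta j <= 2 * eta j.+1.

Definition lacn (n : nat) (t : R) : R := \sum_(j < n) eta j / lam j * sin (lam j * t).
Definition dlacn (n : nat) (t : R) : R := \sum_(j < n) eta j * cos (lam j * t).
Definition placn (n : nat) (t : R) : R := \sum_(j < n) - (eta j / lam j ^+ 2) * cos (lam j * t).
Definition lac (t : R) : R := limn (lacn ^~ t).
Definition plac (t : R) : R := limn (placn ^~ t).

Lemma eta_mono i j : (i <= j)%N -> eta j <= eta i.
Proof.
elim: j => [|j IH]; first by rewrite leqn0 => /eqP ->.
rewrite leq_eqVlt => /orP[/eqP -> //|]; rewrite ltnS => /IH; apply: le_trans; exact: eta_dec.
Qed.

Lemma lac_term n j t : (n <= j)%N -> `|eta j / lam j * sin (lam j * t)| <= eta n / lam j.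
Proof.
move=> nj; have l0 := ltW (@lam_gt0 R j).
rewrite normrM ger0_norm ?divr_ge0 ?(ltW (eta_gt0 _)) //.
apply: le_trans (ler_piMr _ (sin_max _)) _; first by rewrite divr_ge0 ?(ltW (eta_gt0 _)).
by rewrite ler_wpM2r ?invr_ge0 // eta_mono.
Qed.

Lemma plac_term n j t : (n <= j)%N ->
  `|- (eta j / lam j ^+ 2) * cos (lam j * t)| <= eta n / lam n / lam j.
Proof.
move=> nj; have l0 := @lam_gt0 R j; have l1 := @lam_gt0 R n.
rewrite normrM normrN [X in X * _]ger0_norm ?divr_ge0 ?exprn_ge0 ?(ltW (eta_gt0 _)) ?(ltW l0) //.
apply: le_trans (ler_piMr _ (cos_max _)) _.
  by rewrite divr_ge0 ?exprn_ge0 ?(ltW (eta_gt0 _)) ?(ltW l0).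
rewrite expr2 invfM mulrA ler_wpM2r ?invr_ge0 ?(ltW l0) //.
apply: ler_pM; rewrite ?invr_ge0 ?(ltW (eta_gt0 _)) ?(ltW l0) ?eta_mono //.
by rewrite lef_pV2 ?posrE // ler_weXn2l // ler1n.
Qed.

Lemma lac_cvg t : lacn ^~ t @ \oo --> lac t.
Proof.
have [] // := @lac_tail R (fun j => eta j / lam j * sin (lam j * t)) 0 (eta 0%N).
- exact: ltW.
- by move=> j _; exact: lac_term.
Qed.

Lemma plac_cvg t : placn ^~ t @ \oo --> plac t.
Proof.
have [] // := @lac_tail R (fun j => - (eta j / lam j ^+ 2) * cos (lam j * t)) 0 (eta 0%N / lam 0).
- by rewrite divr_ge0 ?ltW // lam_gt0.
- by move=> j _; exact: plac_term.
Qed.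

Lemma lac_approx n t : `|lac t - lacn n t| <= 2 * eta n / lam n.
Proof.
have [] // := @lac_tail R (fun j => eta j / lam j * sin (lam j * t)) n (eta n).
- exact: ltW.
- by move=> j nj; exact: lac_term.
Qed.

Lemma plac_approx n t : `|plac t - placn n t| <= 2 * eta n / lam n ^+ 2.
Proof.
have [||_] // := @lac_tail R (fun j => - (eta j / lam j ^+ 2) * cos (lam j * t)) n (eta n / lam n).
- by rewrite divr_ge0 ?ltW // lam_gt0.
- by move=> j nj; exact: plac_term.
- by rewrite expr2 invfM !mulrA.
Qed.

Lemma is_derive_lacn n (x : R) : is_derive x 1 (lacn n) (dlacn n x).
Proof.
apply: (@is_derive_bigsum R n (fun j t => eta j / lam j * sin (lam j * t))
  (fun j t => eta j * cos (lam j * t))) => j.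
have -> : eta j * cos (lam j * x) = eta j / lam j * (lam j * cos (lam j * x)).
  by rewrite mulrA divfK // lam_neq0.
by apply: is_derive_scale; exact: is_derive_scaled_sin.
Qed.

Lemma is_derive_placn n (x : R) : is_derive x 1 (placn n) (lacn n x).
Proof.
apply: (@is_derive_bigsum R n (fun j t => - (eta j / lam j ^+ 2) * cos (lam j * t))
  (fun j t => eta j / lam j * sin (lam j * t))) => j.
have -> : eta j / lam j * sin (lam j * x) = - (eta j / lam j ^+ 2) * (- lam j * sin (lam j * x)).
  by field; rewrite lam_neq0.
by apply: is_derive_scale; exact: is_derive_scaled_cos.
Qed.

(** By [eta_slow] the product eta j * lam j grows at least 32-fold at each step. The factor 16 is
    the one needed in [diff3_plac_lower]. *)
Lemma sum_eta_lam16 n : 16 * \sum_(j < n) eta j * lam j <= eta n * lam n.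
Proof.
elim: n => [|n IH]; first by rewrite big_ord0 mulr0 mulr_ge0 ?ltW // lam_gt0.
rewrite big_ord_recr /= mulrDr; apply: le_trans (lerD IH (lexx _)) _.
rewrite lamS; have h := ler_wpM2r (ltW (@lam_gt0 R n)) (eta_slow n).
have : 0 <= eta n.+1 * lam n by rewrite mulr_ge0 ?ltW // lam_gt0.
by rewrite mulrCA; lra.
Qed.

Lemma sum_eta_lam n : \sum_(j < n) eta j * lam j <= eta n * lam n.
Proof.
apply: le_trans (sum_eta_lam16 n); rewrite ler_peMl ?ler1n // sumr_ge0 // => j _.
by rewrite mulr_ge0 ?ltW // lam_gt0.
Qed.

Lemma dlacn_lip n s t : `|dlacn n s - dlacn n t| <= eta n * lam n * `|s - t|.
Proof.
rewrite /dlacn -sumrB; apply: le_trans (ler_norm_sum _ _ _) _.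
apply: le_trans (ler_wpM2r (normr_ge0 _) (sum_eta_lam n)); rewrite mulr_suml.
apply: ler_sum => j _; rewrite -mulrBr normrM gtr0_norm // -mulrA ler_wpM2l ?(ltW (eta_gt0 _)) //.
apply: le_trans (cos_lip _ _) _.
by rewrite -mulrBr normrM gtr0_norm ?lam_gt0.
Qed.

Lemma lacn_taylor n s t :
  `|lacn n s - lacn n t - dlacn n t * (s - t)| <= eta n * lam n * (s - t) ^+ 2.
Proof.
have H a b : a <= b -> exists2 c, a <= c <= b & lacn n b - lacn n a = dlacn n c * (b - a).
  exact: MVT_total (is_derive_lacn n).
have [c ct E] : exists2 c, `|c - t| <= `|s - t| & lacn n s - lacn n t = dlacn n c * (s - t).
  have [/H [c /andP[tc cs] E]|/ltW /H [c /andP[sc ct] E]] := leP t s.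
    by exists c => //; rewrite !ger0_norm ?subr_ge0 ?(le_trans tc) // lerD2r.
  exists c; last by rewrite -[LHS]opprB E -mulrN opprB.
  by rewrite ![`|_ - t|]distrC !ger0_norm ?subr_ge0 ?(le_trans sc) // lerB.
rewrite E -mulrBl normrM -real_normK ?num_real // expr2 mulrA.
rewrite ler_wpM2r //; apply: le_trans (dlacn_lip _ _ _) _.
by rewrite ler_wpM2l // mulr_ge0 ?ltW // lam_gt0.
Qed.

Lemma lacn_le2 n t : `|lacn n t| <= 2.
Proof.
apply: le_trans (ler_norm_sum _ _ _) _.
have := sum_tail_le 0 n (@ler01 R); rewrite mulr1 /lam expr0 divr1.
apply: le_trans; apply: ler_sum => j _; rewrite add0n.
apply: le_trans (lac_term _ (leq0n j)) _.
by rewrite ler_wpM2r // invr_ge0 ltW // lam_gt0.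
Qed.

Lemma cvg_dist_le (x : nat -> R) (l a B : R) : x @ \oo --> l ->
  (forall k, `|x k - a| <= B) -> `|l - a| <= B.
Proof. by move=> xl H; apply: (@lim_norm_le _ x l a B 0). Qed.

Lemma plac_cvgB s t : (fun k => placn k s - placn k t) @ \oo --> plac s - plac t.
Proof. by apply: cvgB; exact: plac_cvg. Qed.

Lemma plac_lip s t : `|plac s - plac t| <= 2 * `|s - t|.
Proof.
have cv := @plac_cvgB s t.
rewrite -[plac s - _]subr0; apply: (cvg_dist_le cv) => k /=; rewrite subr0.
wlog ts : s t cv / t <= s.
  move=> H; have [|/ltW st] := leP t s; first exact: H.
  rewrite distrC [`|s - t|]distrC; apply: H st.
  exact: plac_cvgB.
have [c _ E] := MVT_total (is_derive_placn k) ts.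
by rewrite E normrM ler_wpM2r // lacn_le2.
Qed.

Lemma lacn_lip n s t : `|lacn n s - lacn n t| <= n%:R * `|s - t|.
Proof.
rewrite /lacn -sumrB; apply: le_trans (ler_norm_sum _ _ _) _.
rewrite -[n in n%:R]card_ord -sumr_const mulr_suml.
apply: ler_sum => j _; rewrite mul1r -mulrBr normrM gtr0_norm ?divr_gt0 ?lam_gt0 //.
apply: le_trans (ler_wpM2l _ (sin_lip _ _)) _; first by rewrite ltW // divr_gt0 // lam_gt0.
rewrite -mulrBr normrM [`|lam j|]gtr0_norm ?lam_gt0 // mulrA divfK ?lam_neq0 //.
by rewrite ler_piMl.
Qed.

(** [lac] need not be Lipschitz. Cutting the series at n trades a Lipschitz constant n against a
    tail, which is enough for continuity. *)
Lemma lac_modulus n s t : `|lac s - lac t| <= n%:R * `|s - t| + 4 / lam n.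
Proof.
have -> : lac s - lac t = (lac s - lacn n s) + (lacn n s - lacn n t) - (lac t - lacn n t) by ring.
apply: le_trans (ler_normB _ _) _; apply: le_trans (lerD (ler_normD _ _) (lexx _)) _.
have H u : `|lac u - lacn n u| <= 2 / lam n.
  apply: le_trans (lac_approx _ _) _; rewrite ler_wpM2r ?invr_ge0 ?(ltW (lam_gt0 _)) //.
  by rewrite ler_piMr.
have hs := H s; have ht := H t; have hl := lacn_lip n s t.
have -> : 4 / lam n = 2 / lam n + 2 / lam n by rewrite -mulrDl -natrD.
lra.
Qed.

(** * The series on the grids of step pi / lam n *)

Lemma lacn_grid n m : (n <= m)%N -> forall i : nat, lacn m (i%:R * pi / lam n) = lacn n (i%:R * pi / lam n).
Proof.
move=> nm i; rewrite -(subnKC nm) /lacn big_split_ord /= [X in _ + X]big1 ?addr0 // => j _.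
rewrite lamD (_ : lam n * lam j * _ = (64 ^ j * i)%:R * pi) ?sin_npi ?mulr0 //.
by rewrite natrM -lam_nat; field; rewrite lam_neq0.
Qed.

Lemma lac_grid n i : lac (i%:R * pi / lam n) = lacn n (i%:R * pi / lam n).
Proof.
have H : `|lac (i%:R * pi / lam n) - lacn n (i%:R * pi / lam n)| <= 0.
  apply: (@lim_norm_le _ _ _ _ _ n (@lac_cvg _)) => m nm.
  by rewrite lacn_grid // subrr normr0.
by apply/eqP; rewrite -subr_eq0 -normr_le0.
Qed.

(** Frequencies above lam n have an even multiple of pi as argument at every grid point, so their
    cosines equal 1 and cancel in the difference. The frequency lam n alternates in sign and is
    kept, whence n.+1. *)
Lemma plac_grid n i j : plac (i%:R * pi / lam n) - plac (j%:R * pi / lam n) =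
  placn n.+1 (i%:R * pi / lam n) - placn n.+1 (j%:R * pi / lam n).
Proof.
set s := i%:R * _ / _; set t := j%:R * _ / _.
have cv := @plac_cvgB s t.
have H : `|(plac s - plac t) - (placn n.+1 s - placn n.+1 t)| <= 0.
  apply: (@lim_norm_le _ _ _ _ _ n.+1 cv) => m nm.
  have E k : placn m (k%:R * pi / lam n) = placn n.+1 (k%:R * pi / lam n) +
     \sum_(l < m - n.+1) - (eta (n.+1 + l) / lam (n.+1 + l) ^+ 2).
    have -> : placn m = placn (n.+1 + (m - n.+1)) by rewrite subnKC.
    rewrite {1}/placn big_split_ord /=; congr (_ + _).
    apply: eq_bigr => l _.
    rewrite -[RHS]mulr1; congr (_ * _).
    rewrite (_ : lam (n.+1 + l) * _ = (64 ^ l * 64 * k)%:R * pi).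
      by rewrite cos_npi -signr_odd !oddM /= andbF expr0.
    by rewrite !natrM -lam_nat addSn lamS lamD; field; rewrite lam_neq0.
  rewrite !E.
  by rewrite (_ : _ - _ = 0) ?normr0 //; ring.
by apply/eqP; rewrite -subr_eq0 -normr_le0.
Qed.

(** Third differences annihilate quadratics, which is what a horizontal line amounts to in
    [line_near_quadratic]. *)
Definition diff3 (g : R -> R) (h t : R) : R :=
  g (t + 3 * h) - 3 * g (t + 2 * h) + 3 * g (t + h) - g t.

(** The third difference of a cosine is exactly 8 sin^3 (w h / 2) sin (w t + 3 w h / 2). *)
Lemma diff3_cos w h t : `|diff3 (fun x => cos (w * x)) h t| <= `|w * h| ^+ 3.
Proof.
have E : diff3 (fun x => cos (w * x)) h t =
    8 * sin (w * h / 2) ^+ 3 * sin (w * t + 3 * (w * h / 2)).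
  rewrite /diff3; set a := w * t; set b := w * h / 2.
  have -> : w * (t + 3 * h) = (a + 3 * b) + 3 * b by rewrite /a /b; field.
  have -> : w * (t + 2 * h) = (a + 3 * b) + b by rewrite /a /b; field.
  have -> : w * (t + h) = (a + 3 * b) - b by rewrite /a /b; field.
  have -> : cos a = cos ((a + 3 * b) - 3 * b) by congr cos; ring.
  rewrite !cosB; set c := a + 3 * b; rewrite [cos (c + 3 * b)]cosD [cos (c + b)]cosD.
  have -> : sin (3 * b) = 3 * sin b - 4 * sin b ^+ 3.
    rewrite (_ : 3 * b = b *+ 2 + b); last by ring.
    rewrite sinD sin_mulr2n cos_mulr2n.
    have cs : cos b ^+ 2 = 1 - sin b ^+ 2 by rewrite -(cos2Dsin2 b); ring.
    transitivity (4 * cos b ^+ 2 * sin b - sin b); first by ring.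
    by rewrite cs; ring.
  by ring.
rewrite E normrM [`|8 * _|]normrM normrX [`|8|]ger0_norm //.
apply: le_trans (ler_piMr _ (sin_max _)) _; first by rewrite mulr_ge0 // exprn_ge0.
have -> : `|w * h| ^+ 3 = 8 * `|w * h / 2| ^+ 3.
  have -> : `|w * h / 2| = `|w * h| / 2 by rewrite normrM [X in _ * X]ger0_norm ?invr_ge0.
  by field.
by rewrite ler_wpM2l // lerXn2r ?nnegrE // norm_sin_le.
Qed.

Lemma diff3_placn n h t : diff3 (placn n) h t =
  \sum_(j < n) - (eta j / lam j ^+ 2) * diff3 (fun x => cos (lam j * x)) h t.
Proof.
by rewrite /diff3 /placn !mulr_sumr -!sumrB -big_split /= -sumrB; apply: eq_bigr => j _; ring.
Qed.

(** The summand of frequency lam k alternates in sign along the grid, so its third difference has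
    the full weight 1 + 3 + 3 + 1 = 8. The lower frequencies take away at most half of it. *)
Lemma diff3_plac_lower k i : let h := pi / lam k in
  4 * (eta k / lam k ^+ 2) <= `|diff3 plac h (i%:R * h)|.
Proof.
set h := pi / lam k => /=.
have hE (m : nat) : i%:R * h + m%:R * h = (i + m)%:R * pi / lam k by rewrite natrD /h; field; rewrite lam_neq0.
have hE1 : i%:R * h + h = (i + 1)%:R * pi / lam k by rewrite -hE mul1r.
have h0E : i%:R * h = i%:R * pi / lam k by rewrite /h mulrA.
have E : diff3 plac h (i%:R * h) = diff3 (placn k.+1) h (i%:R * h).
  rewrite /diff3 !hE hE1 h0E.
  have := plac_grid k (i + 3) i; have := plac_grid k (i + 2) i; have := plac_grid k (i + 1) i.
  by move=> g1 g2 g3; lra.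
rewrite E diff3_placn big_ord_recr /=.
set S := \sum_(j < k) _.
have pi3 : pi ^+ 3 <= 64 :> R.
  rewrite (_ : 64 = 4 ^+ 3); last by rewrite -natrX.
  by rewrite lerXn2r ?nnegrE ?pi_ge0 // ltW // pi_lt4.
(* The bound pi^3 <= 64 combined with [sum_eta_lam16] leaves the factor 64 / 16 = 4. *)
have Sle : `|S| <= 4 * (eta k / lam k ^+ 2).
  apply: le_trans (ler_norm_sum _ _ _) _.
  apply: (@le_trans _ _ (\sum_(j < k) eta j * lam j * (h ^+ 3))).
    apply: ler_sum => j _; rewrite normrM normrN [X in X * _]ger0_norm; last first.
      by rewrite divr_ge0 ?exprn_ge0 ?(ltW (eta_gt0 _)) ?(ltW (lam_gt0 _)).
    have -> : eta j * lam j * h ^+ 3 = eta j / lam j ^+ 2 * (lam j * h) ^+ 3.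
      by field; rewrite lam_neq0.
    rewrite ler_wpM2l ?divr_ge0 ?exprn_ge0 ?(ltW (eta_gt0 _)) ?(ltW (lam_gt0 _)) //.
    apply: le_trans (diff3_cos _ _ _) _.
    by rewrite ger0_norm // mulr_ge0 ?divr_ge0 ?pi_ge0 // ltW // lam_gt0.
  rewrite -mulr_suml.
  have -> : h ^+ 3 = pi ^+ 3 / lam k ^+ 3 by rewrite /h expr_div_n.
  rewrite mulrA ler_pdivrMr ?exprn_gt0 ?lam_gt0 //.
  have -> : 4 * (eta k / lam k ^+ 2) * lam k ^+ 3 = 4 * (eta k * lam k) by field; rewrite lam_neq0.
  have s0 : 0 <= \sum_(j < k) eta j * lam j.
    by rewrite sumr_ge0 // => j _; rewrite mulr_ge0 ?ltW // lam_gt0.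
  apply: le_trans (ler_wpM2l s0 pi3) _; have := sum_eta_lam16 k; lra.
have -> : diff3 (fun x => cos (lam k * x)) h (i%:R * h) = - 8 * (-1) ^+ i.
  rewrite /diff3 !hE hE1 h0E.
  have c m : lam k * (m%:R * pi / lam k) = m%:R * pi by field; rewrite lam_neq0.
  rewrite !c !cos_npi !exprD; ring.
have e0 : 0 <= eta k / lam k ^+ 2.
  by rewrite divr_ge0 ?exprn_ge0 ?(ltW (eta_gt0 _)) ?(ltW (lam_gt0 _)).
have n8 : `|- (eta k / lam k ^+ 2) * (- 8 * (-1) ^+ i)| = 8 * (eta k / lam k ^+ 2).
  have -> : - (eta k / lam k ^+ 2) * (-8 * (-1) ^+ i) = 8 * (eta k / lam k ^+ 2) * (-1) ^+ i by ring.
  by rewrite normrM normrX normrN1 expr1n mulr1 ger0_norm // mulr_ge0.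
rewrite addrC -[S]opprK; apply: le_trans (lerB_dist _ _); rewrite n8 normrN; lra.
Qed.

(** * The majorant of the increments *)

Definition icos (w t : R) : R := if w == 0 then t else sin (w * t) / w.

Lemma is_derive_icos w (x : R) : is_derive x 1 (icos w) (cos (w * x)).
Proof.
(* The frequency 0 does occur: it belongs to the terms i = j of [maj]. *)
rewrite /icos; have [->|w0] := eqVneq w 0.
  by rewrite mul0r cos0; exact: is_derive_id.
have -> : (fun t => sin (w * t) / w) = (fun t => w^-1 * sin (w * t)).
  by apply/funext => t; rewrite mulrC.
have -> : cos (w * x) = w^-1 * (w * cos (w * x)) by rewrite mulKf.
by apply: is_derive_scale; exact: is_derive_scaled_sin.
Qed.

(* The antiderivative of (1 + (lacn n)'^2) / 2, which dominates the increments
   of lacn n because 1 + y^2 >= 2 |y|. *)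
Definition maj (n : nat) (t : R) : R := 2^-1 * (t + \sum_(i < n) \sum_(j < n)
  eta i * eta j * (2^-1 * (icos (lam i + lam j) t + icos (lam i - lam j) t))).

Lemma is_derive_maj n (x : R) : is_derive x 1 (maj n) (2^-1 * (1 + dlacn n x ^+ 2)).
Proof.
apply: is_derive_scale.
pose h i t := \sum_(j < n) eta i * eta j * (2^-1 * (icos (lam i + lam j) t + icos (lam i - lam j) t)).
have dh : is_derive x 1 (fun t => \sum_(i < n) h i t)
    (\sum_(i < n) \sum_(j < n) eta i * eta j * (2^-1 * (cos ((lam i + lam j) * x) + cos ((lam i - lam j) * x)))).
  apply: (@is_derive_bigsum R n h (fun i x => \sum_(j < n)
    eta i * eta j * (2^-1 * (cos ((lam i + lam j) * x) + cos ((lam i - lam j) * x))))) => i.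
  apply: (@is_derive_bigsum R n (fun j t => eta i * eta j * (2^-1 * (icos (lam i + lam j) t + icos (lam i - lam j) t)))
    (fun j x => eta i * eta j * (2^-1 * (cos ((lam i + lam j) * x) + cos ((lam i - lam j) * x))))) => j.
  apply: is_derive_scale; apply: is_derive_scale.
  by apply: is_deriveD; exact: is_derive_icos.
have := is_deriveD (is_derive_id x 1) dh.
congr (is_derive _ _ _ _); congr (_ + _).
rewrite expr2 /dlacn big_distrlr /=; apply: eq_bigr => i _; apply: eq_bigr => j _.
by rewrite mulrDl mulrBl cosD cosB; field.
Qed.

Lemma maj_id n s t : s <= t -> (t - s) / 2 <= maj n t - maj n s.
Proof.
move=> st; have [c _ ->] := MVT_total (is_derive_maj n) st.
rewrite mulrC ler_wpM2r ?subr_ge0 // -[leLHS]mulr1 ler_wpM2l ?invr_ge0 //.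
by rewrite lerDl sqr_ge0.
Qed.

Lemma maj_mono n s t : s <= t -> maj n s <= maj n t.
Proof.
move=> st; rewrite -subr_ge0; apply: le_trans (maj_id _ st).
by rewrite divr_ge0 // subr_ge0.
Qed.

Lemma maj_lacn n s t : s <= t -> `|lacn n t - lacn n s| <= maj n t - maj n s.
Proof.
move=> st; rewrite ler_norml; apply/andP; split.
  have d (x : R) : is_derive x 1 (fun t => maj n t + lacn n t) (2^-1 * (1 + dlacn n x ^+ 2) + dlacn n x).
    by apply: is_deriveD; [exact: is_derive_maj|exact: is_derive_lacn].
  have := le_of_derive d _ st.
  have p x : 0 <= 2^-1 * (1 + dlacn n x ^+ 2) + dlacn n x.
    by have := sqr_ge0 (dlacn n x + 1); lra.
  by move/(_ p); lra.
have d (x : R) : is_derive x 1 (fun t => maj n t - lacn n t) (2^-1 * (1 + dlacn n x ^+ 2) - dlacn n x).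
  by apply: is_deriveB; [exact: is_derive_maj|exact: is_derive_lacn].
have := le_of_derive d _ st.
have p x : 0 <= 2^-1 * (1 + dlacn n x ^+ 2) - dlacn n x.
  by have := sqr_ge0 (dlacn n x - 1); lra.
by move/(_ p); lra.
Qed.

Lemma maj0 n : maj n 0 = 0.
Proof.
have i0 w : icos w 0 = 0 by rewrite /icos mulr0 sin0 mul0r if_same.
by rewrite /maj add0r big1 ?mulr0 // => i _; rewrite big1 // => j _; rewrite !i0 addr0 !mulr0.
Qed.

(** Orthogonality over a period: the cosines of frequency lam i + lam j integrate to 0, and those of
    frequency lam i - lam j contribute only for i = j. *)
Lemma maj_2pi n : maj n (2 * pi) = pi + pi / 2 * \sum_(j < n) eta j ^+ 2.
Proof.
have i0 (m : nat) : icos m%:R (2 * pi) = if m == 0%N then 2 * pi else 0.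
  rewrite /icos pnatr_eq0; case: ifP => // _.
  by rewrite mulrA -natrM sin_npi mul0r.
have iN w t : icos (- w) t = icos w t.
  by rewrite /icos oppr_eq0; case: ifP => // _; rewrite mulNr sinN invrN mulrNN.
have iD i j : icos (lam i + lam j) (2 * pi) = 0.
  by rewrite !lam_nat -natrD i0 addn_eq0 !expn_eq0.
have iB i j : icos (lam i - lam j) (2 * pi) = if i == j then 2 * pi else 0.
  wlog ij : i j / (i <= j)%N.
    move=> H; have [|/ltnW ji] := leqP i j; first exact: H.
    by rewrite -opprB iN H // eq_sym.
  rewrite -opprB iN !lam_nat -natrB ?leq_exp2l // i0 subn_eq0 leq_exp2l //.
  by rewrite eqn_leq ij.
rewrite /maj mulrDr mulrA mulVf // mul1r; congr (_ + _).
rewrite [pi / 2]mulrC -mulrA; congr (_ * _); rewrite mulr_sumr; apply: eq_bigr => i _.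
rewrite (bigD1 i) //= big1 ?addr0 => [|j ji].
  by rewrite iD iB eqxx; field.
by rewrite iD iB (inj_eq val_inj) eq_sym (negbTE ji) addr0 !mulr0.
Qed.

(** * Discrete orthogonality and the Riesz product *)

Inductive cos_poly (D : nat) : (R -> R) -> Prop :=
| Cos_poly_mono c m : (m <= D)%N -> cos_poly D (fun t => c * cos (m%:R * t))
| Cos_poly_add f g : cos_poly D f -> cos_poly D g -> cos_poly D (fun t => f t + g t).

Lemma cos_poly_widen D D' f : (D <= D')%N -> cos_poly D f -> cos_poly D' f.
Proof.
move=> DD; elim => [c m mD|g h _ ? _ ?]; last exact: Cos_poly_add.
by apply: Cos_poly_mono; exact: leq_trans DD.
Qed.

Lemma cos_poly_scale D f a : cos_poly D f -> cos_poly D (fun t => a * f t).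
Proof.
elim => [c m mD|g h _ Hg _ Hh].
  have -> : (fun t => a * (c * cos (m%:R * t))) = (fun t => (a * c) * cos (m%:R * t)).
    by apply/funext => t; rewrite mulrA.
  exact: Cos_poly_mono.
have -> : (fun t => a * (g t + h t)) = (fun t => a * g t + a * h t).
  by apply/funext => t; rewrite mulrDr.
exact: Cos_poly_add.
Qed.

Lemma cos_poly_mulcos D f k : cos_poly D f -> cos_poly (D + k) (fun t => f t * cos (k%:R * t)).
Proof.
elim => [c m mD|g h _ Hg _ Hh]; last first.
  have -> : (fun t => (g t + h t) * cos (k%:R * t)) =
     (fun t => g t * cos (k%:R * t) + h t * cos (k%:R * t)).
    by apply/funext => t; rewrite mulrDl.
  exact: Cos_poly_add.
have -> : (fun t => c * cos (m%:R * t) * cos (k%:R * t)) =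
    (fun t => c / 2 * cos ((m + k)%:R * t) + c / 2 * cos ((maxn m k - minn m k)%:R * t)).
  apply/funext => t; rewrite natrD mulrDl cosD.
  have -> : cos ((maxn m k - minn m k)%:R * t) = cos (m%:R * t - k%:R * t).
    have [mk|/ltnW km] := leqP m k.
      by rewrite natrB // mulrBl -cosN opprB.
    by rewrite natrB // mulrBl.
  by rewrite cosB; field.
by apply: Cos_poly_add; apply: Cos_poly_mono; lia.
Qed.

Section Grid.
Variable N : nat.
Hypothesis N_gt0 : (0 < N)%N.
Let h : R := 2 * pi / N%:R.
(** Cell midpoints, because the increment of a sine over a cell is a multiple of the cosine at its
    midpoint. *)
Let tau (i : nat) : R := (i%:R + 2^-1) * h.
Let I (f : R -> R) : R := \sum_(i < N) f (tau i).

Let h_gt0 : 0 < h. Proof. by rewrite divr_gt0 ?mulr_gt0 ?pi_gt0 ?ltr0n. Qed.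

(** Multiplied by sin (m h / 2), which is positive for 0 < m < N, the sum telescopes to a multiple
    of sin (2 m pi). *)
Lemma grid_cos0 m : (0 < m < N)%N -> I (fun t => cos (m%:R * t)) = 0.
Proof.
move=> /andP[m0 mN]; pose s : R := sin (m%:R * (h / 2)).
have s0 : s != 0.
  rewrite gt_eqF // sin_gt0_pi //; apply/andP; split.
    by rewrite mulr_gt0 ?ltr0n // divr_gt0.
  have -> : m%:R * (h / 2) = pi * (m%:R / N%:R) by rewrite /h; field; rewrite pnatr_eq0 -lt0n.
  by rewrite gtr_pMr ?pi_gt0 // ltr_pdivrMr ?ltr0n // mul1r ltr_nat.
apply: (mulfI s0); rewrite mulr0 /I mulr_sumr.
have E (i : 'I_N) : s * cos (m%:R * tau i) =
    2^-1 * (sin (m%:R * (i.+1%:R * h)) - sin (m%:R * (i%:R * h))).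
  have -> : m%:R * (i.+1%:R * h) = m%:R * tau i + m%:R * (h / 2) by rewrite /tau -natr1; field.
  have -> : m%:R * (i%:R * h) = m%:R * tau i - m%:R * (h / 2) by rewrite /tau; field.
  by rewrite sinD sinB /s; field.
under eq_bigr do rewrite E.
rewrite -mulr_sumr -(big_mkord xpredT (fun i => sin (m%:R * (i.+1%:R * h)) - sin (m%:R * (i%:R * h)))).
rewrite telescope_sumr // mul0r mulr0 sin0 subr0.
have -> : m%:R * (N%:R * h) = (m * 2)%:R * pi.
  by rewrite natrM /h; field; rewrite pnatr_eq0 -lt0n.
by rewrite sin_npi mulr0.
Qed.

Lemma grid_mulcos0 D f k : cos_poly D f -> (D < k)%N -> (D + k < N)%N ->
  I (fun t => f t * cos (k%:R * t)) = 0.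
Proof.
move=> + Dk DkN; elim => [c m mD|g l _ Hg _ Hl]; last first.
  rewrite /I; under eq_bigr do rewrite mulrDl.
  by rewrite big_split /= -/(I (fun t => g t * cos (k%:R * t))) Hg -/(I (fun t => l t * cos (k%:R * t))) Hl addr0.
have E t : c * cos (m%:R * t) * cos (k%:R * t) = c / 2 * cos ((k + m)%:R * t) + c / 2 * cos ((k - m)%:R * t).
  rewrite natrD natrB; last by lia.
  by rewrite mulrDl mulrBl cosD cosB; field.
rewrite /I; under eq_bigr do rewrite E.
rewrite big_split /= -!mulr_sumr -/(I (fun t => cos ((k + m)%:R * t))) -/(I (fun t => cos ((k - m)%:R * t))).
by rewrite !grid_cos0 ?mulr0 ?addr0 //; lia.
Qed.

Lemma grid_mulcos2 D f k : cos_poly D f -> (D < 2 * k)%N -> (D + 2 * k < N)%N ->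
  I (fun t => f t * cos (k%:R * t) ^+ 2) = 2^-1 * I f.
Proof.
move=> fD Dk DkN.
have E t : f t * cos (k%:R * t) ^+ 2 = 2^-1 * f t + 2^-1 * (f t * cos ((2 * k)%:R * t)).
  have -> : (2 * k)%:R * t = (k%:R * t) *+ 2 by rewrite natrM mulr2n; ring.
  by rewrite cos_mulr2n; field.
rewrite /I; under eq_bigr do rewrite E.
rewrite big_split /= -!mulr_sumr -/(I f) -/(I (fun t => f t * cos ((2 * k)%:R * t))).
by rewrite (grid_mulcos0 fD) // mulr0 addr0.
Qed.

Variables a b : nat -> R.

(* Real and imaginary parts of the Riesz product of the 1 + i a_j cos (64^j t). *)
Fixpoint riesz (m : nat) : (R -> R) * (R -> R) :=
  if m is l.+1 then
    let c t := cos ((64 ^ l)%:R * t) in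
    let: (P, Q) := riesz l in
    (fun t => P t + - a l * (Q t * c t), fun t => Q t + a l * (P t * c t))
  else (fun t => 1 * cos (0%:R * t), fun t => 0 * cos (0%:R * t)).

(** Each factor adds its frequency to the degree. As 4 D < 64^m, the next frequency exceeds the
    degree reached so far, which makes the new terms orthogonal to the old ones. *)
Lemma riesz_poly m : exists2 D, (4 * D < 64 ^ m)%N &
  cos_poly D (riesz m).1 /\ cos_poly D (riesz m).2.
Proof.
elim: m => [|m [D Dm [HP HQ]]]; first by exists 0%N => //; split; exact: Cos_poly_mono.
exists (D + 64 ^ m)%N; first by rewrite expnS; lia.
move: HP HQ => /=; case: (riesz m) => P Q /= HP HQ.
by split; apply: Cos_poly_add; try (apply: cos_poly_scale; exact: cos_poly_mulcos);
  apply: cos_poly_widen (leq_addr _ _) _.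
Qed.

(** The imaginary unit is what helps: the squared modulus of 1 + i a c is 1 + a^2 c^2, so the
    product is controlled by the squares of the coefficients, whereas real factors 1 + a c would
    involve the coefficients themselves. *)
Lemma riesz_norm m t : (riesz m).1 t ^+ 2 + (riesz m).2 t ^+ 2 <= \prod_(j < m) (1 + a j ^+ 2).
Proof.
elim: m => [|m IH]; first by rewrite /= big_ord0 !mul0r cos0 mul1r expr1n expr0n addr0.
rewrite big_ord_recr /=; move: IH; case: (riesz m) => P Q /= IH.
set c := cos _.
have -> : (P t + - a m * (Q t * c)) ^+ 2 + (Q t + a m * (P t * c)) ^+ 2 =
   (P t ^+ 2 + Q t ^+ 2) * (1 + a m ^+ 2 * c ^+ 2) by ring.
apply: ler_pM => //; first by rewrite addr_ge0 // sqr_ge0.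
  by rewrite addr_ge0 // mulr_ge0 // sqr_ge0.
rewrite lerD2l ler_piMr ?sqr_ge0 //.
by rewrite -real_normK ?num_real // expr_le1 // cos_max.
Qed.

(** In the step from m to m + 1, the terms with one new cosine average to 0, and the square of the
    new cosine averages to 1 / 2. *)
Lemma riesz_pairing n m : N = (2 * 64 ^ n)%N -> (m <= n)%N ->
  I (riesz m).1 = N%:R /\
  I (fun t => (\sum_(j < m) b j * cos ((64 ^ j)%:R * t)) * (riesz m).2 t) =
    N%:R / 2 * \sum_(j < m) a j * b j.
Proof.
move=> NE; elim: m => [_|m IH mn].
  rewrite /I /=; split.
    by under eq_bigr do rewrite mul0r cos0 mul1r; rewrite sumr_const card_ord.
  by rewrite big1 ?big_ord0 ?mulr0 // => i _; rewrite big_ord0 mul0r.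
have [IP IQ] := IH (ltnW mn).
have [D Dm [HP HQ]] := riesz_poly m.
have mN : (64 * 64 ^ m <= 64 ^ n)%N by rewrite -expnS leq_exp2l.
have m0 : (0 < 64 ^ m)%N by rewrite expn_gt0.
move: HP HQ IP IQ => /=; case: (riesz m) => P Q /= HP HQ IP IQ.
pose c (t : R) := cos ((64 ^ m)%:R * t).
have IcQ : I (fun t => Q t * c t) = 0 by apply: (grid_mulcos0 HQ); lia.
have IcP : I (fun t => P t * c t) = 0 by apply: (grid_mulcos0 HP); lia.
have IccP : I (fun t => P t * c t ^+ 2) = 2^-1 * N%:R.
  by rewrite (grid_mulcos2 HP) ?IP //; lia.
split.
  by rewrite /I big_split /= -mulr_sumr -/(I P) -/(I (fun t => Q t * c t)) IP IcQ mulr0 addr0.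
pose X (t : R) := \sum_(j < m) b j * cos ((64 ^ j)%:R * t).
(* The products of P with the earlier cosines still have degree below 64^m. *)
have IXcP : I (fun t => X t * P t * c t) = 0.
  have -> : I (fun t => X t * P t * c t) =
      \sum_(j < m) b j * I (fun t => (P t * cos ((64 ^ j)%:R * t)) * c t).
    rewrite /I; under [RHS]eq_bigr do rewrite mulr_sumr.
    rewrite exchange_big /=; apply: eq_bigr => i _; rewrite /X !mulr_suml.
    by apply: eq_bigr => j _; ring.
  rewrite big1 // => j _; rewrite (grid_mulcos0 (cos_poly_mulcos _ HP)) ?mulr0 //.
    have : (64 * 64 ^ j <= 64 ^ m)%N by rewrite -expnS leq_exp2l.
    by lia.
  have : (64 * 64 ^ j <= 64 ^ m)%N by rewrite -expnS leq_exp2l.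
  by lia.
have E t : (\sum_(j < m.+1) b j * cos ((64 ^ j)%:R * t)) * (Q t + a m * (P t * cos ((64 ^ m)%:R * t))) =
   X t * Q t + b m * (Q t * c t) + a m * (X t * P t * c t) + a m * b m * (P t * c t ^+ 2).
  by rewrite big_ord_recr /= -/(X t) -/(c t); ring.
transitivity (I (fun t => X t * Q t + b m * (Q t * c t) + a m * (X t * P t * c t) +
    a m * b m * (P t * c t ^+ 2))); first by apply: eq_bigr => i _; exact: E.
rewrite {1}/I !big_split /= -!mulr_sumr -/(I (fun t => X t * Q t)) -/(I (fun t => Q t * c t)).
rewrite -/(I (fun t => X t * P t * c t)) -/(I (fun t => P t * c t ^+ 2)) IQ IcQ IXcP IccP.
by rewrite big_ord_recr /=; field.
Qed.

End Grid.

(** As long as the sum is at most 1, the product times one minus the sum is at most 1. *)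
Lemma prod_1D_le (x : nat -> R) m : (forall j, 0 <= x j) -> \sum_(j < m) x j <= 2^-1 ->
  \prod_(j < m) (1 + x j) <= 2.
Proof.
move=> x0.
have H k : \sum_(j < k) x j <= 1 -> \prod_(j < k) (1 + x j) * (1 - \sum_(j < k) x j) <= 1.
  elim: k => [|k IH]; first by rewrite !big_ord0 subr0 mulr1.
  rewrite !big_ord_recr /=; set p := \prod_(_ < _) _; set s := \sum_(_ < _) _ => sk.
  have s0 : 0 <= s by rewrite sumr_ge0.
  have p0 : 0 <= p by rewrite prodr_ge0 // => j _; rewrite addr_ge0.
  have xk := x0 k.
  apply: le_trans (IH _); last by rewrite -/s; lra.
  rewrite -/p -/s -mulrA ler_wpM2l //; nra.
move=> s2; have := H m.
have p0 : 0 <= \prod_(j < m) (1 + x j) by rewrite prodr_ge0 // => j _; rewrite addr_ge0.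
have s1 : \sum_(j < m) x j <= 1 by lra.
by move=> /(_ s1); nra.
Qed.

Lemma sin_ge_half (x : R) : 0 <= x -> x <= 2^-1 -> x / 2 <= sin x.
Proof.
move=> x0 x2; have [c /andP[c0 cx]] := MVT_total (@is_derive_sin R) x0.
rewrite sin0 !subr0 => ->; rewrite mulrC ler_wpM2r //.
have := cos_lip c 0; rewrite cos0 subr0 (ger0_norm c0).
by rewrite ler_norml => /andP[+ _]; lra.
Qed.

(** Divided by the mesh, the increments of [lac] are the values of a lacunary cosine sum at the cell
    midpoints. Its pairing with the imaginary part of a bounded Riesz product is of order e S / h
    from below and at most of order V / h. *)
Lemma lac_variation (V : R) n :
  \sum_(i < 2 * 64 ^ n) `|lac (i.+1%:R * pi / lam n) - lac (i%:R * pi / lam n)| <= V ->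
  \sum_(j < n) eta j ^+ 2 <= 4 * V ^+ 2.
Proof.
set N := (2 * 64 ^ n)%N; set S := \sum_(j < n) eta j ^+ 2 => HV.
have V0 : 0 <= V by apply: le_trans HV; rewrite sumr_ge0.
have N0 : (0 < N)%N by rewrite muln_gt0 expn_gt0.
have [S0|S0] := leP S 0; first by apply: le_trans S0 _; rewrite mulr_ge0 // sqr_ge0.
pose h : R := 2 * pi / N%:R.
have hE : h = pi / lam n.
  by rewrite /h /N natrM -lam_nat; field; rewrite lam_neq0.
have h0 : 0 < h by rewrite hE divr_gt0 ?pi_gt0 ?lam_gt0.
(* This normalization makes the squares of the a_j add up to 1 / 2, so that the Riesz product is
   bounded by the square root of 2. *)
pose e : R := Num.sqrt (2 * S)^-1.
have e0 : 0 < e by rewrite sqrtr_gt0 invr_gt0 mulr_gt0.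
have e2 : e ^+ 2 * S = 2^-1.
  by rewrite sqr_sqrtr ?invr_ge0 ?mulr_ge0 ?(ltW S0) //; field; rewrite gt_eqF.
pose a j := e * eta j.
(* The second factor is sin v / v with v = lam j * h / 2, from the increment of a sine over a cell.
   For j < n it is at least 1 / 2, since v <= pi / 128. *)
pose b j := eta j * (2 * sin (lam j * h / 2) / (lam j * h)).
pose tau (i : nat) : R := (i%:R + 2^-1) * h.
pose X (t : R) := \sum_(j < n) b j * cos ((64 ^ j)%:R * t).
have XE (i : nat) : lac (i.+1%:R * pi / lam n) - lac (i%:R * pi / lam n) = h * X (tau i).
  rewrite !lac_grid /lacn -sumrB /X mulr_sumr; apply: eq_bigr => j _.
  have -> : lam j * (i.+1%:R * pi / lam n) = lam j * tau i + lam j * h / 2.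
    by rewrite /tau hE -natr1; field; rewrite lam_neq0.
  have -> : lam j * (i%:R * pi / lam n) = lam j * tau i - lam j * h / 2.
    by rewrite /tau hE; field; rewrite lam_neq0.
  rewrite sinD sinB -lam_nat /b; set u := lam j * tau i; set v := lam j * h / 2.
  by field; rewrite lam_neq0 /= gt_eqF.
have [_] := @riesz_pairing N N0 a b n n erefl (leqnn n).
rewrite -/X -/h => pairing.
pose Q := (riesz a n).2.
have Q2 t : `|Q t| <= Num.sqrt 2.
  rewrite -sqrtr_sqr ler_sqrt //.
  apply: le_trans (prod_1D_le (x := fun j => a j ^+ 2) (m := n) _ _).
  - by apply: le_trans (riesz_norm a n t); rewrite lerDr sqr_ge0.
  - by move=> j; exact: sqr_ge0.
  - by rewrite /a; under eq_bigr do rewrite exprMn; rewrite -mulr_sumr e2.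
have up : N%:R / 2 * \sum_(j < n) a j * b j <= Num.sqrt 2 * (V / h).
  rewrite -pairing; apply: le_trans (ler_norm _) _; apply: le_trans (ler_norm_sum _ _ _) _.
  apply: (@le_trans _ _ (\sum_(i < N) Num.sqrt 2 * `|X (tau i)|)).
    by apply: ler_sum => i _; rewrite normrM mulrC ler_wpM2r // Q2.
  rewrite -mulr_sumr ler_wpM2l ?sqrtr_ge0 // ler_pdivlMr // mulrC.
  apply: le_trans HV; rewrite mulr_sumr; apply: ler_sum => i _.
  by rewrite XE normrM gtr0_norm.
have lo : e * S / 2 <= \sum_(j < n) a j * b j.
  rewrite /S mulr_sumr mulr_suml; apply: ler_sum => j _.
  have l0 : 0 < lam j * h by rewrite mulr_gt0 ?lam_gt0.
  have l1 : lam j * h / 2 <= 2^-1.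
    have -> : lam j * h / 2 = lam j * 64 / lam n * (pi / 128).
      by rewrite hE; field; rewrite lam_neq0.
    have l1 : lam j * 64 / lam n <= 1.
      by rewrite ler_pdivrMr ?lam_gt0 // mul1r mulrC -lamS /lam ler_weXn2l // ler1n.
    have p1 : pi / 128 <= 2^-1 :> R by rewrite ler_pdivrMr //; have := @pi_lt4 R; lra.
    rewrite -[leRHS]mul1r; apply: ler_pM => //; last by rewrite divr_ge0 // pi_ge0.
    by rewrite divr_ge0 ?mulr_ge0 ?(ltW (lam_gt0 _)).
  have s0 := sin_ge_half (ltW (divr_gt0 l0 (ltr0Sn R 1))) l1.
  have -> : a j * b j = e * eta j ^+ 2 * (2 * sin (lam j * h / 2) / (lam j * h)).
    by rewrite /a /b; ring.
  have s1 : 2^-1 <= 2 * sin (lam j * h / 2) / (lam j * h) by rewrite ler_pdivlMr //; lra.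
  by apply: ler_wpM2l s1; rewrite mulr_ge0 ?sqr_ge0 ?(ltW e0).
have Nh : N%:R = 2 * pi / h.
  by rewrite /h invf_div mulrC divfK // gt_eqF // mulr_gt0 ?pi_gt0.
have fin : pi / 2 * (e * S) <= Num.sqrt 2 * V.
  have {}up := le_trans (ler_wpM2l (divr_ge0 (ler0n R N) (ler0n R 2)) lo) up.
  have := ler_wpM2r (ltW h0) up; rewrite -[leRHS]mulrA divfK ?gt_eqF //.
  by apply: le_trans; rewrite Nh le_eqVlt; apply/orP; left; apply/eqP; field; rewrite gt_eqF.
have fin2 : (pi / 2 * (e * S)) ^+ 2 <= 2 * V ^+ 2.
  rewrite -[X in X * V ^+ 2](sqr_sqrtr (ler0n R 2)) -exprMn lerXn2r ?nnegrE //.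
    by rewrite !mulr_ge0 ?divr_ge0 ?pi_ge0 ?(ltW e0) ?(ltW S0).
  by rewrite mulr_ge0 ?sqrtr_ge0.
have E : (pi / 2 * (e * S)) ^+ 2 = pi ^+ 2 / 8 * S.
  have -> : (pi / 2 * (e * S)) ^+ 2 = pi ^+ 2 / 4 * S * (e ^+ 2 * S) by field.
  by rewrite e2; field.
have pi2 : 4 <= pi ^+ 2 :> R by have := @pi_ge2 R; nra.
rewrite E in fin2; nra.
Qed.

Local Notation cgm := (@cg_mul R heisR2).

Lemma lac_continuous : continuous lac.
Proof.
move=> t; apply/cvgrPdist_lt => e e0.
have [n Hn] : exists n : nat, 8 / e < lam n.
  exists (Num.Def.truncn (8 / e)).+1; apply: lt_trans (truncnS_gt _) _.
  by rewrite lam_nat ltr_nat ltn_expl.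
near=> s; apply: le_lt_trans (lac_modulus n t s) _.
have h1 : 4 / lam n < e / 2.
  rewrite ltr_pdivrMr ?lam_gt0 //; rewrite ltr_pdivrMr // in Hn.
  by rewrite mulrC in Hn; lra.
have h2 : n%:R * `|t - s| <= e / 2.
  have : `|t - s| < e / 2 / n.+1%:R.
    near: s; apply: (@nbhsx_ballx R R^o); by rewrite !divr_gt0 // ltr0n.
  rewrite ltr_pdivlMr ?ltr0n // -natr1 mulrDr mulr1 mulrC => h.
  by have := normr_ge0 (t - s); lra.
lra.
Unshelve. all: by end_near.
Qed.

Lemma plac_continuous : continuous plac.
Proof.
move=> t; apply/cvgrPdist_lt => e e0.
near=> s; apply: le_lt_trans (plac_lip t s) _.
have : `|t - s| < e / 2 by near: s; apply: (@nbhsx_ballx R R^o); rewrite divr_gt0.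
lra.
Unshelve. all: by end_near.
Qed.

Lemma pt5_continuous (g0 g1 g2 g3 g4 : R -> R) :
  continuous g0 -> continuous g1 -> continuous g2 -> continuous g3 -> continuous g4 ->
  continuous (fun t => pt5 (g0 t) (g1 t) (g2 t) (g3 t) (g4 t)).
Proof.
move=> h0 h1 h2 h3 h4 t A [P Pnb PA].
pose p s := pt5 (g0 s) (g1 s) (g2 s) (g3 s) (g4 s).
have C (g : R -> R) (j : 'I_5) : continuous g -> (forall s, p s 0 j = g s) ->
    \forall s \near t, P 0 j (p s 0 j).
  move=> cg pg; have := Pnb 0 j; rewrite -/(p t) pg => /cg.
  move=> H; change (nbhs t (fun s => P 0 j (p s 0 j))).
  have -> : (fun s => P 0 j (p s 0 j)) = (fun s => P 0 j (g s)) by apply/funext => s; rewrite pg.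
  exact: H.
have E : forall j : 'I_5, \forall s \near t, P 0 j (p s 0 j).
  by apply: (@forall_I5 (fun j => \forall s \near t, P 0 j (p s 0 j)));
    [apply: (C _ _ h0)|apply: (C _ _ h1)|apply: (C _ _ h2)|apply: (C _ _ h3)|apply: (C _ _ h4)] => s; rewrite mxE.
have FF : Filter (nbhs t) by exact: (@nbhs_filter R t).
have H := @filter_forall _ _ (fun j s => P 0 j (p s 0 j)) (nbhs t) FF E.
change (nbhs t (fun s => A (p s))).
by apply: filterS H => s H; apply: PA => i j; rewrite [i]ord1.
Qed.

(** * The two curves *)

(* [h] refers to the Heisenberg factor and [f] to the flat factor; [plac] being
   an antiderivative of [lac], [hcurve] is horizontal. *)
Definition hcurve (t : R) : 'rV[R]_5 := pt5 t (lac t) 0 0 (t * lac t / 2 - plac t).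
Definition fcurve (t : R) : 'rV[R]_5 := pt5 0 0 t (lac t) 0.

Definition hset : set 'rV[R]_5 := hcurve @` [set t | 0 <= t <= 2 * pi].
Definition fset : set 'rV[R]_5 := fcurve @` [set t | 0 <= t <= 2 * pi].

Lemma cst_continuous_R (a : R) : continuous (fun _ : R => a).
Proof. by move=> x; exact: cvg_cst. Qed.

Lemma hcurve_continuous : continuous hcurve.
Proof.
apply: pt5_continuous; try exact: cst_continuous_R.
- by move=> x; exact: cvg_id.
- exact: lac_continuous.
- move=> x; apply: cvgB; last exact: plac_continuous.
  apply: cvgM; last exact: cvg_cst.
  by apply: cvgM; [exact: cvg_id|exact: lac_continuous].
Qed.

Lemma fcurve_continuous : continuous fcurve.
Proof.
apply: pt5_continuous; try exact: cst_continuous_R.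
- by move=> x; exact: cvg_id.
- exact: lac_continuous.
Qed.

Lemma rescale_param (g : R -> 'rV[R]_5) : continuous g ->
  curve_param (g @` [set t | 0 <= t <= 2 * pi]) (fun s => g (2 * pi * s)).
Proof.
have p0 : 0 < 2 * pi :> R by rewrite mulr_gt0 ?pi_gt0.
move=> cg; split.
  apply: continuous_subspaceT => s.
  apply: (@continuous_comp _ _ _ (fun s : R => 2 * pi * s) g); last exact: cg.
  by apply: cvgM; [exact: cvg_cst|exact: cvg_id].
apply/seteqP; split => [x [t /andP[t0 t1] <-]|x [s /=]].
  exists (t / (2 * pi)); last by rewrite mulrC divfK // gt_eqF.
  by rewrite /= in_itv /= divr_ge0 ?(ltW p0) //= ler_pdivrMr // mul1r.
rewrite in_itv /= => /andP[s0 s1] <-; exists (2 * pi * s) => //.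
by rewrite /= mulr_ge0 ?(ltW p0) //= -[leRHS]mulr1 ler_pM2l.
Qed.

Lemma hset_compact_curve : compact_curve hset.
Proof. by eexists; apply: rescale_param; exact: hcurve_continuous. Qed.

Lemma fset_compact_curve : compact_curve fset.
Proof. by eexists; apply: rescale_param; exact: fcurve_continuous. Qed.

Lemma cgsub_hcurve s t : cgsub (hcurve s) (hcurve t) =
  pt5 (t - s) (lac t - lac s) 0 0
    ((t - s) * (lac s + lac t) / 2 - (plac t - plac s)).
Proof. by apply: row5P; rewrite !cgsub_coord /om !mxE /=; field. Qed.

Lemma cgsub_fcurve (x : 'rV[R]_5) t : cgsub x (fcurve t) =
  pt5 (- x 0 c0) (- x 0 c1) (t - x 0 c2) (lac t - x 0 c3) (- x 0 c4).
Proof. by apply: row5P; rewrite !cgsub_coord /om !mxE /=; field. Qed.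

Lemma lac_approx2 n t : `|lac t - lacn n t| <= 2 / lam n.
Proof.
apply: le_trans (lac_approx _ _) _; rewrite ler_wpM2r ?invr_ge0 ?(ltW (lam_gt0 _)) //.
by rewrite ler_piMr.
Qed.

Lemma plac_approx2 n t : `|plac t - placn n t| <= 2 / lam n.
Proof.
apply: le_trans (plac_approx _ _) _; have l1 := @lam_ge1 R n; have l0 := @lam_gt0 R n.
rewrite ler_pdivrMr ?exprn_gt0 // expr2 mulrA divfK ?gt_eqF //.
by have := eta_le1 n; have := ltW (eta_gt0 n); nra.
Qed.

Lemma lac_maj n s t : s <= t -> `|lac t - lac s| <= maj n t - maj n s + 4 / lam n.
Proof.
move=> st; have h1 := maj_lacn n st; have h2 := lac_approx2 n s; have h3 := lac_approx2 n t.
have -> : 4 / lam n = 2 / lam n + 2 / lam n by rewrite -mulrDl -natrD.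
have -> : lac t - lac s = (lac t - lacn n t) + (lacn n t - lacn n s) - (lac s - lacn n s) by ring.
apply: le_trans (ler_normB _ _) _; apply: le_trans (lerD (ler_normD _ _) (lexx _)) _; lra.
Qed.

(** The left side is the error of the trapezoid rule for [lacn n]; by [cgsub_hcurve], the same error
    for [lac] is the last coordinate of the quotient of two points of [hcurve]. *)
Lemma trapezoid_le n s t : s <= t ->
  `|(t - s) * (lacn n s + lacn n t) / 2 - (placn n t - placn n s)| <= (t - s) * (maj n t - maj n s).
Proof.
move=> st; have [c /andP[sc ct] ->] := MVT_total (is_derive_placn n) st.
have -> : (t - s) * (lacn n s + lacn n t) / 2 - lacn n c * (t - s) =
  (t - s) * ((lacn n t - lacn n c) - (lacn n c - lacn n s)) / 2 by field.
have ts0 : 0 <= t - s by rewrite subr_ge0.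
rewrite -mulrA normrM (ger0_norm ts0) ler_wpM2l // normrM [X in _ * X]ger0_norm ?invr_ge0 //.
have := ler_normB (lacn n t - lacn n c) (lacn n c - lacn n s).
have := maj_lacn n sc; have := maj_lacn n ct.
by have := maj_mono n sc; have := maj_mono n ct; lra.
Qed.

(** The trapezoid error enters the distance under a square root. By [maj_id], t - s is at most twice
    the increment of [maj n], which makes the error quadratic in that increment. As lam n = (8^n)^2,
    the tail 1 / lam n becomes 1 / 8^n. *)
Lemma hcurve_dist n s t : s <= t -> t - s <= 8 ->
  maxnorm (cgsub (hcurve s) (hcurve t)) <= 2 * (maj n t - maj n s) + 5 / 8 ^+ n.
Proof.
move=> st ts8; have M0 := maj_id n st; have L := lac_maj n st.
have ts0 : 0 <= t - s by rewrite subr_ge0.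
have e0 : 0 < 8 ^+ n :> R by rewrite exprn_gt0.
have lE : lam n = (8 ^+ n) ^+ 2 by rewrite -exprM mulnC exprM -natrX.
have e1 : 1 <= 8 ^+ n :> R by rewrite exprn_ege1 // ler1n.
have i1 : (8 ^+ n)^-1 <= 1 :> R by rewrite invf_le1.
have i0 : 0 < (8 ^+ n)^-1 :> R by rewrite invr_gt0.
have l4 : 4 / lam n <= 4 / 8 ^+ n by rewrite lE expr2 invfM; nra.
rewrite cgsub_hcurve; apply/maxnorm_leP.
  by rewrite addr_ge0 ?mulr_ge0 ?divr_ge0 ?(ltW e0) //; lra.
rewrite !pt5E normr0; split; try by rewrite addr_ge0 ?mulr_ge0 ?divr_ge0 ?(ltW e0) //; lra.
- by rewrite ger0_norm //; have := divr_ge0 (ler0n R 5) (ltW e0); lra.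
- by have : 0 < 1 / 8 ^+ n by []; lra.
have T := trapezoid_le n st.
have h1 := lac_approx2 n s; have h2 := lac_approx2 n t.
have k1 := plac_approx2 n s; have k2 := plac_approx2 n t.
have -> : (t - s) * (lac s + lac t) / 2 - (plac t - plac s) =
  ((t - s) * (lacn n s + lacn n t) / 2 - (placn n t - placn n s)) +
  ((t - s) * ((lac s - lacn n s) + (lac t - lacn n t)) / 2 -
  ((plac t - placn n t) - (plac s - placn n s))) by field.
apply: le_trans (ler_normD _ _) _.
have -> : (2 * (maj n t - maj n s) + 5 / 8 ^+ n) ^+ 2 = 4 * (maj n t - maj n s) ^+ 2 +
   20 * (maj n t - maj n s) * (8 ^+ n)^-1 + 25 / lam n.
  by rewrite lE; field; rewrite gt_eqF.
have E : `|(t - s) * ((lac s - lacn n s) + (lac t - lacn n t)) / 2 -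
  ((plac t - placn n t) - (plac s - placn n s))| <= 20 / lam n.
  apply: le_trans (ler_normB _ _) _.
  rewrite -mulrA normrM (ger0_norm ts0) normrM [`|2^-1|]ger0_norm ?invr_ge0 //.
  have a1 := ler_normD (lac s - lacn n s) (lac t - lacn n t).
  have a2 := ler_normB (plac t - placn n t) (plac s - placn n s).
  have : (t - s) * (`|lac s - lacn n s + (lac t - lacn n t)| / 2) <= 8 * (2 / lam n).
    by apply: ler_pM => //; lra.
  by lra.
have l0 : 0 < (lam n)^-1 by rewrite invr_gt0 lam_gt0.
nra.
Qed.

Lemma le_of_pow8 (x K c : R) : (forall n, x <= K + c / 8 ^+ n) -> x <= K.
Proof.
move=> H; apply/ler_addgt0Pr => e e0.
set n := (Num.Def.truncn (`|c| / e)).+1.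
have nE : `|c| / e < 8 ^+ n.
  by apply: lt_trans (truncnS_gt _) _; rewrite -natrX ltr_nat ltn_expl.
apply: le_trans (H n) _; rewrite lerD2l ler_pdivrMr ?exprn_gt0 //.
rewrite ltr_pdivrMr // in nE; rewrite mulrC.
by apply: le_trans (ler_norm _) _; exact: ltW.
Qed.

(** The reflection allows a curve traversed backwards to be treated as one traversed forwards. *)
Lemma lacN t : lac (2 * pi - t) = - lac t.
Proof.
have cv : (fun n => lacn n (2 * pi - t)) @ \oo --> - lac t.
  have -> : (fun n => lacn n (2 * pi - t)) = (fun n => - lacn n t).
    apply/funext => n; rewrite /lacn -sumrN; apply: eq_bigr => j _.
    rewrite -mulrN; congr (_ * _).
    rewrite mulrBr (_ : lam j * (2 * pi) = (64 ^ j * 2)%:R * pi); last by rewrite natrM -lam_nat mulrA.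
    by rewrite sinB sin_npi cos_npi mul0r sub0r -signr_odd oddM andbF expr0 mul1r.
  by apply: cvgN; exact: lac_cvg.
exact: cvg_unique (@lac_cvg _) cv.
Qed.

(** * Lengths of the two curves *)

Section Rectifiability.
Variable N : 'rV[R]_5 -> R.
Hypothesis hN : homogeneous_norm (G := heisR2) N.
Local Notation d := (homogeneous_dist (G := heisR2) N).

(** For a fixed partition, the increments of [maj n] telescope to its total growth, which is bounded
    uniformly in n. The error, one term for each interval of the partition, tends to 0 as n
    grows. *)
Lemma hset_rectifiable B : (forall n, \sum_(j < n) eta j ^+ 2 <= B) -> rectifiable d hset.
Proof.
move=> HB; have [C C0 NC] := hn_upper hN.
exists (fun s => hcurve (2 * pi * s)); first by apply: rescale_param; exact: hcurve_continuous.
have p0 : 0 < 2 * pi :> R by rewrite mulr_gt0 ?pi_gt0.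
set K := C * (2 * (pi + pi / 2 * B)).
apply: (@le_lt_trans _ _ K%:E); last exact: ltry.
apply: ge_ereal_sup => _ [l [lp /eqP lb] <-]; rewrite lee_fin.
set u := fun k => 2 * pi * nth 1 (0 :: l) k.
have uS k : (k < size l)%N -> u k <= u k.+1.
  by move=> kl; rewrite /u ler_pM2l // ltW //; move/(pathP 1): lp => /(_ k kl).
have u0 : u 0%N = 0 by rewrite /u /= mulr0.
have uE : u (size l) = 2 * pi.
  rewrite /u (_ : nth 1 (0 :: l) (size l) = 1) ?mulr1 //.
  exact: etrans (nth_last 1 (0 :: l)) lb.
have um k m : (k <= m)%N -> (m <= size l)%N -> u k <= u m.
  elim: m => [|m IH]; first by rewrite leqn0 => /eqP ->.
  rewrite leq_eqVlt => /orP[/eqP -> //|]; rewrite ltnS => km ml.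
  by apply: le_trans (IH km (ltnW ml)) (uS _ ml).
have main n : \sum_(0 <= k < size l) d (hcurve (u k)) (hcurve (u k.+1)) <=
    K + C * (size l)%:R * (5 / 8 ^+ n).
  apply: (@le_trans _ _ (\sum_(0 <= k < size l)
     (C * 2 * (maj n (u k.+1) - maj n (u k)) + C * (5 / 8 ^+ n)))).
    rewrite !big_nat; apply: ler_sum => k /andP[_ kl].
    apply: le_trans (NC _) _; rewrite -mulrA -mulrDr ler_pM2l //.
    apply: hcurve_dist; first exact: uS.
    have := um 0%N k (leq0n k) (ltnW kl); have := um k.+1 (size l) kl (leqnn _).
    by rewrite u0 uE; have := @pi_lt4 R; lra.
  rewrite big_split /= -mulr_sumr telescope_sumr // u0 uE maj0 subr0 maj_2pi.
  rewrite sumr_const_nat subn0 -mulr_natr.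
  have := ler_wpM2l (divr_ge0 (@pi_ge0 R) (ler0n R 2)) (HB n) => h.
  apply: lerD; last by rewrite le_eqVlt; apply/orP; left; apply/eqP; ring.
  rewrite !mul1r /K [C * (2 * _)]mulrA ler_pM2l; last by rewrite mulr_gt0.
  by rewrite lerD2l.
apply: (@le_of_pow8 _ _ (C * (size l)%:R * 5)) => n.
by have := main n; rewrite mulrA.
Qed.

Fixpoint pathsum (g : R -> 'rV[R]_5) (x : R) (l : seq R) : R :=
  if l is y :: l' then d (g x) (g y) + pathsum g y l' else 0.

Lemma pathsumE g x l : pathsum g x l =
  \sum_(0 <= k < size l) d (g (nth 1 (x :: l) k)) (g (nth 1 (x :: l) k.+1)).
Proof.
elim: l x => [|y l IH] x /=; first by rewrite big_geq.
by rewrite big_nat_recl //= IH.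
Qed.

Lemma pathsum_cat g x l l' : pathsum g x (l ++ l') = pathsum g x l + pathsum g (last x l) l'.
Proof. by elim: l x => [|y l IH] x /=; rewrite ?add0r // IH addrA. Qed.

Lemma pathsum_ge0 g x l : 0 <= pathsum g x l.
Proof. by elim: l x => [|y l IH] x //=; rewrite addr_ge0 // (hn_ge0 hN). Qed.

(** A partition has to start at 0 and end at 1. [pre] and [post] supply the missing ends, and this
    only adds to the sum. *)
Lemma curve_length_ge (g : R -> 'rV[R]_5) (m : nat) (s : nat -> R) :
  (forall k, (k < m)%N -> s k < s k.+1) -> 0 <= s 0%N -> s m <= 1 ->
  ((\sum_(k < m) d (g (s k)) (g (s k.+1)))%:E <= curve_length d 0 1 g)%E.
Proof.
move=> sS s0 s1.
have H l : path <%R 0 l -> last 0 l = 1 -> ((pathsum g 0 l)%:E <= curve_length d 0 1 g)%E.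
  move=> lp lb; rewrite pathsumE; apply: ereal_sup_ubound; exists l => //.
  by split => //; apply/eqP.
pose mid k := mkseq (fun i => s i.+1) k.
have midP k : (k <= m)%N -> [/\ path <%R (s 0%N) (mid k), last (s 0%N) (mid k) = s k &
    pathsum g (s 0%N) (mid k) = \sum_(i < k) d (g (s i)) (g (s i.+1))].
  elim: k => [_|k IH km]; first by rewrite /mid /= big_ord0.
  have [p1 p2 p3] := IH (ltnW km); rewrite /mid mkseqS -/(mid k).
  rewrite rcons_path last_rcons p1 p2 sS //; split => //.
  by rewrite -cats1 pathsum_cat p2 p3 /= addr0 big_ord_recr.
have [mp ml ms] := midP m (leqnn m).
pose pre := if s 0%N == 0 then [::] else [:: s 0%N].
pose post := if s m == 1 then [::] else [:: 1 : R].
have preP : path <%R 0 pre && (last 0 pre == s 0%N).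
  rewrite /pre; case: eqVneq => [->|n0] //=.
  by rewrite lt_neqAle eq_sym n0 s0 eqxx.
have postP : path <%R (s m) post && (last (s m) post == 1).
  rewrite /post; case: eqVneq => [->|n0] //=.
  by rewrite lt_neqAle n0 s1 eqxx.
have [/andP[prep /eqP prel] /andP[postp /eqP postl]] := (preP, postP).
apply: le_trans (H (pre ++ mid m ++ post) _ _).
- rewrite lee_fin !pathsum_cat prel ms ml.
  by rewrite addrCA lerDl addr_ge0 ?pathsum_ge0.
- by rewrite !cat_path prep prel mp ml postp.
- by rewrite !last_cat prel ml postl.
Qed.

(* A parametrization may run back and forth, but the intermediate value
   theorem yields an increasing sequence of times visiting increasing
   prescribed abscissae. *)
Lemma ordered_times (tau : R -> R) (a b : R) (t : nat -> R) (m : nat) : a < b ->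
  {within `[a, b], continuous tau} -> tau a = t 0%N -> tau b = t m ->
  (forall k, (k < m)%N -> t k < t k.+1) ->
  exists s : nat -> R, [/\ s 0%N = a, s m <= b,
    forall k, (k <= m)%N -> tau (s k) = t k & forall k, (k < m)%N -> s k < s k.+1].
Proof.
move=> ab ct ta tb tS.
have tm k j : (k + j <= m)%N -> t k <= t (k + j)%N.
  elim: j => [|j IH]; first by rewrite addn0.
  rewrite addnS => kj; apply: le_trans (IH (ltnW kj)) _; exact: ltW (tS _ kj).
suff H k : (k <= m)%N -> exists s : nat -> R, [/\ s 0%N = a, a <= s k <= b,
    forall j, (j <= k)%N -> tau (s j) = t j & forall j, (j < k)%N -> s j < s j.+1].
  by have [s [h1 /andP[_ h2] h3 h4]] := H m (leqnn m); exists s.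
elim: k => [_|k IH km].
  by exists (fun=> a); split => // [|j]; [rewrite lexx ltW|rewrite leqn0 => /eqP ->].
have [s [h1 /andP[h2 h2'] h3 h4]] := IH (ltnW km).
have cs : {within `[s k, b], continuous tau}.
  by apply: continuous_subspaceW ct; apply: subset_itvr; rewrite bnd_simp.
have tk : tau (s k) = t k by exact: h3.
have k1 : t k < t k.+1 by exact: tS.
have k2 : t k.+1 <= t m by rewrite -(subnKC km) tm // subnKC.
have [|c] := IVT (v := t k.+1) h2' cs.
  by rewrite tk tb ge_min le_max (ltW k1) k2 orbT.
rewrite in_itv /= => /andP[sc cb] tc.
have sc' : s k < c.
  rewrite lt_neqAle sc andbT; apply/eqP => E.
  by move: k1; rewrite -tk -tc E ltxx.
exists (fun j => if (j <= k)%N then s j else c); split => //.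
- by rewrite ltnn cb (le_trans h2 sc).
- by move=> j; rewrite leq_eqVlt => /orP[/eqP ->|jk]; [rewrite ltnn|rewrite -ltnS jk h3].
- move=> j; rewrite ltnS => jk; rewrite jk; case: ltnP => jk'; first exact: h4.
  by have -> : j = k by apply/eqP; rewrite eqn_leq jk jk'.
Qed.

(** A parametrization factors through its abscissa [tau], which is continuous and takes the values 0
    and 2 pi. [ordered_times] makes it visit each grid in order, so a finite length would bound the
    variation of [lac] on all grids, against [lac_variation]. *)
Lemma fset_not_rectifiable : (forall B, exists n, B < \sum_(j < n) eta j ^+ 2) ->
  ~ rectifiable d fset.
Proof.
move=> HS [g [cg gE] len].
have [c c0 NC] := hn_lower hN.
have p0 : 0 < 2 * pi :> R by rewrite mulr_gt0 ?pi_gt0.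
have [V VE] : exists V : R, (curve_length d 0 1 g <= V%:E)%E.
  case: (curve_length d 0 1 g) len => [r||] // _; first by exists r.
  by exists 0; rewrite leNye.
pose tau (s : R) := g s 0 c2.
have gtau s : 0 <= s <= 1 -> 0 <= tau s <= 2 * pi /\ g s = fcurve (tau s).
  move=> s01; have : fset (g s) by rewrite gE; exists s => //; rewrite /= in_itv.
  by case=> t /= t2 E; rewrite /tau -E /fcurve !pt5E.
have ctau : {within `[0, 1], continuous tau}.
  move=> x; apply: (@continuous_comp (subspace `[0 : R, 1]) 'rV[R]_5 R g (fun M : 'rV[R]_5 => M 0 c2) x).
    exact: cg.
  exact: coord_continuous.
have dist (s s' : R) : 0 <= s <= 1 -> 0 <= s' <= 1 ->
    c * `|lac (tau s') - lac (tau s)| <= d (g s) (g s').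
  move=> h h'; have [_ ->] := gtau _ h; have [_ ->] := gtau _ h'.
  apply: le_trans (NC _); rewrite ler_pM2l // -/(cgsub _ _).
  have [_ _ _ b3 _] := maxnorm_bound (cgsub (fcurve (tau s)) (fcurve (tau s'))).
  by move: b3; rewrite cgsub_fcurve !pt5E.
(* [tau1] is [tau] or its reflection 2 pi - [tau], whichever takes the value 0 before the value 2
   pi. *)
have main (tau1 : R -> R) a b : a < b -> 0 <= a -> b <= 1 ->
    {within `[0, 1], continuous tau1} -> tau1 a = 0 -> tau1 b = 2 * pi ->
    (forall s s', `|lac (tau1 s') - lac (tau1 s)| = `|lac (tau s') - lac (tau s)|) -> False.
  move=> ab a0 b1 c1 ta tb tE.
  have [n] := HS (4 * (V / c) ^+ 2); apply/negP; rewrite -leNgt.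
  apply: lac_variation; set m := (2 * 64 ^ n)%N.
  have [|||k km|s [sa sb st sS]] := @ordered_times tau1 a b (fun k => k%:R * pi / lam n) m ab.
  - apply: continuous_subspaceW c1 => x /=; rewrite !in_itv /= => /andP[ax xb].
    by rewrite (le_trans a0 ax) (le_trans xb b1).
  - by rewrite ta !mul0r.
  - by rewrite tb /m natrM -lam_nat; field; rewrite lam_neq0.
  - by rewrite ltr_pM2r ?invr_gt0 ?lam_gt0 // ltr_pM2r ?pi_gt0 // ltr_nat.
  rewrite ler_pdivlMr // mulrC; rewrite -lee_fin; apply: le_trans VE.
  have s01 k : (k <= m)%N -> 0 <= s k <= 1.
    move=> km.
    have mono i j : (i + j <= m)%N -> s i <= s (i + j)%N.
      elim: j => [|j IH]; first by rewrite addn0.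
      rewrite addnS => kj; apply: le_trans (IH (ltnW kj)) _; exact: ltW (sS _ kj).
    have := mono 0%N k; rewrite add0n sa => /(_ km) /(le_trans a0) -> /=.
    have := mono k (m - k)%N; rewrite subnKC // => /(_ (leqnn _)) h.
    by apply: le_trans h (le_trans sb b1).
  have := @curve_length_ge g m s sS _ (le_trans sb b1).
  rewrite sa => /(_ a0); apply: le_trans.
  rewrite lee_fin mulr_sumr; apply: ler_sum => k _.
  rewrite -(st k.+1) // -(st k) ?(ltnW (ltn_ord k)) // tE.
  by apply: dist; apply: s01 => //; exact: ltnW.
have ex t : 0 <= t <= 2 * pi -> exists2 s, 0 <= s <= 1 & tau s = t.
  move=> t2; have : fset (fcurve t) by exists t.
  by rewrite gE => -[s /=]; rewrite in_itv /= => s01 E; exists s => //; rewrite /tau E pt5E.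
have [sa /andP[sa0 sa1] Ea] : exists2 s, 0 <= s <= 1 & tau s = 0 by apply: ex; rewrite lexx ltW.
have [sb /andP[sb0 sb1] Eb] : exists2 s, 0 <= s <= 1 & tau s = 2 * pi by apply: ex; rewrite lexx ltW.
have [ab|ba|E] := ltgtP sa sb.
- by apply: (main tau _ _ ab).
- apply: (main (fun s => 2 * pi - tau s) _ _ ba) => //.
  + by move=> x; apply: cvgB; [exact: cvg_cst|exact: ctau].
  + by rewrite Eb subrr.
  + by rewrite Ea subr0.
  + by move=> s s'; rewrite !lacN -opprD normrN.
- by move: p0; rewrite -Eb -E Ea ltxx.
Qed.
End Rectifiability.

(** * Beta numbers of the flat curve *)

Definition cball (p : 'rV[R]_5) (rho : R) : set 'rV[R]_5 := [set x | maxnorm (cgsub p x) <= rho].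

Section FsetBeta.
Variable N : 'rV[R]_5 -> R.
Hypothesis hN : homogeneous_norm (G := heisR2) N.
Local Notation d := (homogeneous_dist (G := heisR2) N).
Local Notation betaE := (@beta R heisR2 d).

Lemma cgsub_fcurve2 s t : cgsub (fcurve s) (fcurve t) = pt5 0 0 (t - s) (lac t - lac s) 0.
Proof. by rewrite cgsub_fcurve !pt5E oppr0. Qed.

Lemma tangent_sub (t b t0 a s m : R) :
  cgsub (pt5 0 0 t b 0) (cgm (pt5 0 0 t0 a 0) (s *: pt5 0 0 1 m 0)) =
  pt5 0 0 (t0 + s - t) (a + s * m - b) 0.
Proof. by apply: row5P; rewrite cgsub_coord /om !cgm_coord /om !mxE /=; ring. Qed.

Lemma fcurve_tangent k t0 t :
  `|lac t - lac t0 - dlacn k t0 * (t - t0)| <= eta k * (lam k * (t - t0) ^+ 2 + 4 / lam k).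
Proof.
have h1 := lac_approx k t; have h2 := lac_approx k t0; have h3 := lacn_taylor k t t0.
have -> : lac t - lac t0 - dlacn k t0 * (t - t0) =
  (lac t - lacn k t) - (lac t0 - lacn k t0) + (lacn k t - lacn k t0 - dlacn k t0 * (t - t0)) by ring.
apply: le_trans (ler_normD _ _) _; apply: le_trans (lerD (ler_normB _ _) (lexx _)) _.
have -> : eta k * (lam k * (t - t0) ^+ 2 + 4 / lam k) =
  2 * eta k / lam k + 2 * eta k / lam k + eta k * lam k * (t - t0) ^+ 2 by ring.
lra.
Qed.

(** The line is the tangent, at a point of the curve in the ball, of the graph of [lacn k]
    translated to that point. Both the curvature of [lacn k] and the tail of the series carry the
    factor eta k. *)
Lemma fset_beta_small : exists2 K, 0 < K & forall k x r,
  (lam k.+1)^-1 <= r -> r <= (lam k)^-1 -> betaE fset x r <= K * eta k.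
Proof.
have [C C0 NC] := hn_upper hN; have [c c_0 Nc] := hn_lower hN.
(* The first summand comes from c * |t - t0| <= 2 r, the second from 1 / lam k <= 64 r in the tail 4
   / lam k. *)
pose K := C * (4 / c ^+ 2 + 256).
have K0 : 0 < K.
  apply: mulr_gt0; first exact: C0.
  apply: addr_gt0; last by rewrite ltr0n.
  by apply: divr_gt0; [rewrite ltr0n|exact: exprn_gt0].
exists K => [|k x r r1 r2]; first exact: K0.
have r0 : 0 < r by apply: lt_le_trans r1; rewrite invr_gt0 lam_gt0.
have l0 := @lam_gt0 R k; have e0 := eta_gt0 k.
have [[z0 Ez0 xz0]|H] := pselect (exists2 z, fset z & d x z < r); last first.
  rewrite (beta_eq0 hN) //; first by apply: mulr_ge0; apply: ltW.
  by move=> z Ez zr; apply: H; exists z.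
have [t0 t02 E0] := Ez0.
have [||L lL Lt] := @line_exists R (fcurve t0) (pt5 0 0 1 (dlacn k t0) 0).
- by rewrite pt5E.
- by apply/eqP => /rowP /(_ c2); rewrite !mxE /= => /eqP; rewrite oner_eq0.
have -> : K * eta k = K * eta k * r / r by rewrite mulfK // gt_eqF.
have Ke : 0 <= K * eta k * r := mulr_ge0 (mulr_ge0 (ltW K0) (ltW e0)) (ltW r0).
apply: (beta_le hN r0 Ke lL).
move=> z [t t2 <-] zr.
apply: le_trans (dist_set_le hN _ (Lt (t - t0))) _.
have tt : c * `|t - t0| <= 2 * r.
  apply: (@le_trans _ _ (d z0 (fcurve t))).
    apply: le_trans (Nc _); rewrite ler_pM2l // -E0 -/(cgsub _ _) cgsub_fcurve2.
    have [_ _ + _ _] := maxnorm_bound (pt5 0 0 (t - t0) (lac t - lac t0) 0).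
    by rewrite pt5E.
  by apply: le_trans (hd_tri hN x _ _) _; rewrite (hd_sym hN z0); lra.
have tt2 : (t - t0) ^+ 2 <= 4 / c ^+ 2 * r ^+ 2.
  rewrite -real_normK ?num_real //.
  have -> : 4 / c ^+ 2 * r ^+ 2 = (2 * r / c) ^+ 2 by field; rewrite gt_eqF.
  by rewrite lerXn2r ?nnegrE ?divr_ge0 ?mulr_ge0 ?(ltW r0) ?(ltW c_0) // ler_pdivlMr // mulrC.
apply: le_trans (NC _) _; rewrite /K -!mulrA ler_pM2l //.
rewrite -/(cgsub _ _).
rewrite tangent_sub [t0 + (t - t0)]addrC subrK subrr.
have -> : lac t0 + (t - t0) * dlacn k t0 - lac t = - (lac t - lac t0 - dlacn k t0 * (t - t0)).
  by move: (lac t) (lac t0) (dlacn k t0) => a b e; ring.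
have lr : lam k * r <= 1 by rewrite mulrC -ler_pdivlMr // div1r.
have kr : 4 / lam k <= 256 * r.
  have -> : 4 / lam k = 256 / lam k.+1 by rewrite lamS; field; rewrite lam_neq0.
  by rewrite ler_pM2l ?ltr0n.
have K0' : 0 <= 4 / c ^+ 2 by rewrite divr_ge0 ?exprn_ge0 // ltW.
apply: (@le_trans _ _ (eta k * (lam k * (t - t0) ^+ 2 + 4 / lam k))).
  apply/maxnorm_le; rewrite !pt5E normr0 sqrtr0 normrN.
  have q0 := le_trans (normr_ge0 _) (fcurve_tangent k t0 t).
  by split => //; exact: fcurve_tangent.
rewrite [leRHS]mulrCA ler_pM2l // [(_ + 256) * r]mulrDl.
apply: lerD kr.
apply: le_trans (ler_wpM2l (ltW l0) tt2) _.
have : 0 <= 4 / c ^+ 2 * r by rewrite mulr_ge0 // ltW.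
move=> Ar0; have -> : lam k * (4 / c ^+ 2 * r ^+ 2) = 4 / c ^+ 2 * r * (lam k * r).
  by move: (4 / c ^+ 2) (lam k) => A L0; ring.
by rewrite ler_piMr.
Qed.

Lemma fcurve_diam s t : 0 <= s <= 2 * pi -> 0 <= t <= 2 * pi ->
  maxnorm (cgsub (fcurve s) (fcurve t)) <= 8.
Proof.
move=> /andP[s0 s1] /andP[t0 t1]; rewrite cgsub_fcurve2; apply/maxnorm_le.
rewrite !pt5E normr0 sqrtr0; split => //.
  by rewrite ler_norml; have := @pi_lt4 R; lra.
have h u : `|lac u| <= 2.
  by have := lac_approx2 0 u; rewrite /lacn big_ord0 subr0 /lam expr0 divr1.
by apply: le_trans (ler_normB _ _) _; have := h s; have := h t; lra.
Qed.

Lemma fset_beta_large : exists2 K, 0 < K & forall x r, 0 < r -> betaE fset x r <= K / r.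
Proof.
have [C C0 NC] := hn_upper hN; exists (C * 8); first by rewrite mulr_gt0.
move=> x r r0.
have [L lL Lt] := line_through (fcurve 0).
apply: (beta_le hN r0 _ lL); first by rewrite mulr_ge0 // ltW.
move=> z [t t2 <-] _; apply: le_trans (dist_set_le hN _ Lt) _.
apply: le_trans (NC _) _; rewrite ler_pM2l // -/(cgsub _ _); apply: fcurve_diam => //.
by rewrite lexx mulr_ge0 // pi_ge0.
Qed.

(* Points equidistributed for maj k, at spacing comparable to 1 / lam k. *)
Lemma fset_net k : exists p : nat -> 'rV[R]_5,
  forall x rho, 0 <= rho -> (exists2 z, fset z & maxnorm (cgsub x z) <= rho / lam k) ->
    exists2 i, (i%:R <= maj k (2 * pi) * lam k) & cball (p i) ((5 + rho) / lam k) x.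
Proof.
have l0 := @lam_gt0 R k; have p0 : 0 <= 2 * pi :> R by rewrite mulr_ge0 // pi_ge0.
have cmaj : continuous (maj k).
  move=> y; apply: differentiable_continuous; apply/derivable1_diffP.
  by have := is_derive_maj k y; move=> /(@ex_derive _ _ _ _ _ _ _).
have ex i : exists t, i%:R <= maj k (2 * pi) * lam k -> maj k t = i%:R / lam k.
  have [h|h] := leP (i%:R) (maj k (2 * pi) * lam k); last by exists 0.
  have [|t _ E] := IVT (v := i%:R / lam k) p0 (continuous_subspaceT cmaj).
    have q : i%:R / lam k <= maj k (2 * pi) by rewrite ler_pdivrMr.
    by rewrite maj0 ge_min le_max q orbT andbT divr_ge0 // ltW.
  by exists t.
have [t tE] := choice ex.
exists (fun i => fcurve (t i)) => x rho rho0 [z [u /andP[u0 u1] <-] xz].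
pose i := Num.Def.truncn (maj k u * lam k).
have mu0 : 0 <= maj k u * lam k.
  by rewrite mulr_ge0 ?(ltW l0) // -(maj0 k) maj_mono.
have /andP[i1 i2] := truncn_itv mu0.
have iV : i%:R <= maj k (2 * pi) * lam k.
  by apply: le_trans i1 _; rewrite ler_pM2r // maj_mono.
exists i => //.
have {}tE := tE i iV.
have d1 : 0 <= maj k u - maj k (t i) <= 1 / lam k.
  rewrite tE subr_ge0 ler_pdivrMr // i1 /= lerBlDr -mulrDl ler_pdivlMr //.
  by rewrite addrC natr1 ltW.
have tu : t i <= u.
  rewrite leNgt; apply/negP => ut; have := maj_id k (ltW ut).
  by move: d1 => /andP[d1 _]; lra.
have d2 := maj_id k tu.
have d3 := lac_maj k tu.
have d5 : maxnorm (cgsub (fcurve (t i)) (fcurve u)) <= 5 / lam k.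
  have e5 : 5 / lam k = 5 * (1 / lam k) by ring.
  move: d1 => /andP[d0 d1].
  have i0 : 0 <= 1 / lam k by rewrite divr_ge0 // ltW.
  have i4 : 4 / lam k = 4 * (1 / lam k) by ring.
  rewrite cgsub_fcurve2; apply/maxnorm_le; rewrite !pt5E normr0 sqrtr0.
  split; try by rewrite divr_ge0 // ltW.
    rewrite ger0_norm ?subr_ge0 //; lra.
  lra.
rewrite /cball /=.
apply: le_trans (hd_tri maxnorm_homogeneous (fcurve u) _ _) _.
by rewrite [X in _ + X](hd_sym maxnorm_homogeneous) mulrDl lerD.
Qed.
End FsetBeta.

(* In the coordinate z - a b / 2 a horizontal line is a quadratic function of a,
   up to an error that is quadratic in the horizontal displacement. *)
Lemma line_near_quadratic (g0 g1 g4 v0 v1 s t f z F qa qb qz : R) :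
  v0 != 0 -> qa = g0 + s * v0 -> qb = g1 + s * v1 ->
  qz = g4 + 2^-1 * (s * (g0 * v1 - g1 * v0)) -> z = t * f / 2 - F ->
  let al := qa - t in let be := qb - f in let m := v1 / v0 in
  let ze := qz - z - 2^-1 * (t * qb - f * qa) in
  F = (2^-1 * g0 * g1 - g4 + g1 * (t - g0) + 2^-1 * m * (t - g0) ^+ 2) +
      (ze - 2^-1 * m * al ^+ 2 + 2^-1 * al * be).
Proof. by move=> v00 -> -> -> -> /=; field. Qed.

(** The quadratic part cancels, and the errors enter with total weight 1 + 3 + 3 + 1 = 8. *)
Lemma diff3_quadratic (a b c h t F0 F1 F2 F3 e0 e1 e2 e3 E : R) :
  F0 = a + b * t + c * t ^+ 2 + e0 -> F1 = a + b * (t + h) + c * (t + h) ^+ 2 + e1 ->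
  F2 = a + b * (t + 2 * h) + c * (t + 2 * h) ^+ 2 + e2 ->
  F3 = a + b * (t + 3 * h) + c * (t + 3 * h) ^+ 2 + e3 ->
  `|e0| <= E -> `|e1| <= E -> `|e2| <= E -> `|e3| <= E ->
  `|F3 - 3 * F2 + 3 * F1 - F0| <= 8 * E.
Proof.
move=> -> -> -> ->; rewrite !ler_norml => /andP[? ?] /andP[? ?] /andP[? ?] /andP[? ?].
rewrite (_ : _ - _ = e3 - 3 * e2 + 3 * e1 - e0); last by ring.
by apply/andP; split; lra.
Qed.

(** * Beta numbers of the horizontal curve *)

Section HsetBeta.
Variable N : 'rV[R]_5 -> R.
Hypothesis hN : homogeneous_norm (G := heisR2) N.
Local Notation d := (homogeneous_dist (G := heisR2) N).
Local Notation betaE := (@beta R heisR2 d).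
Local Notation line := (@horizontal_line R heisR2).

Definition spacing (k : nat) : R := pi / lam k.

(** The growth of the majorant over three steps controls both the extent of the window and the slope
    of any line close to it. [maj k.+1] is enough because [lac] and [lacn k.+1] agree at the grid
    points. *)
Definition flat_at (K : R) (k i : nat) : bool :=
  maj k.+1 ((i + 3)%:R * spacing k) - maj k.+1 (i%:R * spacing k) <= K * spacing k.

Lemma spacing_gt0 k : 0 < spacing k.
Proof. by rewrite divr_gt0 ?pi_gt0 ?lam_gt0. Qed.

Lemma lac_gridS k i : lac (i%:R * spacing k) = lacn k.+1 (i%:R * spacing k).
Proof. by rewrite /spacing mulrA lac_grid lacn_grid. Qed.

Lemma plac_gridS k i j : plac (i%:R * spacing k) - plac (j%:R * spacing k) =
  placn k.+1 (i%:R * spacing k) - placn k.+1 (j%:R * spacing k).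
Proof. by rewrite /spacing !mulrA plac_grid. Qed.

Lemma flat_incr K k i j : flat_at K k i -> (j <= 3)%N ->
  maj k.+1 ((i + j)%:R * spacing k) - maj k.+1 (i%:R * spacing k) <= K * spacing k.
Proof.
move=> fl j3; apply: le_trans fl; rewrite lerD2r maj_mono // ler_pM2r ?spacing_gt0 //.
by rewrite ler_nat leq_add2l.
Qed.

Lemma flat_lac K k i j : flat_at K k i -> (j <= 3)%N ->
  `|lac ((i + j)%:R * spacing k) - lac (i%:R * spacing k)| <= K * spacing k.
Proof.
move=> fl j3; rewrite !lac_gridS; apply: le_trans (flat_incr fl j3).
apply: maj_lacn; rewrite ler_pM2r ?spacing_gt0 //.
by rewrite ler_nat leq_addr.
Qed.

Lemma flat_dist K k i j : 0 <= K -> flat_at K k i -> (j <= 3)%N ->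
  maxnorm (cgsub (hcurve (i%:R * spacing k)) (hcurve ((i + j)%:R * spacing k))) <= (3 + K) * spacing k.
Proof.
move=> K0 fl j3; have h0 := spacing_gt0 k.
have ij : i%:R * spacing k <= (i + j)%:R * spacing k.
  by rewrite ler_pM2r // ler_nat leq_addr.
have T := trapezoid_le k.+1 ij.
have L := flat_lac fl j3; have I := flat_incr fl j3.
rewrite -!lac_gridS -plac_gridS in T.
have tE : (i + j)%:R * spacing k - i%:R * spacing k = j%:R * spacing k.
  by rewrite natrD; ring.
have j0 : 0 <= j%:R :> R by [].
have j3' : j%:R <= 3 :> R by rewrite ler_nat.
have Kh : 0 <= K * spacing k by rewrite mulr_ge0 // ltW.
rewrite cgsub_hcurve; apply/maxnorm_leP; first by rewrite mulr_ge0 ?addr_ge0 ?(ltW h0).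
rewrite !pt5E normr0 tE.
have b3 : 0 <= (3 + K) * spacing k by rewrite mulrDl; lra.
split => //.
- by rewrite normrM !ger0_norm ?(ltW h0) // ler_pM2r //; lra.
- by rewrite mulrDl; lra.
rewrite tE in T; apply: le_trans T _.
apply: (@le_trans _ _ (3 * spacing k * (K * spacing k))).
  apply: ler_pM => //; first by rewrite mulr_ge0 // ltW.
    by rewrite subr_ge0 maj_mono.
  by rewrite ler_pM2r.
have -> : 3 * spacing k * (K * spacing k) = 3 * K * spacing k ^+ 2 by ring.
rewrite [leRHS]exprMn; apply: ler_wpM2r; first exact: sqr_ge0.
by have := sqr_ge0 K; rewrite sqrrD; lra.
Qed.

(** Otherwise L passes within e h of all four points, where h is the spacing, and its slope is at
    most K. By [line_near_quadratic], [plac] is then quadratic at the four grid points up to (3 + K)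
    / 2 * (e h)^2, against the lower bound for its third difference; the constant 16 comes from pi^2
    <= 16. *)
Lemma line_far K k i e : 1 <= K -> 0 < e -> e <= 4^-1 -> flat_at K k i ->
  16 * (3 + K) * e ^+ 2 < eta k -> forall L, line L ->
  exists2 j, (j <= 3)%N & forall y, L y ->
    e * spacing k < maxnorm (cgsub (hcurve ((i + j)%:R * spacing k)) y).
Proof.
move=> K1 e0 e4 fl eK L lL.
apply: contrapT => nj.
have near j : (j <= 3)%N -> exists2 y, L y &
    maxnorm (cgsub (hcurve ((i + j)%:R * spacing k)) y) <= e * spacing k.
  move=> j3; apply: contrapT => ny; apply: nj; exists j => // y Ly.
  by rewrite ltNge; apply/negP => h; apply: ny; exists y.
move: lL => [g [v [vl v0 LE]]].
have v4 : v 0 c4 = 0 by move/mem_layer : vl; apply.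
have h0 := spacing_gt0 k; set h := spacing k in h0 *.
have {}near j : (j <= 3)%N -> exists s, [/\
    `|g 0 c0 + s * v 0 c0 - (i + j)%:R * h| <= e * h,
    `|g 0 c1 + s * v 0 c1 - lac ((i + j)%:R * h)| <= e * h &
    `|g 0 c4 + 2^-1 * (s * (g 0 c0 * v 0 c1 - g 0 c1 * v 0 c0)) -
       ((i + j)%:R * h * lac ((i + j)%:R * h) / 2 - plac ((i + j)%:R * h)) -
       2^-1 * ((i + j)%:R * h * (g 0 c1 + s * v 0 c1) - lac ((i + j)%:R * h) * (g 0 c0 + s * v 0 c0))|
      <= (e * h) ^+ 2].
  move=> j3; have [y + ny] := near j j3; rewrite LE => -[s _ yE].
  have eh0 : 0 <= e * h by rewrite mulr_ge0 ?ltW.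
  move: ny => /maxnorm_leP => /(_ eh0) [n0 n1 _ _ n4].
  exists s; rewrite -yE cgsub_coord !cgm_coord /om !mxE /= in n0.
  rewrite -yE cgsub_coord !cgm_coord /om !mxE /= in n1.
  rewrite -yE cgsub_coord /om !cgm_coord /om !mxE /= v4 in n4.
  split=> //; apply: le_trans _ n4; rewrite le_eqVlt; apply/orP; left; apply/eqP.
  rewrite -/h; set t := _ * h; move: (lac t) (plac t) => a b.
  by congr (`|_|); field.
have [s0 [a0 b0 z0]] := near 0%N isT; have [s1 [a1 b1 z1]] := near 1%N isT.
have [s2 [a2 b2 z2]] := near 2%N isT; have [s3 [a3 b3 z3]] := near 3%N isT.
have f3 := flat_lac fl (leqnn 3); rewrite -/h in f3.
rewrite addn0 in a0 b0 z0.
have tE j : (i + j)%:R * h = i%:R * h + j%:R * h by rewrite natrD mulrDl.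
have eh4 : e * h <= 4^-1 * h by rewrite ler_pM2r.
(* From the first to the last point the abscissa advances by 3 h, with an error of at most e h <= h
   / 4 at each end. *)
have dv0 : 2 * h <= (s3 - s0) * v 0 c0.
  by move: a0 a3; rewrite tE !ler_norml => /andP[? ?] /andP[? ?]; lra.
have v0n : v 0 c0 != 0.
  by apply/eqP => E; move: dv0; rewrite E mulr0; lra.
set m := v 0 c1 / v 0 c0.
have dv1 : `|(s3 - s0) * v 0 c1| <= (K + 2^-1) * h.
  by move: b0 b3 f3; rewrite !ler_norml mulrDl => /andP[? ?] /andP[? ?] /andP[? ?]; apply/andP; split; lra.
have mK : `|m| <= K.
  have h20 : 0 < (s3 - s0) * v 0 c0 by apply: lt_le_trans dv0; rewrite mulr_gt0.
  have -> : m = ((s3 - s0) * v 0 c1) / ((s3 - s0) * v 0 c0).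
    rewrite /m -mulf_div divff ?mul1r //; apply/eqP => E; move: h20; rewrite E mul0r ltxx //.
  rewrite normrM normfV [`|_ * v 0 c0|]gtr0_norm // ler_pdivrMr //.
  have K0 : 0 <= K by lra.
  have Kdv := ler_wpM2l K0 dv0.
  have K2 : (K + 2^-1) * h <= K * 2 * h by rewrite ler_pM2r //; lra.
  lra.
have eE (ze al be : R) : `|ze| <= (e * h) ^+ 2 -> `|al| <= e * h -> `|be| <= e * h ->
    `|ze - 2^-1 * m * al ^+ 2 + 2^-1 * al * be| <= (3 + K) / 2 * (e * h) ^+ 2.
  move=> hz ha hb; have eh0 : 0 <= e * h by rewrite mulr_ge0 ?ltW.
  apply: le_trans (ler_normD _ _) _; apply: le_trans (lerD (ler_normB _ _) (lexx _)) _.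
  have ab : `|2^-1 * al * be| <= 2^-1 * (e * h) ^+ 2.
    by rewrite -mulrA normrM ger0_norm // ler_pM2l // normrM expr2 ler_pM.
  have aa : `|2^-1 * m * al ^+ 2| <= 2^-1 * K * (e * h) ^+ 2.
    rewrite normrM normrX; apply: ler_pM; [exact: normr_ge0|by apply: exprn_ge0|..].
      by rewrite normrM ger0_norm // ler_pM2l.
    by rewrite lerXn2r ?nnegrE.
  apply: le_trans (lerD (lerD hz aa) ab) _.
  by move: ((e * h) ^+ 2) => q; lra.
have main : `|diff3 plac h (i%:R * h)| <= 8 * ((3 + K) / 2 * (e * h) ^+ 2).
  rewrite /diff3.
  (* A and B are coefficients of the quadratic of [line_near_quadratic] expanded in t. They depend
     on the line only; the parameter s, which varies with the grid point, enters the error alone. *)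
  pose A := 2^-1 * g 0 c0 * g 0 c1 - g 0 c4 - g 0 c1 * g 0 c0 + 2^-1 * m * g 0 c0 ^+ 2.
  pose B := g 0 c1 - m * g 0 c0.
  have Q s t : plac t = A + B * t + (2^-1 * m) * t ^+ 2 +
      ((g 0 c4 + 2^-1 * (s * (g 0 c0 * v 0 c1 - g 0 c1 * v 0 c0)) - (t * lac t / 2 - plac t) -
        2^-1 * (t * (g 0 c1 + s * v 0 c1) - lac t * (g 0 c0 + s * v 0 c0)))
       - 2^-1 * m * (g 0 c0 + s * v 0 c0 - t) ^+ 2
       + 2^-1 * (g 0 c0 + s * v 0 c0 - t) * (g 0 c1 + s * v 0 c1 - lac t)).
    rewrite {1}(@line_near_quadratic (g 0 c0) (g 0 c1) (g 0 c4) (v 0 c0) (v 0 c1)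
      s t (lac t) _ (plac t) _ _ _ v0n erefl erefl erefl erefl).
    by rewrite /= -/m; congr (_ + _); rewrite /A /B; field.
  apply: (diff3_quadratic (Q s0 _) (Q s1 _) (Q s2 _) (Q s3 _)).
  - exact: eE.
  - by have := eE _ _ _ z1 a1 b1; rewrite tE mul1r.
  - by have := eE _ _ _ z2 a2 b2; rewrite tE.
  - by have := eE _ _ _ z3 a3 b3; rewrite tE.
have low := le_trans (diff3_plac_lower k i) main.
have l0 := @lam_gt0 R k.
move: low; rewrite exprMn /h /spacing expr_div_n.
have -> : 8 * ((3 + K) / 2 * (e ^+ 2 * (pi ^+ 2 / lam k ^+ 2))) = 4 * ((3 + K) * e ^+ 2 * pi ^+ 2 / lam k ^+ 2).
  by field; rewrite gt_eqF.
rewrite ler_pM2l // ler_pM2r ?invr_gt0 ?exprn_gt0 // => low.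
have p16 : pi ^+ 2 <= 16 :> R.
  by rewrite (_ : 16 = 4 ^+ 2); [apply: lerXn2r; rewrite ?nnegrE ?pi_ge0 ?ltW ?pi_lt4|ring].
have : (3 + K) * e ^+ 2 * pi ^+ 2 <= (3 + K) * e ^+ 2 * 16.
  by rewrite ler_wpM2l // mulr_ge0 ?sqr_ge0 //; lra.
by move=> /(le_trans low); lra.
Qed.

Lemma hset_beta_lower K : 1 <= K -> exists A c, [/\ 0 < A, 0 < c & forall k i x r,
  flat_at K k i -> (i + 3)%:R * spacing k <= 2 * pi ->
  cball (hcurve (i%:R * spacing k)) (spacing k) x ->
  A * spacing k <= r -> r <= 2 * A * spacing k ->
  c * Num.sqrt (eta k) <= betaE hset x r].
Proof.
move=> K1; have [C C0 NC] := hn_upper hN; have [c c_0 Nc] := hn_lower hN.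
have K3 : 0 < 32 * (3 + K) by rewrite mulr_gt0 //; lra.
(* The ball has to contain the whole window: x is within C h of its first point, and the other
   points are within C (3 + K) h of that one. *)
pose A := C * (5 + K); have A0 : 0 < A by rewrite mulr_gt0 //; lra.
pose q := Num.sqrt (32 * (3 + K))^-1.
have q0 : 0 < q by rewrite sqrtr_gt0 invr_gt0.
have cq0 : 0 < c * q := mulr_gt0 c_0 q0.
have A20 : 0 < 2 * A := mulr_gt0 (ltr0Sn R 1) A0.
exists A, (c * q / (2 * A)); split=> //; first exact: divr_gt0.
move=> k i x r fl i2pi xb r1 r2.
have h0 := spacing_gt0 k; set h := spacing k in h0 i2pi xb r1 r2 *.
have r0 : 0 < r := lt_le_trans (mulr_gt0 A0 h0) r1.
have ek0 := eta_gt0 k.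
(* [line_far] asks for 16 (3 + K) e^2 < eta k; this choice gives eta k / 2. *)
pose e := q * Num.sqrt (eta k).
have e0 : 0 < e by apply: mulr_gt0 => //; rewrite sqrtr_gt0.
have e2 : e ^+ 2 = eta k / (32 * (3 + K)).
  by rewrite exprMn !sqr_sqrtr ?invr_ge0 ?(ltW K3) ?(ltW ek0) // mulrC.
have eK : 16 * (3 + K) * e ^+ 2 < eta k.
  have -> : 16 * (3 + K) * e ^+ 2 = eta k / 2.
    by rewrite e2; field; rewrite gt_eqF //; lra.
  lra.
have e4 : e <= 4^-1.
  have : e ^+ 2 <= 4^-1 ^+ 2.
    rewrite e2 ler_pdivrMr //; have := eta_le1 k; lra.
  by rewrite ler_sqr ?nnegrE ?(ltW e0) // invr_ge0.
apply: (@le_trans _ _ (c * e * h / r)).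
  rewrite ler_pdivlMr //.
  have -> : c * e * h = c * q / (2 * A) * Num.sqrt (eta k) * (2 * A * h).
    by rewrite /e; field; rewrite gt_eqF.
  by rewrite ler_pM2l //; apply: mulr_gt0; [exact: divr_gt0|rewrite sqrtr_gt0].
apply: (beta_ge hN r0) => L lL.
have [j j3 far] := line_far K1 e0 e4 fl eK lL.
exists (hcurve ((i + j)%:R * h)); split.
- exists ((i + j)%:R * h) => //=; rewrite mulr_ge0 ?(ltW h0) //=.
  by apply: le_trans i2pi; rewrite ler_pM2r // ler_nat leq_add2l.
- apply: lt_le_trans r1; rewrite /A -mulrA.
  apply: le_lt_trans (hd_tri hN (hcurve (i%:R * h)) _ _) _.
  apply: (@le_lt_trans _ _ (C * h + C * ((3 + K) * h))); last first.
    by have Ch := mulr_gt0 C0 h0; rewrite mulrDl [(5 + K) * h]mulrDl !mulrDr; lra.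
  apply: lerD.
    rewrite (hd_sym hN); apply: le_trans (NC _) _; rewrite ler_pM2l //; exact: xb.
  apply: le_trans (NC _) _; rewrite ler_pM2l //; apply: flat_dist => //; lra.
- apply: lb_le_inf; first by apply: image_nonempty; exact: line_neq0 lL.
  move=> _ [y Ly <-]; apply: le_trans (Nc _); rewrite -mulrA ler_pM2l // ltW //.
  exact: far.
Qed.

(** Pigeonhole: the majorant grows by at most pi + pi / 2 * B in all, and a window that is not flat
    takes more than K h of it, where h is the spacing. With K = 4 + 2 B this leaves flat windows
    whose number times h is at least pi / 4. Windows start at every fourth grid point; a period has
    2 * 64^k cells at level k, a multiple of 4 only for k > 0, whence the level k.+1. *)
Lemma flat_count B k : (forall n, \sum_(j < n) eta j ^+ 2 <= B) ->
  2^-1 <= #|[pred i : 'I_(32 * 64 ^ k) | flat_at (4 + 2 * B) k.+1 (4 * i)]|%:R * spacing k.+1.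
Proof.
move=> HB; have h0 := spacing_gt0 k.+1.
have B0 : 0 <= B by have := HB 0%N; rewrite big_ord0.
set K := 4 + 2 * B; have K0 : 0 < K by rewrite /K; lra.
set n := (32 * 64 ^ k)%N; set h := spacing k.+1 in h0 *.
have nh : n%:R * h = pi / 2.
  by rewrite /n /h /spacing natrM -lam_nat lamS; field; rewrite lam_neq0.
pose M t := maj k.+2 t.
have W : \sum_(i < n) (M ((4 * i + 3)%:R * h) - M ((4 * i)%:R * h)) <= pi + pi / 2 * B.
  apply: (@le_trans _ _ (\sum_(i < n) (M ((4 * i.+1)%:R * h) - M ((4 * i)%:R * h)))).
    apply: ler_sum => i _; rewrite lerD2r maj_mono // ler_pM2r // ler_nat; lia.
  rewrite -(big_mkord xpredT (fun i => M ((4 * i.+1)%:R * h) - M ((4 * i)%:R * h))).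
  rewrite telescope_sumr // muln0 mul0r natrM -mulrA nh /M maj0 subr0.
  rewrite (_ : 4 * (pi / 2) = 2 * pi); last by field.
  by rewrite maj_2pi lerD2l ler_wpM2l // divr_ge0 // pi_ge0.
have S : \sum_(i < n) (K * h - (M ((4 * i + 3)%:R * h) - M ((4 * i)%:R * h))) <=
    #|[pred i : 'I_n | flat_at K k.+1 (4 * i)]|%:R * (K * h).
  rewrite -sum1_card natr_sum mulr_suml [leRHS]big_mkcond /=; apply: ler_sum => i _.
  rewrite inE /flat_at -/h -/(M _) -/(M _).
  case: ifP => [_|/negbT].
    by rewrite mul1r gerBl subr_ge0 maj_mono // ler_pM2r // ler_nat leq_addr.
  by rewrite -ltNge => /ltW; rewrite subr_le0.
move: S; rewrite sumrB sumr_const card_ord -mulr_natl => S.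
have S' : K * (n%:R * h) - (pi + pi / 2 * B) <= K * (#|[pred i : 'I_n | flat_at K k.+1 (4 * i)]|%:R * h).
  by have := le_trans _ S; move: W S; set X := \sum_(i < n) _; set Y := #|_|%:R; lra.
rewrite nh in S'.
have p2 := @pi_ge2 R.
rewrite mulr1 -(ler_pM2l K0); apply: le_trans S'; rewrite /K.
have : 0 <= B * (pi - 2) by rewrite mulr_ge0 // subr_ge0.
nra.
Qed.
End HsetBeta.

Lemma lam_between (x : R) : 1 <= x -> exists k, lam k <= x /\ x <= lam k.+1.
Proof.
move=> x1; have ex : exists n, x < lam n.
  have /andP[_ h] := truncn_itv (le_trans ler01 x1).
  exists (Num.truncn x).+1; apply: lt_le_trans h _; rewrite lam_nat ler_nat.
  by apply: ltnW; apply: ltn_expl.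
case: (ex_minnP ex) => -[|k] xk mn; first by move: xk; rewrite /lam expr0 ltNge x1.
by exists k; split; [rewrite leNgt; apply/negP => /mn; rewrite ltnn|exact: ltW].
Qed.

Lemma sum_lam_inv n : \sum_(k < n) (lam k)^-1 <= 2 - 2 * (lam n)^-1 :> R.
Proof.
elim: n => [|n IH]; first by rewrite big_ord0 /lam expr0 invr1 mulr1 subrr.
rewrite big_ord_recr /= lamS invfM; have : 0 < (lam n)^-1 :> R by rewrite invr_gt0 lam_gt0.
lra.
Qed.

(** It serves an enumeration of rectangles in which even indices carry the scales r <= 1 and odd
    indices the scales r >= 1. *)
Lemma sum_interleave (u w : nat -> R) n : (forall k, 0 <= u k) -> (forall k, 0 <= w k) ->
  \sum_(k < n) (if odd k then w k./2 else u k./2) <= \sum_(k < n) u k + \sum_(k < n) w k.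
Proof.
move=> u0 w0.
have mono (f : nat -> R) (i j : nat) : (forall k, 0 <= f k) -> (i <= j)%N ->
    \sum_(k < i) f k <= \sum_(k < j) f k.
  move=> f0 /subnKC <-; rewrite big_split_ord /= lerDl; exact: sumr_ge0.
have -> : \sum_(k < n) (if odd k then w k./2 else u k./2) =
    \sum_(k < uphalf n) u k + \sum_(k < n./2) w k.
  elim: n => [|n IH]; first by rewrite !big_ord0 addr0.
  rewrite big_ord_recr IH /= uphalf_half; case: (odd n) => /=.
    by rewrite add1n [X in _ = _ + X]big_ord_recr /= addrA.
  by rewrite add0n [X in _ = X + _]big_ord_recr /= addrAC.
by apply: lerD; apply: mono => //; lia.
Qed.

(** * The beta integrals *)

Section BallUnions.

Definition ball_union (n : nat) (p : nat -> 'rV[R]_5) (rho : R) : set (5.-tuple (measurableTypeR R)) :=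
  \big[setU/set0]_(i < n) tball (p i) rho.

Lemma ball_unionP n p rho t : ball_union n p rho t <-> exists2 i, (i < n)%N & tball (p i) rho t.
Proof.
rewrite /ball_union -(bigcup_mkord n (fun i => tball (p i) rho)); split => [[i] /= ? ?|[i ? ?]]; by exists i.
Qed.

Lemma measurable_ball_union n p rho : 0 <= rho -> measurable (ball_union n p rho).
Proof. by move=> r0; apply: bigsetU_measurable => i _; exact: measurable_tball. Qed.

Lemma lebesgue_ball_union n p rho : 0 <= rho ->
  (lebesgue_tuple (ball_union n p rho) <= (n%:R * (32 * rho ^+ 6))%:E)%E.
Proof.
move=> r0; have [m mE] := @lebesgue_tuple_sigma_finite_measure R 5.
have mb i : (i < n)%N -> measurable (tball (p i) rho) by move=> _; exact: measurable_tball.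
have mtb i : m (tball (p i) rho) = (32 * rho ^+ 6)%:E.
  exact: etrans (congr1 (@^~ (tball (p i) rho)) mE) (lebesgue_tball _ r0).
have := @Boole_inequality _ _ _ m (fun i => tball (p i) rho) n mb.
rewrite (eq_bigr (fun=> (32 * rho ^+ 6)%:E)) => [|i _]; last exact: mtb.
rewrite sumEFin sumr_const card_ord -[_ *+ n]mulr_natl.
by rewrite -(congr1 (@^~ (ball_union n p rho)) mE).
Qed.

End BallUnions.

Section FsetIntegral.
Variable N : 'rV[R]_5 -> R.
Hypothesis hN : homogeneous_norm (G := heisR2) N.
Local Notation d := (homogeneous_dist (G := heisR2) N).
Local Notation betaE := (@beta R heisR2 d).

(** For r near 1 / lam k, beta is at most K1 * eta k, and the net gives at most about (1 + sum_(j <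
    k) eta_j^2) lam k balls of radius about 1 / lam k. For r near lam k >= 1, beta is at most K2 / r
    on a neighborhood of volume about (lam k)^6, which contributes about 1 / lam k. *)
Lemma fset_beta_integral p : 2 < p ->
  (exists B, forall n, \sum_(k < n) eta k `^ p * (1 + \sum_(j < k) eta j ^+ 2) <= B) ->
  (beta_integral d fset p < +oo)%E.
Proof.
move=> p2 [B0 hB]; have pn0 : p != 0 by rewrite gt_eqF // (lt_trans _ p2).
have [K1 K10 small] := fset_beta_small hN; have [K2 K20 large] := fset_beta_large hN.
have [c c_gt0 Nc] := hn_lower hN.
have [P HP] := choice fset_net.
pose M k := maj k (2 * pi) * lam k.
have maj0 k : 0 <= maj k (2 * pi).
  by rewrite maj_2pi addr_ge0 ?pi_ge0 // mulr_ge0 ?divr_ge0 ?pi_ge0 ?sumr_ge0 // => i _; rewrite sqr_ge0.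
have M0 k : 0 <= M k by rewrite mulr_ge0 // ltW // lam_gt0.
pose n k := (Num.truncn (M k)).+1.
have nM k : (n k)%:R <= M k + 1 by rewrite /n -addn1 natrD lerD2r; rewrite truncn_le.
have net k t r rho : r <= c * (rho / lam k) -> 0 <= rho ->
    (exists2 z, fset z & d (row_of_tuple t) z < r) -> ball_union (n k) (P k) ((5 + rho) / lam k) t.
  move=> rr rho0 [z zf dz]; have [||i iM h] := HP k (row_of_tuple t) rho => //.
    exists z => //; rewrite -(ler_pM2l c_gt0); apply: le_trans (Nc _) _.
    by apply: le_trans (ltW dz) rr.
  apply/ball_unionP; exists i => //; rewrite /n ltnS -ltnS -(ltr_nat R).
  by apply: le_lt_trans iM _; have /andP[] := truncn_itv (M0 k).
pose f t r := betaE fset (@row_of_tuple R 5 t) r `^ p / r ^+ 6.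
have f0 t r : 0 < r -> 0 <= f t r.
  by move=> r0; rewrite /f divr_ge0 ?powR_ge0 // exprn_ge0 // ltW.
have fE t r : 0 < r -> f t r = 0 \/ exists2 z, fset z & d (row_of_tuple t) z < r.
  move=> r0; have [h|h] := pselect (exists2 z, fset z & d (row_of_tuple t) z < r); first by right.
  left; rewrite /f (beta_eq0 hN r0) ?powR0 ?mul0r //.
  by move=> z zf dz; apply: h; exists z.
have l0 := @lam_gt0 R.
have li0 k : 0 < (lam k)^-1 :> R by rewrite invr_gt0.
have lle k : lam k <= lam k.+1 :> R by rewrite lamS; have := l0 k; lra.
have ci0 : 0 < c^-1 by rewrite invr_gt0.
pose c1 k := (K1 * eta k) `^ p * lam k.+1 ^+ 6.
pose c2 k := (K2 / lam k) ^+ 2 / lam k ^+ 6.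
pose r1 k := (5 + c^-1) / lam k : R.
pose r2 k := 5 + lam k.+1 / c : R.
pose cc k := if odd k then c2 k./2 else c1 k./2.
pose aa k : R := if odd k then lam k./2 else (lam (k./2).+1)^-1.
pose bb k : R := if odd k then lam (k./2).+1 else (lam k./2)^-1.
(* For r >= 1 the net of level 0 is enough, where lam 0 = 1. *)
pose NN k := if odd k then ball_union (n 0%N) (P 0%N) (r2 k./2) else ball_union (n k./2) (P k./2) (r1 k./2).
pose vv k := if odd k then (n 0%N)%:R * (32 * r2 k./2 ^+ 6) else (n k./2)%:R * (32 * r1 k./2 ^+ 6).
have r10 k : 0 <= r1 k by rewrite /r1 mulr_ge0 ?ltW // addr_gt0.
have r20 k : 0 <= r2 k by rewrite /r2 addr_ge0 // mulr_ge0 ?ltW.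
have [m mE] := @lebesgue_tuple_sigma_finite_measure R 5.
pose u k := K1 `^ p * 64 ^+ 6 * 32 * (5 + c^-1) ^+ 6 * 5 * (eta k `^ p * (1 + \sum_(j < k) eta j ^+ 2)).
pose w k := K2 ^+ 2 * 64 * 32 * (5 + 64 / c) ^+ 6 * 5 * (lam k)^-1.
have S0 k : 0 <= \sum_(j < k) eta j ^+ 2 by apply: sumr_ge0 => i _; rewrite sqr_ge0.
have q10 : 0 <= 5 + c^-1 by rewrite addr_ge0 // ltW.
have q20 : 0 <= 5 + 64 / c by rewrite addr_ge0 // mulr_ge0 // ltW.
have cu0 : 0 <= K1 `^ p * 64 ^+ 6 * 32 * (5 + c^-1) ^+ 6 * 5.
  by rewrite !mulr_ge0 ?powR_ge0 ?exprn_ge0.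
have cw0 : 0 <= K2 ^+ 2 * 64 * 32 * (5 + 64 / c) ^+ 6 * 5.
  by rewrite !mulr_ge0 ?exprn_ge0 ?(ltW K20).
have u0 k : 0 <= u k.
  by apply: mulr_ge0 => //; rewrite mulr_ge0 ?powR_ge0 // addr_ge0.
have w0 k : 0 <= w k by apply: mulr_ge0 => //; exact: ltW.
pose B := K1 `^ p * 64 ^+ 6 * 32 * (5 + c^-1) ^+ 6 * 5 * B0 + K2 ^+ 2 * 64 * 32 * (5 + 64 / c) ^+ 6 * 5 * 2.
suff : (\int[m]_t \int[lebesgue_measure]_(r in `]0%R, +oo[) (f t r)%:E <= B%:E)%E.
  by rewrite mE => h; apply: le_lt_trans h _; rewrite ltry.
apply: (@double_integral_le R _ _ m cc aa bb NN _ _ _ _ f vv).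
- move=> k; rewrite /cc; case: ifP => _.
    by rewrite divr_ge0 ?exprn_ge0 // ?mulr_ge0 ?ltW.
  by rewrite mulr_ge0 ?powR_ge0 // exprn_ge0 // ltW.
- by move=> k; rewrite /aa; case: ifP.
- move=> k; rewrite /aa /bb; case: ifP => _.
    exact: lle.
  by rewrite lef_pV2 ?posrE.
- by move=> k; rewrite /NN; case: ifP => _; exact: measurable_ball_union.
- exact: f0.
- move=> t r r0; have [->|hz] := fE t r r0; first by left.
  right; have b0 := beta_ge0 hN fset (row_of_tuple t) r0; have b1 := beta_le1 hN fset (row_of_tuple t) r0.
  have [r1'|r1'] := leP r 1.
    have [|k [k1 k2]] := @lam_between r^-1; first by rewrite invf_ge1.
    have h1 : (lam k.+1)^-1 <= r by rewrite -[r]invrK lef_pV2 ?posrE ?invr_gt0.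
    have h2 : r <= (lam k)^-1 by rewrite -[r]invrK lef_pV2 ?posrE ?invr_gt0.
    exists k.*2; rewrite /NN /aa /bb /cc odd_double doubleK; split.
    + apply: net hz; last exact: ltW.
      by rewrite mulrA divff ?gt_eqF // mul1r.
    + by rewrite h1 h2.
    + rewrite /f /c1; apply: ler_pM; rewrite ?powR_ge0 ?invr_ge0 ?exprn_ge0 // ?(ltW r0) //.
        apply: ge0_ler_powR; rewrite ?nnegrE ?(ltW (lt_trans _ p2)) //.
        by rewrite mulr_ge0 // ltW.
        exact: small.
      rewrite -exprVn; apply: lerXn2r; rewrite ?nnegrE ?invr_ge0 ?(ltW r0) ?(ltW (l0 _)) //.
  have [|k [k1 k2]] := @lam_between r; first exact: ltW.
  exists k.*2.+1; rewrite /NN /aa /bb /cc /= odd_double /= uphalf_double; split.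
  + have -> : r2 k = (5 + lam k.+1 / c) / lam 0 by rewrite /lam expr0 divr1.
    apply: net hz; last by rewrite mulr_ge0 // ltW.
    by rewrite {2}/lam expr0 divr1 mulrCA divff ?gt_eqF // mulr1.
  + by rewrite k1 k2.
  + rewrite /f /c2; apply: ler_pM; rewrite ?powR_ge0 ?invr_ge0 ?exprn_ge0 // ?(ltW r0) //.
      (* As beta <= 1 and p > 2, the exponent may be lowered to 2, which suffices for convergence at
         large scales. *)
      apply: le_trans (_ : betaE fset (row_of_tuple t) r `^ 2 <= _).
        have [->|bn] := eqVneq (betaE fset (row_of_tuple t) r) 0.
          by rewrite !powR0 // pnatr_eq0.
        by apply: ger_powR; rewrite ?lt_def ?bn ?b0 ?b1 // ltW.
      rewrite powR_mulrn //; apply: lerXn2r; rewrite ?nnegrE //.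
        by rewrite mulr_ge0 // ltW.
      apply: le_trans (large _ _ r0) _; rewrite ler_pM2l // lef_pV2 ?posrE //.
    by rewrite lef_pV2 ?posrE ?exprn_gt0 //; apply: lerXn2r => //; rewrite nnegrE ltW.
- by move=> k; rewrite mE /NN /vv; case: ifP => _; exact: lebesgue_ball_union.
move=> q; apply: le_trans (_ : \sum_(k < q) (if odd k then w k./2 else u k./2) <= _).
  apply: ler_sum => k _; rewrite /cc /bb /aa /vv; case: ifP => _.
    set j := k./2; have L0 := l0 j; have L1 := @lam_ge1 R j.
    apply: le_trans (_ : c2 j * (64 * lam j) * (5 * (32 * (lam j * (5 + 64 / c)) ^+ 6)) <= _).
      apply: ler_pM.
      + by rewrite mulr_ge0 ?subr_ge0 // divr_ge0 ?sqr_ge0 // exprn_ge0 // ltW.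
      + by rewrite mulr_ge0 // mulr_ge0 // exprn_ge0.
      + apply: ler_wpM2l; first by rewrite divr_ge0 ?sqr_ge0 // exprn_ge0 // ltW.
        by rewrite lamS; lra.
      + apply: ler_pM => //; first by rewrite mulr_ge0 // exprn_ge0.
          apply: le_trans (nM 0%N) _; rewrite /M maj_2pi big_ord0 mulr0 addr0 /lam expr0 mulr1.
          by have := @pi_lt4 R; lra.
        rewrite ler_pM2l //; apply: lerXn2r; rewrite ?nnegrE ?r20 // ?mulr_ge0 // ?(ltW L0) //.
        rewrite /r2 lamS mulrDr; apply: lerD; first by lra.
        by rewrite -mulrA mulrCA.
    have Ln : lam j != 0 by rewrite gt_eqF.
    by rewrite /c2 /w le_eqVlt; apply/orP; left; apply/eqP; field; rewrite Ln gt_eqF.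
  set j := k./2; have L0 := l0 j; have L1 := @lam_ge1 R j.
  apply: le_trans (_ : c1 j * (lam j)^-1 * (5 * (1 + \sum_(i < j) eta i ^+ 2) * lam j * (32 * r1 j ^+ 6)) <= _).
    apply: ler_pM.
    + rewrite mulr_ge0 ?subr_ge0 ?lef_pV2 ?posrE //.
      by rewrite mulr_ge0 ?powR_ge0 // exprn_ge0 // ltW.
    + by rewrite mulr_ge0 // mulr_ge0 // exprn_ge0.
    + apply: ler_wpM2l; first by rewrite mulr_ge0 ?powR_ge0 // exprn_ge0 // ltW.
      by have := li0 j.+1; lra.
    + apply: ler_wpM2r; first by rewrite mulr_ge0 // exprn_ge0.
      apply: le_trans (nM j) _; rewrite /M maj_2pi.
      have := @pi_lt4 R; move: (S0 j); set S := \sum_(i < j) _ => S0' p4.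
      have : pi / 2 * S <= 2 * S by apply: ler_wpM2r => //; lra.
      have := ler_wpM2r (ltW L0).
      move=> /(_ (pi + pi / 2 * S) (4 + 2 * S)) h1 h2.
      have /h1 : pi + pi / 2 * S <= 4 + 2 * S by lra.
      have : 0 <= S * lam j by rewrite mulr_ge0 // ltW.
      by nra.
  have Ln : lam j != 0 by rewrite gt_eqF.
  rewrite /c1 /u /r1 lamS (powRM _ (ltW K10) (ltW (eta_gt0 j))).
  by rewrite le_eqVlt; apply/orP; left; apply/eqP; field; rewrite Ln gt_eqF.
apply: le_trans (sum_interleave q u0 w0) _; rewrite /B -!mulr_sumr.
apply: lerD; apply: ler_wpM2l => //.
by apply: le_trans (sum_lam_inv q) _; have := li0 q; lra.
Qed.
End FsetIntegral.

Lemma mul4_leq (i j : nat) : (4 * i < 4 * j + 3)%N -> (i <= j)%N. Proof. lia. Qed.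

Lemma mul4_ltn (i m : nat) : (i < 32 * m)%N -> (4 * i + 3 <= 128 * m)%N. Proof. lia. Qed.

Section HsetIntegral.
Variable N : 'rV[R]_5 -> R.
Hypothesis hN : homogeneous_norm (G := heisR2) N.
Local Notation d := (homogeneous_dist (G := heisR2) N).
Local Notation betaE := (@beta R heisR2 d).

(** Write h for the spacing. The balls of radius h at the starts of the flat windows number at least
    1 / (2 h), and each has volume 32 h^6. With r between A h and 2 A h, the level k contributes at
    least a fixed multiple of eta_(k+1)^(p/2). The larger exponent p is nonnegative, which p1 need
    not be. *)
Lemma hset_beta_integral p1 p B0 : p1 <= p -> 0 <= p ->
  (forall n, \sum_(j < n) eta j ^+ 2 <= B0) ->
  (forall B, exists n, B < \sum_(k < n) eta k.+1 `^ (p / 2)) ->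
  beta_integral d hset p1 = +oo%E.
Proof.
move=> p1p p0 hB0 dv.
have B00 : 0 <= B0 by have := hB0 0%N; rewrite big_ord0.
have [|A [c [A0 c_0 low]]] := @hset_beta_lower N hN (4 + 2 * B0); first by lra.
pose h k := spacing k.+1.
have h0 k : 0 < h k by exact: spacing_gt0.
pose f t r := betaE hset (@row_of_tuple R 5 t) r `^ p1 / r ^+ 6.
have f0 t r : 0 < r -> 0 <= f t r.
  by move=> r0; rewrite /f divr_ge0 ?powR_ge0 // exprn_ge0 // ltW.
pose cc k := c `^ p * eta k.+1 `^ (p / 2) / (2 * A * h k) ^+ 6.
pose aa k := A * h k.
pose bb k := 2 * A * h k.
pose fl k := [pred i : 'I_(32 * 64 ^ k) | flat_at (4 + 2 * B0) k.+1 (4 * i)].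
pose ball k (i : 'I_(32 * 64 ^ k)) := tball (hcurve ((4 * i)%N%:R * h k)) (h k).
pose NN k := \big[setU/set0]_(i < 32 * 64 ^ k | fl k i) ball k i.
pose vv k := #|fl k|%:R * (32 * h k ^+ 6).
have [m mE] := @lebesgue_tuple_sigma_finite_measure R 5.
have mball k i : measurable (ball k i) by apply: measurable_tball; exact: ltW.
have aa0 k : 0 < aa k by exact: mulr_gt0.
have bb0 k : 0 < bb k by rewrite mulr_gt0 // mulr_gt0.
have ab k : aa k <= bb k by rewrite /bb -mulrA ler_peMl ?ltW // ltr1n.
have cc0 k : 0 <= cc k.
  by rewrite divr_ge0 ?exprn_ge0 ?(ltW (bb0 k)) // mulr_ge0 ?powR_ge0.
have mNN k : measurable (NN k) by apply: bigsetU_measurable => i _.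
have v0 k : 0 <= vv k by apply: mulr_ge0 => //; apply: mulr_ge0 => //; rewrite exprn_ge0 // ltW.
have vE k : ((vv k)%:E <= m (NN k))%E.
  rewrite /NN (measure_bigsetU_ord_cond m) //; last first.
    (* The balls are disjoint: consecutive centers are 4 h apart in the first coordinate, and the
       radii are h. *)
    move=> i j _ _ [t [ti tj]].
    have c0E (x : 'I_(32 * 64 ^ k)) : ball k x t -> `|tnth t c0 - (4 * x)%:R * h k| <= h k.
      rewrite /ball /tball /= => /(maxnorm_cgsub_leP _ _ (ltW (h0 k)))[+ _ _ _ _].
      by rewrite row_of_tupleE /hcurve pt5E.
    have := c0E _ ti; have := c0E _ tj; rewrite !ler_distl => /andP[j1 j2] /andP[i1 i2].
    have hk := h0 k.
    have ij : (4 * i)%:R < (4 * j)%:R + 3 :> R by rewrite -(ltr_pM2r hk) mulrDl; lra.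
    have ji : (4 * j)%:R < (4 * i)%:R + 3 :> R by rewrite -(ltr_pM2r hk) mulrDl; lra.
    apply: val_inj; move: ij ji; rewrite -!(natrD _ _ 3) !ltr_nat => ij ji.
    by apply/eqP; rewrite eqn_leq (mul4_leq ij) (mul4_leq ji).
  rewrite (eq_bigr (fun=> (32 * h k ^+ 6)%:E)) => [|i _]; last first.
    exact: etrans (congr1 (@^~ (ball k i)) mE) (lebesgue_tball _ (ltW (h0 k))).
  by rewrite sumEFin sumr_const /vv mulr_natl.
have ba k : bb k.+1 < aa k.
  have -> : bb k.+1 = aa k / 32.
    by rewrite /bb /aa /h /spacing (@lamS R k.+1); field; rewrite lam_neq0.
  by have := aa0 k; lra.
have fc k t r : NN k t -> aa k <= r <= bb k -> cc k <= f t r.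
  move=> Nt /andP[r1 r2].
  have [i fi ti] : exists2 i, fl k i & ball k i t.
    by move: Nt; rewrite /NN; elim/big_rec: _ => // i X fi IH [ti|/IH //]; exists i.
  have r0 : 0 < r := lt_le_trans (aa0 k) r1.
  have b1 := beta_le1 hN hset (row_of_tuple t) r0.
  have bl : c * Num.sqrt (eta k.+1) <= betaE hset (row_of_tuple t) r.
    apply: (low k.+1 (4 * i)%N) => //.
    have -> : 2 * pi = (128 * 64 ^ k)%:R * spacing k.+1.
      rewrite /spacing lamS lam_nat natrM; field; rewrite -lam_nat; exact: lam_neq0.
    rewrite ler_pM2r ?spacing_gt0 // ler_nat; exact: mul4_ltn (ltn_ord i).
  have c1 : 0 < c * Num.sqrt (eta k.+1) by rewrite mulr_gt0 // sqrtr_gt0.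
  have b0 := lt_le_trans c1 bl.
  rewrite /cc /f; apply: ler_pM.
  - by rewrite mulr_ge0 // powR_ge0.
  - by rewrite invr_ge0 exprn_ge0 // ltW // bb0.
  - apply: le_trans (_ : betaE hset (row_of_tuple t) r `^ p <= _).
      have -> : c `^ p * eta k.+1 `^ (p / 2) = (c * Num.sqrt (eta k.+1)) `^ p.
        by rewrite -powR12_sqrt ?(ltW (eta_gt0 _)) // powRM ?powR_ge0 ?(ltW c_0) // -powRrM [2^-1 * p]mulrC.
      by apply: ge0_ler_powR; rewrite ?nnegrE // ltW.
    (* Here beta lies in (0, 1], so passing from p to the smaller p1 does not decrease the power. *)
    by apply: ger_powR; rewrite ?b0.
  - by rewrite lef_pV2 ?posrE ?exprn_gt0 ?bb0 //; apply: lerXn2r; rewrite ?nnegrE // ltW // bb0.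
have Bn n : ((\sum_(k < n) cc k * (bb k - aa k) * vv k)%:E <= beta_integral d hset p1)%E.
  have := @double_integral_ge R _ _ m cc aa bb NN cc0 aa0 ab mNN f vv n f0 fc ba v0 vE.
  by rewrite mE.
have cp0 : 0 < c `^ p by rewrite powR_gt0.
(* The rectangle of index k contributes c^p / (2 A^5) * eta_(k+1)^(p/2) times the number of flat
   windows times h, and the latter product is at least 1 / 2. *)
pose C := c `^ p / (4 * A ^+ 5).
have C0 : 0 < C by rewrite divr_gt0 // mulr_gt0 // exprn_gt0.
apply: eq_infty => B; have [n Bn'] := dv (B / C).
apply: le_trans (Bn n); rewrite lee_fin.
rewrite ltr_pdivrMr // mulr_suml in Bn'; apply: le_trans (ltW Bn') _.
apply: ler_sum => k _; rewrite mulrC.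
have fc' : 2^-1 <= #|fl k|%:R * h k := flat_count k hB0.
have -> : cc k * (bb k - aa k) * vv k = C * eta k.+1 `^ (p / 2) * (2 * (#|fl k|%:R * h k)).
  have hn : h k != 0 by rewrite gt_eqF.
  have An : A != 0 by rewrite gt_eqF.
  by rewrite /cc /bb /aa /vv /C; field; rewrite An hn.
have h2 : 1 <= 2 * (#|fl k|%:R * h k) by rewrite mulrC -ler_pdivrMr // mul1r.
by apply: ler_peMr => //; rewrite mulr_ge0 ?powR_ge0 ?(ltW C0).
Qed.
End HsetIntegral.

End Lacunary.

(** * Power weights *)

Section PSeries.
Context {R : realType}.

(** This is x^(-t) >= 1 + t (1 - x) at x = (j + 1) / (j + 2), from ln x <= x - 1 and e^y >= 1 + y;
    it takes the place of the integral comparison for the series. *)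
Lemma powR_telescope (t : R) (j : nat) : 0 < t ->
  t * j.+2%:R `^ (- (1 + t)) <= j.+1%:R `^ (- t) - j.+2%:R `^ (- t).
Proof.
move=> t0; have j1 : 0 < j.+1%:R :> R by rewrite ltr0n.
have j2 : 0 < j.+2%:R :> R by rewrite ltr0n.
pose x : R := j.+1%:R / j.+2%:R; have x0 : 0 < x by rewrite divr_gt0.
have -> : j.+1%:R `^ (- t) = j.+2%:R `^ (- t) * x `^ (- t).
  by rewrite -powRM ?(ltW j2) ?(ltW x0) // /x mulrCA divff ?gt_eqF // mulr1.
have -> : j.+2%:R `^ (- (1 + t)) = j.+2%:R `^ (- t) * j.+2%:R^-1.
  rewrite -(powR_inv1 (ltW j2)) -powRD ?pnatr_eq0 ?implybT //.
  by congr (_ `^ _); ring.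
have xt : 1 + t * j.+2%:R^-1 <= x `^ (- t).
  rewrite /powR gt_eqF //; apply: le_trans (expR_ge1Dx _).
  rewrite lerD2l mulNr -mulrN; apply: ler_wpM2l; first exact: ltW.
  have : ln x <= x - 1.
    by have := @le_ln1Dx R (x - 1); rewrite [1 + _]addrC subrK; apply; lra.
  have -> : x - 1 = - j.+2%:R^-1.
    have e : j.+1%:R = j.+2%:R - 1 :> R by rewrite -[j.+2%:R]natr1 addrK.
    by rewrite /x e; field; rewrite gt_eqF.
  by rewrite lerNr.
rewrite mulrCA -subr_ge0.
have -> : j.+2%:R `^ (- t) * x `^ (- t) - j.+2%:R `^ (- t) - j.+2%:R `^ (- t) * (t / j.+2%:R) =
  j.+2%:R `^ (- t) * (x `^ (- t) - (1 + t * j.+2%:R^-1)) by ring.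
by rewrite mulr_ge0 ?powR_ge0 // subr_ge0.
Qed.

Lemma p_series_bounded (s : R) : 1 < s -> exists B, forall n, \sum_(j < n) j.+1%:R `^ (- s) <= B.
Proof.
move=> s1; pose t := s - 1; have t0 : 0 < t by rewrite subr_gt0.
exists (1 + t^-1) => -[|n]; first by rewrite big_ord0 addr_ge0 // invr_ge0 ltW.
suff h : \sum_(j < n.+1) (j.+1%:R : R) `^ (- s) <= 1 + t^-1 * (1 - n.+1%:R `^ (- t)).
  by apply: le_trans h _; rewrite lerD2l ler_piMr ?invr_ge0 ?(ltW t0) // lerBlDr lerDl powR_ge0.
elim: n => [|n IH]; first by rewrite big_ord_recl big_ord0 !powR1 subrr mulr0.
rewrite big_ord_recr /=; have := powR_telescope n t0.
rewrite (_ : 1 + t = s); last by rewrite /t addrC subrK.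
rewrite -(ler_pM2l (_ : 0 < t^-1)) ?invr_gt0 // mulrA mulVf ?gt_eqF // mul1r; move: IH; lra.
Qed.

Lemma harmonic_unbounded (B : R) : exists n, B < \sum_(j < n) j.+1%:R^-1.
Proof.
apply: contrapT => h; apply: (@dvg_harmonic R).
have ub n : series harmonic n <= B.
  by rewrite leNgt; apply/negP => ?; apply: h; exists n; rewrite -(big_mkord xpredT (fun j => j.+1%:R^-1)).
apply: nondecreasing_is_cvgn; first by apply: nondecreasing_series => n _ _; rewrite invr_ge0.
by exists B => _ [n _ <-].
Qed.

(* From 1 / (j+1) <= (n+1)^t (j+1)^(-1-t). *)
Lemma harmonic_growth (t : R) : 0 < t -> exists2 B, 0 <= B &
  forall n, \sum_(j < n) j.+1%:R^-1 <= n.+1%:R `^ t * B.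
Proof.
move=> t0; have [|B hB] := @p_series_bounded (1 + t); first by lra.
exists B; first by have := hB 0%N; rewrite big_ord0.
move=> n; apply: le_trans (_ : n.+1%:R `^ t * \sum_(j < n) j.+1%:R `^ (- (1 + t)) <= _); last first.
  by rewrite ler_wpM2l ?powR_ge0.
rewrite mulr_sumr; apply: ler_sum => j _.
have j0 : 0 < (j.+1)%:R :> R by rewrite ltr0n.
have -> : j.+1%:R^-1 = j.+1%:R `^ t * j.+1%:R `^ (- (1 + t)) :> R.
  by rewrite -(powR_inv1 (ltW j0)) -powRD ?pnatr_eq0 ?implybT //; congr (_ `^ _); ring.
apply: ler_wpM2r; first exact: powR_ge0.
apply: ge0_ler_powR; rewrite ?nnegrE ?(ltW t0) //.
by rewrite ler_nat ltnS ltnW.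
Qed.

Definition power_weights (a : R) (j : nat) : R := j.+1%:R `^ (- a).

Lemma power_weights_gt0 a j : 0 < power_weights a j.
Proof. by rewrite powR_gt0. Qed.

Lemma power_weights_le1 a j : 0 <= a -> power_weights a j <= 1.
Proof. by move=> a0; rewrite -[leRHS](powRr0 j.+1%:R) ler_powR ?ler1n // oppr_le0. Qed.

Lemma power_weights_dec a j : 0 <= a -> power_weights a j.+1 <= power_weights a j.
Proof.
move=> a0; rewrite /power_weights !powRN lef_pV2 ?posrE ?powR_gt0 //.
by apply: ge0_ler_powR; rewrite ?nnegrE // ler_nat.
Qed.

Lemma power_weights_slow a j : 0 <= a <= 1 -> power_weights a j <= 2 * power_weights a j.+1.
Proof.
move=> /andP[a0 a1]; rewrite /power_weights !powRN.
rewrite ler_pdivlMr ?powR_gt0 // mulrC ler_pdivrMr ?powR_gt0 //.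
apply: le_trans (_ : (2 * j.+1%:R) `^ a <= _).
  by apply: ge0_ler_powR; rewrite ?nnegrE ?mulr_ge0 // -natrM ler_nat; lia.
rewrite powRM //; apply: ler_wpM2r; first exact: powR_ge0.
by rewrite -[leRHS]powRr1 // ler_powR // ler1n.
Qed.

Lemma power_weights_powR a p j : power_weights a j `^ p = j.+1%:R `^ (- (a * p)).
Proof. by rewrite /power_weights -powRrM mulNr. Qed.

Lemma power_weights_sqr a j : power_weights a j ^+ 2 = j.+1%:R `^ (- (a * 2)).
Proof. by rewrite -power_weights_powR powR_mulrn // ltW // power_weights_gt0. Qed.

End PSeries.

Lemma exists_hset (R : realType) (N : 'rV[R]_5 -> R) (p : R) :
  homogeneous_norm (G := heisR2) N -> p < 4 ->
  exists E, [/\ compact_curve E, rectifiable (homogeneous_dist (G := heisR2) N) E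
    & beta_integral (homogeneous_dist (G := heisR2) N) E p = +oo%E].
Proof.
(* With a = 2 / q, the squares of eta are summable because q < 4, the powers eta^(q/2) are the
   harmonic terms, and q >= 2 gives a <= 1, as slow decay requires. *)
move=> hN p4; pose q := Num.max p 2; pose a := 2 / q.
have q2 : 2 <= q by rewrite le_max lexx orbT.
have q4 : q < 4 by rewrite gt_max p4 ltr_nat.
have q0 : 0 < q by lra.
have a01 : 0 <= a <= 1 by rewrite /a divr_ge0 ?(ltW q0) // ler_pdivrMr // mul1r.
have /andP[a0 _] := a01.
pose eta := power_weights a.
have g0 := power_weights_gt0 a; have l1 j := power_weights_le1 j a0.
have dc j := power_weights_dec j a0; have sl j := power_weights_slow j a01.
have [|B hB] := @p_series_bounded R (a * 2).
  by rewrite /a mulrAC ltr_pdivlMr // mul1r; lra.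
have hB' n : \sum_(j < n) eta j ^+ 2 <= B.
  by under eq_bigr do rewrite /eta power_weights_sqr; exact: hB.
exists (hset eta); split.
- exact: hset_compact_curve.
- exact: hset_rectifiable hB'.
apply: (@hset_beta_integral R eta g0 l1 dc sl N hN p q B) => //.
- by rewrite le_max lexx.
- exact: ltW.
(* The sum runs over eta_(k+1), so the first harmonic term, which is 1, is lost; hence b + 1 and
   n.-1. *)
move=> b; have [n hn] := harmonic_unbounded (b + 1); exists n.-1.
case: n hn => [|n]; first by rewrite big_ord0 big_ord0; lra.
rewrite big_ord_recl /= invr1 [b + 1]addrC ltrD2l => hn.
apply: lt_le_trans hn _; apply: ler_sum => i _.
rewrite /eta power_weights_powR (_ : a * (q / 2) = 1); first by rewrite powR_inv1 // lift0.
by rewrite /a; field; rewrite gt_eqF.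
Qed.

Lemma exists_fset (R : realType) (N : 'rV[R]_5 -> R) (p : R) :
  homogeneous_norm (G := heisR2) N -> 2 < p ->
  exists E, [/\ compact_curve E, ~ rectifiable (homogeneous_dist (G := heisR2) N) E
    & (beta_integral (homogeneous_dist (G := heisR2) N) E p < +oo)%E].
Proof.
move=> hN p2; pose a : R := 2^-1; have a01 : 0 <= a <= 1 by rewrite /a; apply/andP; split; lra.
have /andP[a0 _] := a01.
pose eta := power_weights a.
have g0 := power_weights_gt0 a; have l1 j := power_weights_le1 j a0.
have dc j := power_weights_dec j a0; have sl j := power_weights_slow j a01.
have sqE n : \sum_(j < n) eta j ^+ 2 = \sum_(j < n) j.+1%:R^-1.
  by apply: eq_bigr => j _; rewrite /eta power_weights_sqr /a mulVf ?pnatr_eq0 // powR_inv1.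
exists (fset eta); split.
- exact: fset_compact_curve.
- apply: (fset_not_rectifiable g0 dc hN) => b.
  by have [n hn] := harmonic_unbounded b; exists n; rewrite sqE.
apply: (@fset_beta_integral R eta g0 l1 dc sl N hN) => //.
(* Then p / 2 = 1 + 2 t: the growth (k + 1)^t of the harmonic sums uses up half of the excess, and
   the exponent 1 + t that remains is still summable. *)
pose t := (p / 2 - 1) / 2; have t0 : 0 < t by rewrite /t; lra.
have [B B0 hB] := harmonic_growth t0.
have [|D hD] := @p_series_bounded R (1 + t); first by lra.
exists ((1 + B) * D) => n; apply: le_trans (ler_wpM2l _ (hD n)); last by lra.
rewrite mulr_sumr; apply: ler_sum => k _.
have k1 : 1 <= k.+1%:R :> R by rewrite ler1n.
have kt : 1 <= k.+1%:R `^ t :> R.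
  by rewrite -[leLHS](powRr0 k.+1%:R) ler_powR // ltW.
rewrite sqE /eta power_weights_powR.
have -> : k.+1%:R `^ (- (1 + t)) = k.+1%:R `^ (- (a * p)) * k.+1%:R `^ t.
  by rewrite -powRD ?pnatr_eq0 ?implybT //; congr (_ `^ _); rewrite /t /a; field.
rewrite mulrCA; apply: ler_wpM2l; first exact: powR_ge0.
rewrite mulrDl mul1r; apply: lerD => //.
by rewrite mulrC; exact: hB.
Qed.

Theorem proposition1p4 (R : realType) :
  exists G : carnotGroup R,
    (exists N : 'rV[R]_(cg_dim G) -> R, homogeneous_norm N) /\
    forall N : 'rV[R]_(cg_dim G) -> R, homogeneous_norm N ->
      hausdorff_dim (homogeneous_dist N) setT = 6%:E /\
      forall p1 p2 : R, p1 < 4 -> 2 < p2 ->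
        exists E1 E2 : set ('rV[R]_(cg_dim G)),
          [/\ compact_curve E1 /\ compact_curve E2,
              rectifiable (homogeneous_dist N) E1,
              ~ rectifiable (homogeneous_dist N) E2,
              beta_integral (homogeneous_dist N) E1 p1 = +oo%E
            & (beta_integral (homogeneous_dist N) E2 p2 < +oo)%E].
Proof.
exists heisR2; split; first by exists maxnorm; exact: maxnorm_homogeneous.
move=> N hN; split; first exact: hausdorff_dim_heisR2.
move=> p1 p2 p14 p22; have [E1 [c1 r1 b1]] := exists_hset hN p14.
have [E2 [c2 r2 b2]] := exists_fset hN p22.
by exists E1, E2.
Qed.
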